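(* Let $(X,d)$ be a metric space, $P\subseteq X$ a set of $n$ points, $1\le k\le n$, $\alpha\ge 1$, $t\ge 1$ an integer and $\varepsilon\in(0,1)$. Run the following procedure with the $k$-median cost $\mathrm{cost}(S)=\sum_{x\in P}d(x,S)$. Step 0 (critical balls): set $Z\leftarrow P$, $\mathcal{C}^*\leftarrow\emptyset$; while $Z\neq\emptyset$: choose $c\in Z$ minimizing $r_k(c)$ (ties arbitrary), add $c$ to $\mathcal{C}^*$, and set $Z\leftarrow\{x\in Z: d(x,c)>6\alpha\, r_k(x)\}$. Let $\mathcal{B}=\{B(c,\alpha r_k(c)): c\in\mathcal{C}^*\}$ and call $S\subseteq P$ feasible if $S\cap B\neq\emptyset$ for every $B\in\mathcal{B}$. Step I (initialization): $S'\leftarrow\mathcal{C}^*$; then $k-|\mathcal{C}^*|$ times, add to $S'$ a point $z\in P\setminus S'$ maximizing $d(z,S')$. Step II (local search): repeatedly, with current set $S$, search over all $i\in\{1,\dots,t\}$ and all $T_1\subseteq S$, $T_2\subseteq P\setminus S$ with $|T_1|=|T_2|=i$ for a set $S'=(S\cup T_2)\setminus T_1$ that is feasible and satisfies $\mathrm{cost}(S')\le(1-\varepsilon)\mathrm{cost}(S)$; if one is found, replace $S$ by $S'$ (one iteration) and repeat; otherwise output $S$. Then the local search stops after $O(\log n/\varepsilon)$ iterations, and the total running time is $\tilde O\big((kn)^{t+1}\varepsilon^{-1}\big)$ (with unit-cost distance evaluations).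
   Context: For $x\in P$, $r\ge0$: $B(x,r)=\{y\in P:d(x,y)\le r\}$; $d(x,Y)=\min_{y\in Y}d(x,y)$. The fair radius is $r_k(x)=\min\{r\ge0:|B(x,r)|\ge n/k\}$. $\tilde O$ hides polylogarithmic factors. *)

(* Defs.v *)
From HB Require Import structures.
From mathcomp Require Import all_boot all_order all_algebra finmap.
From mathcomp Require Import all_classical all_reals all_analysis.

Set Implicit Arguments.
Unset Strict Implicit.
Unset Printing Implicit Defensive.

Import Order.TTheory GRing.Theory Num.Theory.
Local Open Scope fset_scope.
Local Open Scope ring_scope.

(** ** The clustering procedure *)

Section Procedure.
Context {R : realType} {X : metricType R}.
Implicit Types (P S Z C Cs : {fset X}) (x c z : X).

Definition cball P x (r : R) : {fset X} := [fset y in P | mdist x y <= r].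

(* The minimum over a nonempty [S] : the unit of the iterated minimum is the
   distance to the first element of [S]. *)
Definition dist_to x S : R :=
  \big[Num.min/mdist x (head x (enum_fset S))]_(y <- S) mdist x y.

Definition cost P S : R := \sum_(x <- P) dist_to x S.

(* The infimum is attained when [x \in P] and [0 < k], since then the set is
   nonempty and [cball P x] is a step function that is constant on intervals
   closed on the left. *)
Definition fair_radius P (k : nat) x : R :=
  inf [set r : R | 0 <= r /\
    (#|` P|%:R / k%:R : R) <= #|` cball P x r|%:R]%classic.

(* [critical_loop P k alpha Z C Cs] : the selection of critical centers,
   entered with remaining points [Z] and current centers [C], can end with
   [Cs] (ties between minimizers are broken arbitrarily). *)
Inductive critical_loop P (k : nat) (alpha : R) :
    {fset X} -> {fset X} -> {fset X} -> Prop :=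
| critical_stop C : critical_loop P k alpha fset0 C C
| critical_step Z C Cs c :
    c \in Z ->
    (forall x, x \in Z -> fair_radius P k c <= fair_radius P k x) ->
    critical_loop P k alpha
      [fset x in Z | 6 * alpha * fair_radius P k x < mdist x c] (c |` C) Cs ->
    critical_loop P k alpha Z C Cs.

Definition critical_centers P k alpha Cs : Prop :=
  critical_loop P k alpha P fset0 Cs.

Definition feasible P k alpha Cs S : Prop :=
  S `<=` P /\
  forall c, c \in Cs -> S `&` cball P c (alpha * fair_radius P k c) != fset0.

(* [farthest_loop P m S S'] : [m] rounds of farthest-point insertion
   started from [S] can end with [S']. *)
Inductive farthest_loop P : nat -> {fset X} -> {fset X} -> Prop :=
| farthest_stop S : farthest_loop P 0 S S
| farthest_step m S S' z :
    z \in P `\` S ->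
    (forall x, x \in P `\` S -> dist_to x S <= dist_to z S) ->
    farthest_loop P m (z |` S) S' ->
    farthest_loop P m.+1 S S'.

(* The truncated subtraction is harmless: the balls around the critical centers
   are disjoint and hold at least [#|` P| / k] points each, so there are at
   most [k] centers. *)
Definition initialization P k Cs S : Prop :=
  farthest_loop P (k - #|` Cs|) Cs S.

Definition improving_swap P k alpha (t : nat) (eps : R) Cs S S' : Prop :=
  exists (i : nat) (T1 T2 : {fset X}),
    [/\ (1 <= i <= t)%N, T1 `<=` S, T2 `<=` P `\` S,
        #|` T1| = i & #|` T2| = i] /\
    [/\ S' = (S `|` T2) `\` T1, feasible P k alpha Cs S' &
        cost P S' <= (1 - eps) * cost P S].

(* The first [j] iterations of the local search are [F 0 -> F 1 -> ... -> F j];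
   the values of [F] beyond [j] are irrelevant. *)
Definition partial_run P k alpha t eps Cs (F : nat -> {fset X}) (j : nat)
    : Prop :=
  [/\ critical_centers P k alpha Cs,
      initialization P k Cs (F 0%N) &
      forall l, (l < j)%N ->
        improving_swap P k alpha t eps Cs (F l) (F l.+1)].

Definition complete_run P k alpha t eps Cs (F : nat -> {fset X}) (j : nat)
    : Prop :=
  partial_run P k alpha t eps Cs F j /\
  ~ (exists S', improving_swap P k alpha t eps Cs (F j) S').

End Procedure.

(** ** A real random access machine with a distance oracle

   Running time is measured on a deterministic while-language over a memory
   made of finitely many infinite arrays of natural numbers and of reals
   (a scalar variable is an array of which only cell 0 is used).  Every
   constant, read, write, arithmetic operation, comparison, connective and
   oracle call costs one.  Naturals have no multiplication, so that no value
   of more than [O(T)] bits can be computed in time [T]; reals have the four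
   field operations and comparisons, and there is no conversion from reals to
   naturals.  The syntax does not mention the type of reals, so one program
   serves all inputs. *)

Inductive nexp :=
| NConst of nat
| NGet of nat & nexp
| NAdd of nexp & nexp
| NSub of nexp & nexp.

Inductive rexp :=
| RConst of nat
| RGet of nat & nexp
| RDist of nexp & nexp
| RAdd of rexp & rexp
| RSub of rexp & rexp
| RMul of rexp & rexp
| RDiv of rexp & rexp.

Inductive bexp :=
| NLe of nexp & nexp
| NEq of nexp & nexp
| RLe of rexp & rexp
| REq of rexp & rexp
| BNot of bexp
| BAnd of bexp & bexp.

Inductive cmd :=
| Skip
| NSet of nat & nexp & nexp
| RSet of nat & nexp & rexp
| Seq of cmd & cmd
| If of bexp & cmd & cmd
| While of bexp & cmd.

Fixpoint ncost (e : nexp) : nat :=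
  match e with
  | NConst _ => 1
  | NGet _ i => (ncost i).+1
  | NAdd e f | NSub e f => (ncost e + ncost f).+1
  end.

Fixpoint rcost (e : rexp) : nat :=
  match e with
  | RConst _ => 1
  | RGet _ i => (ncost i).+1
  | RDist i j => (ncost i + ncost j).+1
  | RAdd e f | RSub e f | RMul e f | RDiv e f => (rcost e + rcost f).+1
  end.

Fixpoint bcost (b : bexp) : nat :=
  match b with
  | NLe e f | NEq e f => (ncost e + ncost f).+1
  | RLe e f | REq e f => (rcost e + rcost f).+1
  | BNot b => (bcost b).+1
  | BAnd b c => (bcost b + bcost c).+1
  end.

Section Machine.
Context {R : realType}.

Record memory := Memory {
  nmem : nat -> nat -> nat;
  rmem : nat -> nat -> R }.

Definition update {T : Type} (m : nat -> nat -> T) (a i : nat) (v : T)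
    : nat -> nat -> T :=
  fun b j => if (b == a) && (j == i) then v else m b j.

Variable dist : nat -> nat -> R.

Fixpoint neval (st : memory) (e : nexp) : nat :=
  match e with
  | NConst m => m
  | NGet a i => nmem st a (neval st i)
  | NAdd e f => (neval st e + neval st f)%N
  | NSub e f => (neval st e - neval st f)%N
  end.

Fixpoint reval (st : memory) (e : rexp) : R :=
  match e with
  | RConst m => m%:R
  | RGet a i => rmem st a (neval st i)
  | RDist i j => dist (neval st i) (neval st j)
  | RAdd e f => reval st e + reval st f
  | RSub e f => reval st e - reval st f
  | RMul e f => reval st e * reval st f
  | RDiv e f => reval st e / reval st f
  end.

Fixpoint beval (st : memory) (b : bexp) : bool :=
  match b with
  | NLe e f => (neval st e <= neval st f)%N
  | NEq e f => neval st e == neval st f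
  | RLe e f => reval st e <= reval st f
  | REq e f => reval st e == reval st f
  | BNot b => ~~ beval st b
  | BAnd b c => beval st b && beval st c
  end.

(* [exec c st st' T] : started in memory [st], [c] halts in memory [st'] after
   [T] unit-cost steps. *)
Inductive exec : cmd -> memory -> memory -> nat -> Prop :=
| exec_skip st : exec Skip st st 1
| exec_nset a i e st :
    exec (NSet a i e) st
      (Memory (update (nmem st) a (neval st i) (neval st e)) (rmem st))
      (ncost i + ncost e).+1
| exec_rset a i e st :
    exec (RSet a i e) st
      (Memory (nmem st) (update (rmem st) a (neval st i) (reval st e)))
      (ncost i + rcost e).+1
| exec_seq c1 c2 st1 st2 st3 T1 T2 :
    exec c1 st1 st2 T1 -> exec c2 st2 st3 T2 ->
    exec (Seq c1 c2) st1 st3 (T1 + T2)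
| exec_if b c1 c2 st st' T :
    exec (if beval st b then c1 else c2) st st' T ->
    exec (If b c1 c2) st st' (bcost b + T)
| exec_while_stop b c st :
    ~~ beval st b -> exec (While b c) st st (bcost b)
| exec_while_step b c st1 st2 st3 T1 T2 :
    beval st1 b -> exec c st1 st2 T1 -> exec (While b c) st2 st3 T2 ->
    exec (While b c) st1 st3 (bcost b + T1 + T2).

Lemma exec_det c st st1 st2 T1 T2 :
  exec c st st1 T1 -> exec c st st2 T2 -> st1 = st2 /\ T1 = T2.
Proof.
move=> E; elim: E st2 T2 => {c st st1 T1}.
- by move=> st st2 T2 E; inversion E.
- by move=> a i e st st2 T2 E; inversion E.
- by move=> a i e st st2 T2 E; inversion E.
- move=> c1 c2 st1 st2 st3 T1 T2 _ IH1 _ IH2 st4 T4 E.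
  inversion E as [| | |? ? ? ? ? ? ? E1 E2| | |]; subst.
  by case: (IH1 _ _ E1) => ? ?; subst; case: (IH2 _ _ E2) => -> ->.
- move=> b c1 c2 st st' T _ IH st2 T2 E.
  inversion E as [| | | |? ? ? ? ? ? E1| |]; subst.
  by case: (IH _ _ E1) => -> ->.
- move=> b c st /negP nb st2 T2 E.
  by inversion E.
- move=> b c st1 st2 st3 T1 T2 bt _ IH1 _ IH2 st4 T4 E.
  inversion E as [| | | | |? ? ? nb|? ? ? ? ? ? ? _ E1 E2]; subst.
    by rewrite bt in nb.
  by case: (IH1 _ _ E1) => ? ?; subst; case: (IH2 _ _ E2) => -> ->.
Qed.

(* Initially [n], [k], [t] are in cells 0, 1, 2 of natural array 0, and
   [alpha], [eps] in cells 0, 1 of real array 0; everything else is zero. *)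
Definition input (n k t : nat) (alpha eps : R) : memory :=
  Memory (fun a i => if a == 0%N then nth 0%N [:: n; k; t] i else 0%N)
         (fun a i => if a == 0%N then nth 0 [:: alpha; eps] i else 0).

End Machine.

Section InputOutput.
Context {R : realType} {X : metricType R} {n : nat}.
Implicit Types (x : 'I_n -> X) (st : @memory R).

(* The points are known to the machine only through their indices. *)
Definition oracle x (i j : nat) : R :=
  match insub i : option 'I_n, insub j : option 'I_n with
  | Some i', Some j' => mdist (x i') (x j')
  | _, _ => 0
  end.

(* The set of points whose indices are in cells [o, ..., o + m - 1] of natural
   array [a]. *)
Definition stored_set x st (a o m : nat) : {fset X} :=
  [fset x i | i : 'I_n & (i : nat) \in [seq nmem st a l | l <- iota o m]].

(* Where a halted machine leaves the trace of the run that it has performed: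
   the numbers of critical centers and of iterations in cells 0 and 1 of
   natural array 1, the critical centers in array 2, and the successive sets of
   the local search in consecutive blocks of [k] cells of array 3. *)
Definition output_iterations st : nat := nmem st 1 1.
Definition output_centers x st : {fset X} := stored_set x st 2 0 (nmem st 1 0).
Definition output_set x (k : nat) st (l : nat) : {fset X} :=
  stored_set x st 3 (l * k) k.

End InputOutput.

(* Main.v *)
(* The cost of the initial set [S0] is within a factor [2 n] of the cost of any
   feasible set [S] of the same size.  Indeed let [w] be a point farthest from
   [S0], at distance [r].  Two points of [S0 + w] are at distance at least [r],
   except perhaps two critical centers, which are however at distance more than
   [6 alpha] times the larger of their radii.  Send each critical center of
   fair radius less than [r / (2 alpha)] to a point of [S] in its ball, every other
   point of [S0 + w] to a nearest point of [S]; two points have the same image,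
   so one of them is at distance at least [r / 2] from [S].  As every iteration
   divides the cost by at least [1 / (1 - eps)], the bound on their number
   follows.

   For the running time, the fair radius of a point is the [ceil (n / k)]-th
   smallest distance to it.  When [k] is small there is only time
   [O~(n)] to find it; it is read off a tournament tree from which the minimum is
   removed [ceil (n / k) - 1] times.  A swap of at most [t] points is described
   by a word of [min t k] letters in [0, k n), one letter for each exchange of a
   position for a point; these words are tried in the order of an odometer, each
   in time [O(k n)]. *)
Require Import Defs.
From HB Require Import structures.
From mathcomp Require Import all_boot all_order all_algebra finmap.
From mathcomp Require Import all_classical all_reals all_analysis.
From mathcomp Require Import zify ring lra.

Set Implicit Arguments.
Unset Strict Implicit.
Unset Printing Implicit Defensive.

Import Order.TTheory GRing.Theory Num.Theory.
Local Open Scope fset_scope.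
Local Open Scope ring_scope.

(** * Execution of commands within a time bound *)

(** Termination of the program rests on the bound on the iterations: the loop of the local search is
    verified under the hypothesis that some [J] bounds every chain of accepted swaps, and the
    geometric argument supplies [J] afterwards. The test of a candidate has two conditions that the
    procedure does not mention. A word may insert a point twice, or a point already present, so the
    entries must be distinct. A word may also merely permute the positions; at cost 0 it would pass
    the test with factor [1 - eps] although it is no swap, so the cost must strictly decrease. For a
    genuine swap this is automatic, since a point outside the current set makes its cost positive.
    Words have [minn t k] letters rather than [t] because the time bound is uniform in [t]: for
    [k = n = 1] it does not depend on [t] at all. The cost ratio [2 n] would give [ln 2 + ln n] in
    the count of iterations; as a swap requires [n >= 2], the ratio is at most [n ^ 2], which leaves
    [2 ln n] and also settles [n = 1]. *)

Fixpoint loop_free (c : cmd) : bool :=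
  match c with
  | Seq c1 c2 | If _ c1 c2 => loop_free c1 && loop_free c2
  | While _ _ => false
  | _ => true
  end.

(* Meaningful for loop-free commands only, like [sem] below. *)
Fixpoint static_cost (c : cmd) : nat :=
  match c with
  | Skip => 1
  | NSet _ i e => (ncost i + ncost e).+1
  | RSet _ i e => (ncost i + rcost e).+1
  | Seq c1 c2 => static_cost c1 + static_cost c2
  | If b c1 c2 => bcost b + maxn (static_cost c1) (static_cost c2)
  | While b c => bcost b
  end.

Fixpoint nat_writes (c : cmd) : seq nat :=
  match c with
  | NSet a _ _ => [:: a]
  | Seq c1 c2 | If _ c1 c2 => nat_writes c1 ++ nat_writes c2
  | While _ c => nat_writes c
  | _ => [::]
  end.

Fixpoint real_writes (c : cmd) : seq nat :=
  match c with
  | RSet a _ _ => [:: a]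
  | Seq c1 c2 | If _ c1 c2 => real_writes c1 ++ real_writes c2
  | While _ c => real_writes c
  | _ => [::]
  end.

Fixpoint nreads (e : nexp) : seq nat :=
  match e with
  | NConst _ => [::]
  | NGet a i => a :: nreads i
  | NAdd e f | NSub e f => nreads e ++ nreads f
  end.

Definition var (v : nat) : nexp := NGet v (NConst 0).
Definition rvar (v : nat) : rexp := RGet v (NConst 0).
Definition setv (v : nat) (e : nexp) : cmd := NSet v (NConst 0) e.
Definition setr (v : nat) (e : rexp) : cmd := RSet v (NConst 0) e.
Definition NLt (e f : nexp) : bexp := BNot (NLe f e).

Definition While_lt (v : nat) (e : nexp) (c : cmd) : cmd :=
  While (NLt (var v) e) (Seq c (setv v (NAdd (var v) (NConst 1)))).

Definition For (v : nat) (e : nexp) (c : cmd) : cmd :=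
  Seq (setv v (NConst 0)) (While_lt v e c).

Section Runs.
Local Open Scope nat_scope.
Context {R : realType}.
Variable D : nat -> nat -> R.
Implicit Types (st : @memory R) (c : cmd) (Q : @memory R -> Prop).

(** For a concrete [c] the membership test computes, so [fr.1 a isT] rewrites natural array [a] to
    its earlier value, and [fr.2 a isT] does the same for reals. This is how facts pass from one
    phase to the next. *)
Definition frame c st st' : Prop :=
  (forall a, a \notin nat_writes c -> forall i, nmem st' a i = nmem st a i) /\
  (forall a, a \notin real_writes c -> forall i, rmem st' a i = rmem st a i).

Definition runs c st Q (B : nat) : Prop :=
  exists st' T, [/\ exec D c st st' T, (T <= B)%N & Q st'].

Fixpoint sem c st : memory :=
  match c with
  | NSet a i e =>
      Memory (update (nmem st) a (neval st i) (neval st e)) (rmem st)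
  | RSet a i e =>
      Memory (nmem st) (update (rmem st) a (neval st i) (reval D st e))
  | Seq c1 c2 => sem c2 (sem c1 st)
  | If b c1 c2 => if beval D st b then sem c1 st else sem c2 st
  | _ => st
  end.

Definition setn st (v x : nat) : memory :=
  Memory (update (nmem st) v 0%N x) (rmem st).

Lemma update_eq (T : Type) (m : nat -> nat -> T) a i v : update m a i v a i = v.
Proof. by rewrite /update !eqxx. Qed.

Lemma update_neq (T : Type) (m : nat -> nat -> T) a i v b j :
  (b != a) || (j != i) -> update m a i v b j = m b j.
Proof. by rewrite /update -negb_and => /negbTE ->. Qed.

Lemma frame_trans c st1 st2 st3 :
  frame c st1 st2 -> frame c st2 st3 -> frame c st1 st3.
Proof.
move=> [n12 r12] [n23 r23]; split=> a ha i; first by rewrite n23 ?n12.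
by rewrite r23 ?r12.
Qed.

Lemma frame_sub c c' st st' :
  {subset nat_writes c <= nat_writes c'} ->
  {subset real_writes c <= real_writes c'} -> frame c st st' -> frame c' st st'.
Proof.
move=> sn sr [fn fr]; split=> a ha i; first by apply: fn; apply: contra ha => /sn.
by apply: fr; apply: contra ha => /sr.
Qed.

Lemma frame_all c c' st st' :
  all (mem (nat_writes c')) (nat_writes c) ->
  all (mem (real_writes c')) (real_writes c) -> frame c st st' -> frame c' st st'.
Proof. by move=> /allP hn /allP hr; apply: frame_sub => a; [apply: hn|apply: hr]. Qed.

Lemma frame_cat c1 c2 c st1 st2 st3 :
  frame c1 st1 st2 -> frame c2 st2 st3 ->
  all (mem (nat_writes c)) (nat_writes c1 ++ nat_writes c2) ->
  all (mem (real_writes c)) (real_writes c1 ++ real_writes c2) ->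
  frame c st1 st3.
Proof.
rewrite !all_cat => fr1 fr2 /andP[n1 n2] /andP[r1 r2].
exact: frame_trans (frame_all n1 r1 fr1) (frame_all n2 r2 fr2).
Qed.

Lemma exec_frame c st st' T : exec D c st st' T -> frame c st st'.
Proof.
elim=> {c st st' T}.
- by [].
- move=> a i e st; split=> //= b; rewrite inE => ba j.
  by rewrite update_neq ?ba.
- move=> a i e st; split=> //= b; rewrite inE => ba j.
  by rewrite update_neq ?ba.
- move=> c1 c2 st1 st2 st3 T1 T2 _ f1 _ f2.
  apply: (frame_trans (st2 := st2)).
    by apply: frame_sub f1 => a /= h; rewrite mem_cat h.
  by apply: frame_sub f2 => a /= h; rewrite mem_cat h orbT.
- move=> b c1 c2 st st' T _ f.
  by apply: frame_sub f => a /=; case: ifP => _ h; rewrite mem_cat h ?orbT.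
- by [].
- by move=> b c st1 st2 st3 T1 T2 _ _ f1 _; apply: frame_trans.
Qed.

Lemma runs_frame c st Q B :
  runs c st Q B -> runs c st (fun st' => Q st' /\ frame c st st') B.
Proof.
by case=> st' [T [E le q]]; exists st', T; split=> //; split=> //;
   apply: exec_frame E.
Qed.

Lemma neval_frame c e st st' :
  ~~ has (mem (nat_writes c)) (nreads e) -> frame c st st' ->
  neval st' e = neval st e.
Proof.
move=> + [fn _]; elim: e => //= [a i IH|e IHe f IHf|e IHe f IHf].
- by rewrite negb_or => /andP[ha /IH ->]; rewrite fn.
- by rewrite has_cat negb_or => /andP[/IHe -> /IHf ->].
- by rewrite has_cat negb_or => /andP[/IHe -> /IHf ->].
Qed.

Lemma runs_mono c st Q Q' B B' :
  runs c st Q B -> (forall st', Q st' -> Q' st') -> (B <= B')%N ->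
  runs c st Q' B'.
Proof.
case=> st' [T [E le q]] QQ' BB'.
by exists st', T; split=> //; [apply: leq_trans BB'|apply: QQ'].
Qed.

Lemma runs_le c st Q B B' : runs c st Q B -> (B <= B')%N -> runs c st Q B'.
Proof. by move=> r; apply: (runs_mono r). Qed.

Lemma runs_sem c st Q : loop_free c -> Q (sem c st) -> runs c st Q (static_cost c).
Proof.
elim: c st Q => //=.
- by move=> st Q _ q; exists st, 1%N; split=> //; apply: exec_skip.
- by move=> a i e st Q _ q; do 2!eexists; split; [apply: exec_nset|by []|].
- by move=> a i e st Q _ q; do 2!eexists; split; [apply: exec_rset|by []|].
- move=> c1 IH1 c2 IH2 st Q /andP[l1 l2] q.
  have [|st1 [T1 [E1 le1 e1]]] := IH1 st (fun st' => st' = sem c1 st) l1; first by [].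
  subst st1; have [st2 [T2 [E2 le2 q2]]] := IH2 (sem c1 st) Q l2 q.
  exists st2, (T1 + T2)%N; split=> //; last exact: leq_add.
  exact: exec_seq E1 E2.
- move=> b c1 IH1 c2 IH2 st Q /andP[l1 l2] q.
  have [st2 [T2 [E2 le2 q2]]] : runs (if beval D st b then c1 else c2) st Q
      (maxn (static_cost c1) (static_cost c2)).
    case: ifP q => _ q.
      by apply: runs_le (IH1 _ _ l1 q) _; rewrite leq_maxl.
    by apply: runs_le (IH2 _ _ l2 q) _; rewrite leq_maxr.
  exists st2, (bcost b + T2)%N; split=> //; last by rewrite leq_add2l.
  exact: exec_if.
Qed.

Lemma runs_seq c1 c2 st Q1 Q B1 B2 :
  runs c1 st Q1 B1 ->
  (forall st', frame c1 st st' -> Q1 st' -> runs c2 st' Q B2) ->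
  runs (Seq c1 c2) st Q (B1 + B2).
Proof.
case=> st1 [T1 [E1 le1 q1]] /(_ _ (exec_frame E1) q1) [st2 [T2 [E2 le2 q2]]].
exists st2, (T1 + T2)%N; split=> //; last exact: leq_add.
exact: exec_seq E1 E2.
Qed.

Lemma runs_if b c1 c2 st Q B1 B2 :
  (beval D st b -> runs c1 st Q B1) -> (~~ beval D st b -> runs c2 st Q B2) ->
  runs (If b c1 c2) st Q (bcost b + maxn B1 B2).
Proof.
move=> r1 r2.
have [st2 [T2 [E2 le2 q2]]] :
    runs (if beval D st b then c1 else c2) st Q (maxn B1 B2).
  case: ifP => [bt|/negbT bf].
    by apply: runs_le (r1 bt) _; rewrite leq_maxl.
  by apply: runs_le (r2 bf) _; rewrite leq_maxr.
exists st2, (bcost b + T2)%N; split=> //; last by rewrite leq_add2l.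
exact: exec_if.
Qed.

(** Besides the invariant, the body may assume the frame of the whole loop relative to [st0]; so [I]
    need not list what stays unchanged. *)
Lemma runs_while b c st0 (I : memory -> Prop) (M : memory -> nat) B :
  (forall st, frame c st0 st -> I st -> beval D st b ->
     runs c st (fun st' => I st' /\ (M st' < M st)%N) B) ->
  I st0 ->
  runs (While b c) st0 (fun st' => I st' /\ ~~ beval D st' b)
    (M st0 * (B + bcost b) + bcost b).
Proof.
move=> body; have: frame c st0 st0 by [].
(* All occurrences are generalized but the first argument of [frame], which stays the memory at the
   entry of the loop. *)
have [m] := ubnP (M st0); move: {1 3 4 5 6}st0.
elim: m => // m IH st Mm fr i.
case: (boolP (beval D st b)) => [bt|bf]; last first.
  by do 2!eexists; split; [exact: exec_while_stop|rewrite leq_addl|].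
have [st1 [T1 [E1 le1 [i1 M1]]]] := body _ fr i bt.
have [|st2 [T2 [E2 le2 q2]]] := IH st1 _ (frame_trans fr (exec_frame E1)) i1.
  by apply: leq_trans M1 _.
exists st2, (bcost b + T1 + T2)%N; split=> //.
  exact: exec_while_step bt E1 E2.
have le3 : (M st1).+1 * (B + bcost b) <= M st * (B + bcost b) by rewrite leq_mul.
by rewrite mulSn in le3; lia.
Qed.

(** After the body, [I] is required of the memory in which the counter is already incremented, hence
    [setn]. The constant 10 is 4 for the test, apart from [e], plus 6 for the increment. *)
Lemma runs_while_lt v e body N i0 st0 (I : nat -> memory -> Prop) B :
  v \notin nat_writes body ->
  (forall st, frame (While_lt v e body) st0 st -> neval st e = N) ->
  (forall i st, (i < N)%N -> nmem st v 0 = i ->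
     frame (While_lt v e body) st0 st -> I i st ->
     runs body st (fun st' => I i.+1 (setn st' v i.+1)) B) ->
  nmem st0 v 0 = i0 -> (i0 <= N)%N -> I i0 st0 ->
  runs (While_lt v e body) st0 (fun st' => I N st')
    ((N - i0) * (B + ncost e + 10) + ncost e + 10).
Proof.
move=> vb eN step st0v i0N I0.
pose J st := (nmem st v 0 <= N)%N /\ I (nmem st v 0%N) st.
have r : runs (While_lt v e body) st0
   (fun st' => J st' /\ ~~ beval D st' (NLt (var v) e))
   ((N - nmem st0 v 0) * (B + 6 + bcost (NLt (var v) e)) + bcost (NLt (var v) e)).
  apply: (@runs_while _ _ _ J (fun st => N - nmem st v 0)%N).
    move=> st fr [le i] /=; rewrite (eN _ fr) -ltnNge => lt.
    apply: (@runs_seq _ _ _ _ _ B (static_cost (setv v (NAdd (var v) (NConst 1))))).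
      exact: step lt erefl fr i.
    move=> st' [fn _] i'.
    apply: runs_sem => //=.
    have -> : nmem st' v 0 = nmem st v 0 by apply: fn.
    by rewrite /J addn1 /= update_eq; split; [split|lia].
  by split; rewrite st0v.
apply: (runs_mono (runs_frame r)) => [st' [[[le i] /=]]|/=]; last first.
  by rewrite st0v /NLt /=; lia.
move=> nlt fr; move: nlt; rewrite (eN _ fr) negbK => ge.
by have <- : nmem st' v 0 = N by apply/eqP; rewrite eqn_leq le.
Qed.

Lemma runs_for v e body N st0 (I : nat -> memory -> Prop) B :
  v \notin nat_writes body ->
  (forall st, frame (For v e body) st0 st -> neval st e = N) ->
  I 0 (setn st0 v 0) ->
  (forall i st, (i < N)%N -> nmem st v 0 = i ->
     frame (For v e body) st0 st -> I i st ->
     runs body st (fun st' => I i.+1 (setn st' v i.+1)) B) ->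
  runs (For v e body) st0 (fun st' => I N st')
    (N * (B + ncost e + 10) + ncost e + 13).
Proof.
move=> vb eN I0 step.
have sub st : frame (While_lt v e body) (setn st0 v 0) st ->
    frame (For v e body) st0 st.
  move=> fr; apply: (frame_trans (st2 := setn st0 v 0)).
    by split=> //= a; rewrite inE negb_or => /andP[av _] i; rewrite update_neq ?av.
  by apply: frame_sub fr => a /= h; rewrite ?inE h ?orbT.
apply: runs_le.
  apply: (@runs_seq _ _ _ (fun st => st = setn st0 v 0)).
    exact: runs_sem.
  move=> _ _ ->; apply: (@runs_while_lt _ _ _ N 0 _ I B) => //.
  - by move=> st /sub; apply: eN.
  - by move=> i st iN sti /sub; apply: step.
  - by rewrite /= update_eq.
by rewrite subn0 /=; lia.
Qed.
End Runs.

(* Natural arrays: 4 the tournament tree, 5 the table of halves, 6 the flags of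
   the remaining points, 7 and 8 the tables of quotients and remainders by [n],
   9 the current word.  Natural scalars: 10 and 11 [ceil (n / k)] and its
   product by [k], 15 the current node of the tree, 16 a success flag, 17 the
   selected point, 18 the size of the set under construction, 19 and 20 the
   offsets in array 3 of the current set and of the candidate, 21 and 22 the
   flags of an improvement and of the end of the search for one, 23
   [minn t k], 24 [k * n]; 12, 13, 14 and 25 are loop counters.  Reals: 1 the
   array of fair radii, 2 and 3 the smallest and the latest distance, 4 the
   largest distance to the set under construction, 5 the cost being computed,
   6 the cost of the current set. *)
Definition nE : nexp := NGet 0 (NConst 0).
Definition kE : nexp := NGet 0 (NConst 1).
Definition tE : nexp := NGet 0 (NConst 2).

Definition min_dist (z o s : nexp) : cmd :=
  Seq (setr 2 (RDist z (NGet 3 o)))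
      (For 14 s
        (Seq (setr 3 (RDist z (NGet 3 (NAdd o (var 14)))))
             (If (RLe (rvar 3) (rvar 2)) (setr 2 (rvar 3)) Skip))).

Definition cost_at (o : nat) : cmd :=
  Seq (setr 5 (RConst 0))
      (For 12 nE
        (Seq (min_dist (var 12) (var o) kE) (setr 5 (RAdd (rvar 5) (rvar 2))))).

(** Naturals have no division: [ceil (n / k)] is the number of copies of [k] that must be added to
    reach [n]. *)
Definition compute_m : cmd :=
  Seq (Seq (setv 10 (NConst 0)) (setv 11 (NConst 0)))
      (While (NLt (var 11) nE)
        (Seq (setv 10 (NAdd (var 10) (NConst 1))) (setv 11 (NAdd (var 11) kE)))).

(** The machine cannot halve either; the table gives the parent of a node of the tournament tree in
    constant time. *)
Definition half_table : cmd :=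
  For 12 nE
    (Seq (NSet 5 (NAdd (var 12) (var 12)) (var 12))
         (NSet 5 (NAdd (NAdd (var 12) (var 12)) (NConst 1)) (var 12))).

(** * Minimum distances, costs, and tables of integers *)

Section Programs.
Context {R : realType}.
Variable D : nat -> nat -> R.
Implicit Types (st : @memory R).
Local Open Scope nat_scope.

(** The empty minimum is [f 0]: the program [min_dist] starts from the value at position 0 and then
    examines that position again. *)
Fixpoint min_upto (f : nat -> R) (N : nat) : R :=
  if N is N'.+1 then Num.min (min_upto f N') (f N') else f 0.

Lemma min_upto_le f N l : l < N -> (min_upto f N <= f l)%R.
Proof.
elim: N => // N IH; rewrite ltnS leq_eqVlt /= ge_min.
by case/orP => [/eqP ->|/IH ->//]; rewrite lexx orbT.
Qed.

Lemma min_upto_ex f N : 0 < N -> exists2 l, l < N & min_upto f N = f l.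
Proof.
elim: N => // [[|N] IH _]; first by exists 0 => //=; rewrite minxx.
have [l lN e] := IH isT; rewrite [min_upto _ _]/= -/(min_upto f N.+1) e minEle.
by case: ifP => _; [exists l => //; apply: ltnW|exists N.+1].
Qed.

Lemma eq_min_upto f g N :
  0 < N -> (forall l, l < N -> f l = g l) -> min_upto f N = min_upto g N.
Proof.
elim: N => // [[|N] IH _] fg; first by rewrite /= fg.
rewrite [LHS]/= [RHS]/= -/(min_upto f N.+1) -/(min_upto g N.+1) fg // IH // => l lN.
by rewrite fg // ltnW.
Qed.

Lemma runs_min_dist z o s st N :
  14 \notin nreads z ++ nreads o ++ nreads s -> neval st s = N -> 0 < N ->
  runs D (min_dist z o s) st
    (fun st' => rmem st' 2 0 =
       min_upto (fun l => D (neval st z) (nmem st 3 (neval st o + l))) N)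
    ((ncost z + ncost o + ncost s + 60) * N.+1).
Proof.
rewrite !mem_cat !negb_or => /and3P[hz ho hs] sN N0.
have ind e st' : 14 \notin nreads e -> frame (min_dist z o s) st st' ->
    neval st' e = neval st e.
  move=> he; apply: neval_frame; apply/hasPn => a ae /=.
  by rewrite !inE; apply: contraNN he => /orP[] /eqP <-.
set f := fun l => D (neval st z) (nmem st 3 (neval st o + l)).
apply: runs_le.
  apply: runs_seq; first by apply: runs_sem; [|exact: erefl].
  move=> _ /[swap] <- fr1.
  apply: (@runs_for _ _ _ _ _ N _
    (fun i st' => rmem st' 2 0 = min_upto f i)) => //.
  - move=> st2 fr2; rewrite -sN; apply: ind => //.
    exact: frame_cat fr1 fr2 _ _.
  - by rewrite /= /f addn0 update_eq.
  - move=> i st2 iN sti fr2 mi.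
    have fr : frame (min_dist z o s) st st2 by exact: frame_cat fr1 fr2 _ _.
    apply: runs_sem => //=.
    rewrite sti (ind _ _ hz fr) (ind _ _ ho fr) !update_eq (fr.1 3 isT).
    rewrite -/(f i) /update /= mi [in RHS]minC minEle.
    by case: ifP.
by rewrite /=; nia.
Qed.

Lemma runs_cost_at o n k st :
  13 < o -> o != 14 -> nmem st 0 0 = n -> nmem st 0 1 = k -> 0 < k ->
  runs D (cost_at o) st
    (fun st' => rmem st' 5 0 = \sum_(z <- iota 0 n)
       min_upto (fun l => D z (nmem st 3 (nmem st o 0 + l))) k)%R
    (250 * (n.+1 * k.+1)).
Proof.
move=> o13 o14 n0 k0 kpos; apply: runs_le.
  apply: runs_seq; first by apply: runs_sem; [|exact: erefl].
  move=> _ /[swap] <- fr1.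
  apply: (@runs_for _ _ _ _ _ n _ (fun i st' => rmem st' 5 0 =
     \sum_(z <- iota 0 i) min_upto (fun l => D z (nmem st 3 (nmem st o 0 + l))) k)%R) => //.
  - by move=> st2 fr2; rewrite -n0 /= (fr2.1 0 isT).
  - by rewrite /= big_nil.
  - move=> i st2 iN sti fr2 Ii.
    apply: runs_seq.
      apply: (@runs_min_dist _ _ _ _ k) => //; first by rewrite /= !inE; lia.
      by rewrite -k0 /= (fr2.1 0 isT).
    move=> st3 fr3 /= e3; apply: runs_sem => //=.
    rewrite /update /= (fr3.2 5 isT) Ii e3 -[_ :: _]/(iota 0 i.+1) -[i.+1]addn1.
    rewrite iotaD big_cat big_seq1 add0n sti /=.
    congr (_ + _)%R; apply: eq_min_upto => // l lk.
    rewrite (fr2.1 3 isT) (fr2.1 o) //.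
    by rewrite /= !inE; lia.
rewrite /=; nia.
Qed.

Lemma runs_compute_m n k st :
  nmem st 0 0 = n -> nmem st 0 1 = k -> 0 < k -> 0 < n ->
  runs D compute_m st (fun st' => let m := nmem st' 10 0 in
     [/\ 0 < m, m.-1 * k < n & n <= m * k]) (100 * n).
Proof.
move=> n0 k0 kpos npos; apply: runs_le.
  apply: runs_seq; first by apply: runs_sem; [|exact: erefl].
  move=> _ /[swap] <- fr1.
  apply: runs_mono; last exact: leqnn.
    apply: (@runs_frame _ _ _ _ _ _).
    apply: (@runs_while _ _ _ _ _ (fun st' => [/\ nmem st' 11 0 = nmem st' 10 0 * k &
         (0 < nmem st' 10 0 -> (nmem st' 10 0).-1 * k < n)])
       (fun st' => n - nmem st' 11 0)).
    - move=> st2 fr2 [e I] /=; rewrite -ltnNge (fr2.1 0 isT) /= /update /= n0 => lt.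
      apply: runs_sem => //=; rewrite /update /= (fr2.1 0 isT) /= /update /= k0 e addn1 /=.
      by split; [split=> //; lia|nia].
    - by [].
  move=> st' [[[e I] /=]] + fr2; rewrite negbK (fr2.1 0 isT) /= /update /= n0 => ge.
  have m0 : 0 < nmem st' 10 0 by rewrite e in ge; case: (nmem _ _ _) ge => //; lia.
  by rewrite -e; split=> //; apply: I.
rewrite /=; lia.
Qed.

Lemma runs_half_table n st :
  nmem st 0 0 = n ->
  runs D half_table st (fun st' => forall i, i < n + n -> nmem st' 5 i = i./2)
    (100 * n.+1).
Proof.
move=> n0; apply: runs_le.
  apply: (@runs_for _ _ _ _ _ n _ (fun i st' => forall j, j < i + i -> nmem st' 5 j = j./2)) => //.
  - by move=> st2 fr2; rewrite -n0 /= (fr2.1 0 isT).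
  - move=> i st2 iN sti fr2 Ii; apply: runs_sem => //= j ji.
    rewrite /update /= sti; case: eqP => [->|h1]; first by lia.
    case: eqP => [->|h2]; first by lia.
    by apply: Ii; lia.
rewrite /=; lia.
Qed.
End Programs.

(** * Fair radii by a tournament tree *)

Definition pull : cmd :=
  let i := var 15 in
  let l := NGet 4 (NAdd i i) in
  let r := NGet 4 (NAdd (NAdd i i) (NConst 1)) in
  If (NEq l (NConst 0)) (NSet 4 i r)
    (If (NEq r (NConst 0)) (NSet 4 i l)
      (If (RLe (RDist (var 12) (NSub l nE)) (RDist (var 12) (NSub r nE)))
          (NSet 4 i l) (NSet 4 i r))).

(** Heap layout: node [i] has children [2 i] and [2 i + 1], and the leaves are the cells [n] to
    [2 n - 1], whether or not [n] is a power of two. Children have larger indices than their parent,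
    so the inner nodes are filled from [n - 1] down to 1. *)
Definition tree_build : cmd :=
  Seq (For 13 nE (NSet 4 (NAdd nE (var 13)) (NAdd nE (var 13))))
      (For 13 (NSub nE (NConst 1))
        (Seq (setv 15 (NSub (NSub nE (NConst 1)) (var 13))) pull)).

Definition tree_remove : cmd :=
  Seq (Seq (setv 15 (NGet 4 (NConst 1))) (NSet 4 (var 15) (NConst 0)))
      (While (NLt (NConst 1) (var 15))
        (Seq (setv 15 (NGet 5 (var 15))) pull)).

Definition fair_radii : cmd :=
  For 12 nE
    (Seq tree_build
      (Seq (For 14 (NSub (var 10) (NConst 1)) tree_remove)
           (RSet 1 (var 12) (RDist (var 12) (NSub (NGet 4 (NConst 1)) nE))))).

Section Tournament.
Context {R : realType}.
Variable f : nat -> R.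
Variable n : nat.
Local Open Scope nat_scope.

(* Leaf [a] stands for the point [a - n], and [0] for the absence of a leaf. *)
Definition winner (a b : nat) : nat :=
  if a == 0 then b else if b == 0 then a else if (f a <= f b)%R then a else b.

Definition node_ok (W : nat -> nat) (i : nat) : Prop :=
  W i = winner (W (i + i)) (W (i + i + 1)).

Definition leaves_ok (W : nat -> nat) : Prop :=
  forall i, n <= i < n + n -> W i = 0 \/ W i = i.

Definition tournament (W : nat -> nat) : Prop :=
  leaves_ok W /\ forall i, 0 < i < n -> node_ok W i.

Lemma winnerP a b : winner a b = a \/ winner a b = b.
Proof. by rewrite /winner; do !case: ifP => _; auto. Qed.

Lemma winner_le a b c : c = a \/ c = b -> c != 0 ->
  winner a b != 0 /\ (f (winner a b) <= f c)%R.
Proof.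
rewrite /winner => cab c0.
case: (a =P 0) => [a0|/eqP a0].
  by have <- : c = b by case: cab => // ca; rewrite ca a0 in c0.
case: (b =P 0) => [b0|/eqP b0].
  by have <- : c = a by case: cab => // cb; rewrite cb b0 in c0.
case: ifP => [ab|/negbT]; first by case: cab => ->.
by rewrite -ltNge => /ltW ba; case: cab => ->.
Qed.

(** A label is copied from one of the two children, so following it downwards ends at a live
    leaf. *)
Lemma tournament_leaf W i : tournament W -> 0 < i < n + n -> W i != 0 ->
  n <= W i < n + n /\ W (W i) = W i.
Proof.
case=> lv nd; have [m] := ubnP (n + n - i); elim: m i => // m IH i im i0 wi.
case: (leqP n i) => [ni|ltin].
  have [|e|e] := lv i; first by lia.
    by rewrite e in wi.
  by rewrite !e; split=> //; lia.
have wn : node_ok W i by apply: nd; lia.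
rewrite wn; rewrite wn in wi.
by case: (winnerP (W (i + i)) (W (i + i + 1))) wi => -> wi; apply: IH => //; lia.
Qed.

(** On the way up from [i] to the root, a nonzero label forces a nonzero label at the parent, with a
    value of [f] that is no larger. *)
Lemma tournament_min W i : tournament W -> 0 < i < n + n -> W i != 0 ->
  W 1 != 0 /\ (f (W 1%N) <= f (W i))%R.
Proof.
case=> lv nd; have [m] := ubnP i; elim: m i => // m IH i im i0 wi.
case: (ltnP 1 i) => [i1|i1]; last first.
  by have e : i = 1 by [lia]; rewrite e in wi *.
have wn : node_ok W i./2 by apply: nd; lia.
have [] := @winner_le (W (i./2 + i./2)) (W (i./2 + i./2 + 1)) (W i) _ wi.
  case: (boolP (odd i)) => oi; [right|left]; congr W; lia.
rewrite -wn => w0 le.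
have [] := IH i./2 _ _ w0; try lia.
by move=> w1 le1; split=> //; apply: le_trans le1 le.
Qed.
End Tournament.

Lemma eq_node_ok (R : realType) (f : nat -> R) (W W' : nat -> nat) i :
  W' i = W i -> W' (i + i)%N = W (i + i)%N ->
  W' (i + i + 1)%N = W (i + i + 1)%N ->
  node_ok f W i -> node_ok f W' i.
Proof. by rewrite /node_ok => -> -> ->. Qed.

Section FairRadii.
Context {R : realType}.
Variable D : nat -> nat -> R.
Implicit Types (st : @memory R).
Local Open Scope nat_scope.

Lemma sem_seq c1 c2 st : sem D (Seq c1 c2) st = sem D c2 (sem D c1 st).
Proof. by []. Qed.

Lemma sem_pull n x st : nmem st 0 0 = n -> nmem st 12 0 = x ->
  let i := nmem st 15 0 in
  sem D pull st = Memory (update (nmem st) 4 i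
    (winner (fun a => D x (a - n)) (nmem st 4 (i + i)) (nmem st 4 (i + i + 1))))
    (rmem st).
Proof.
by move=> n0 x0 /=; rewrite n0 x0 /winner; do 3?case: ifP => //.
Qed.

Lemma runs_tree_build n st : nmem st 0 0 = n ->
  runs D tree_build st (fun st' =>
    tournament (fun a => D (nmem st 12 0) (a - n)) n (nmem st' 4) /\
    forall i, n <= i < n + n -> nmem st' 4 i = i) (200 * n.+1).
Proof.
move=> n0; set x := nmem st 12 0; set f := fun a => D x (a - n).
apply: runs_le.
  apply: runs_seq.
    apply: (@runs_for _ _ _ _ _ n _
      (fun i st' => forall j, n <= j < n + i -> nmem st' 4 j = j)) => //.
    - by move=> st2 fr2; rewrite -n0 /= (fr2.1 0 isT).
    - by move=> j /=; lia.
    - move=> i st2 iN sti fr2 Ii; apply: runs_sem => //= j ji.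
      rewrite /update /= sti (fr2.1 0 isT) n0; case: eqP => // h.
      by apply: Ii; lia.
  move=> st1 fr1 lv.
  apply: runs_mono; last exact: leqnn.
    apply: (@runs_for _ _ _ _ _ (n - 1) _
      (fun i st' => (forall j, n <= j < n + n -> nmem st' 4 j = j) /\
         forall j, n - i <= j < n -> 0 < j -> node_ok f (nmem st' 4) j)) => //.
    - by move=> st2 fr2; rewrite -n0 /= (fr2.1 0 isT) (fr1.1 0 isT).
    - by split=> [j /lv e|j]; [rewrite /= /update /= e|lia].
    - move=> i st2 iN sti fr2 [lv2 nd2].
      have e0 : nmem st2 0 0 = n by rewrite (fr2.1 0 isT) (fr1.1 0 isT).
      have ex : nmem st2 12 0 = x by rewrite (fr2.1 12 isT) (fr1.1 12 isT).
      apply: runs_sem => //; rewrite sem_seq (sem_pull (n := n) (x := x)) //=.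
      rewrite /update /= sti e0 -/f; set p := n - 1 - i.
      have pn : p < n by rewrite /p; lia.
      split=> [j nj|j nj j0].
        by case: eqP => [jp|_]; [lia|apply: lv2].
      case: (j =P p) => [->|/eqP jp].
        by rewrite /node_ok /= eqxx; do 2?[case: eqP => [|_]; first by lia].
      apply: (@eq_node_ok _ _ (nmem st2 4)); last by apply: nd2 => //; lia.
      + by rewrite /= (negbTE jp).
      + by case: eqP => //=; lia.
      + by case: eqP => //=; lia.
  move=> st2 [lv2 nd2]; split; last by [].
  by split=> [i /lv2 ->|i ni]; [right|apply: nd2; lia].
rewrite /=; lia.
Qed.

Lemma runs_tree_remove n st :
  let f := fun a => D (nmem st 12 0) (a - n) in
  let W := nmem st 4 in
  nmem st 0 0 = n -> 0 < n -> (forall i, i < n + n -> nmem st 5 i = i./2) ->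
  tournament f n W -> W 1 != 0 ->
  runs D tree_remove st (fun st' => tournament f n (nmem st' 4) /\
    forall i, n <= i < n + n -> nmem st' 4 i = if i == W 1 then 0 else W i)
   (100 * (trunc_log 2 (n + n)).+1).
Proof.
move=> f W n0 npos half tW w1.
have [w1n ww1] := tournament_leaf tW (i := 1) ltac:(lia) w1.
apply: runs_le.
  apply: runs_seq; first by apply: runs_sem; [|exact: erefl].
  move=> _ /[swap] <- fr1.
  (* Only the parent of the current node may disagree with its children. At the root this exception
     is [1./2 = 0], which is not a node, so the whole tree is consistent again. *)
  pose J st' := [/\ 0 < nmem st' 15 0 < n + n,
    forall i, n <= i < n + n -> nmem st' 4 i = if i == W 1 then 0 else W i &
    forall i, 0 < i < n -> i != (nmem st' 15 0)./2 -> node_ok f (nmem st' 4) i].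
  apply: runs_mono; last exact: leqnn.
    apply: (@runs_while _ _ _ _ _ J (fun st' => trunc_log 2 (nmem st' 15 0))).
    - move=> st2 fr2 [c2 lv nd] /=; rewrite -ltnNge => c1.
      have e0 : nmem st2 0 0 = n by rewrite (fr2.1 0 isT) (fr1.1 0 isT).
      have ex : nmem st2 12 0 = nmem st 12 0 by rewrite (fr2.1 12 isT) (fr1.1 12 isT).
      have eh : nmem st2 5 (nmem st2 15 0) = (nmem st2 15 0)./2.
        by rewrite (fr2.1 5 isT) (fr1.1 5 isT) half; lia.
      apply: runs_sem => //; rewrite sem_seq (sem_pull (n := n) (x := nmem st 12 0)) //=.
      rewrite /J /update /= eh -/f; set p := (nmem st2 15 0)./2.
      have p2 : 0 < p < n by rewrite /p; lia.
      split; last by rewrite -/(trunc_log 2 _) (trunc_log2S c1).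
      split; first by lia.
        by move=> j jn; case: eqP => [|_]; [lia|apply: lv].
      move=> j j0 jp; case: (j =P p) => [->|/eqP jp'].
        by rewrite /node_ok /= eqxx; do 2?[case: eqP => [|_]; first by lia].
      apply: (@eq_node_ok _ _ (nmem st2 4)); last by apply: nd.
      + by rewrite /= (negbTE jp').
      + by case: eqP => //=; lia.
      + by case: eqP => //=; lia.
    - rewrite /J /= /update /= -/W; split; first by lia.
        by move=> i ni; case: eqP.
      case: tW => _ nd i i0 iw.
      apply: (@eq_node_ok _ _ W); last by apply: nd.
      + by case: eqP => //=; lia.
      + by case: eqP => //=; lia.
      + by case: eqP => //=; lia.
  move=> st' [[c2 lv nd] /=]; rewrite negbK => c1; split; last by [].
  split=> [i ni|i i0]; last by apply: nd => //; lia.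
  rewrite lv //; case: eqP => _; first by left.
  by case: tW => /(_ i ni).
rewrite /= /update /= -/W.
have : trunc_log 2 (W 1) <= trunc_log 2 (n + n) by apply: leq_trunc_log; lia.
lia.
Qed.
End FairRadii.

(** [rs] lists the leaves deleted so far. By the last clause they form an initial segment for [f],
    ties being decided by the order of deletion. *)
Definition removed (R : realType) (f : nat -> R) (n : nat) (W : nat -> nat)
    (rs : seq nat) : Prop :=
  [/\ uniq rs, (forall i, i \in rs -> n <= i < n + n)%N,
      (forall i, n <= i < n + n -> W i = if i \in rs then 0 else i)%N &
      forall i j, i \in rs -> (n <= j < n + n)%N -> j \notin rs -> f i <= f j].

(** Fewer than [n] deletions leave a live leaf, so the root holds a winner, and the winner beats
    every leaf that is left. *)
Lemma removed_root (R : realType) (f : nat -> R) (n : nat) (W : nat -> nat) rs :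
  (0 < n)%N -> tournament f n W -> removed f n W rs -> (size rs < n)%N ->
  [/\ W 1%N != 0%N, (n <= W 1 < n + n)%N, W 1%N \notin rs &
      forall j, (n <= j < n + n)%N -> j \notin rs -> f (W 1%N) <= f j].
Proof.
move=> n0 tW [urs rsn Wrs le] sz.
have [j jn jrs] : exists2 j, j \in iota n n & j \notin rs.
  apply/hasP; apply: contraTT sz => /hasPn h; rewrite -leqNgt -[leqLHS](size_iota n).
  by apply: uniq_leq_size; [exact: iota_uniq|move=> j /h; rewrite negbK].
have alive i : (n <= i < n + n)%N -> i \notin rs ->
    W 1%N != 0%N /\ f (W 1%N) <= f i.
  move=> ni irs; have wi : W i = i by rewrite Wrs // (negbTE irs).
  by have := tournament_min tW (i := i); rewrite wi; apply; lia.
have [w0 _] := alive j ltac:(by rewrite mem_iota in jn) jrs.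
have [wn ww] := tournament_leaf tW (i := 1%N) ltac:(lia) w0.
split=> // [|i ni irs]; last by case: (alive i ni irs).
by apply: contraNN w0 => wr; rewrite -ww Wrs // wr.
Qed.

Section Radii.
Context {R : realType}.
Variable D : nat -> nat -> R.
Implicit Types (st : @memory R).
Local Open Scope nat_scope.

(** [v] is the [m]-th smallest distance from [x], with multiplicity. Counting makes this independent
    of the order among ties. *)
Definition radius_spec (n m x : nat) (v : R) : Prop :=
  m <= count (fun y => (D x y <= v)%R) (iota 0 n) /\
  count (fun y => (D x y < v)%R) (iota 0 n) < m.

(** The [m - 1] deleted leaves together with the root are [m] points within the value at the root;
    conversely, a point strictly closer than the root must have been deleted. *)
Lemma removed_radius n m x W rs :
  let f := fun a => D x (a - n) in
  0 < m <= n -> tournament f n W -> removed f n W rs -> size rs = m - 1 ->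
  radius_spec n m x (D x (W 1 - n)).
Proof.
move=> f mn tW rm sz.
have [w0 wn wrs le] := removed_root (n := n) ltac:(lia) tW rm ltac:(lia).
case: rm => urs rsn Wrs rle; rewrite /radius_spec -!size_filter; split.
  have <- : size [seq i - n | i <- W 1 :: rs] = m by rewrite size_map /= sz; lia.
  apply: uniq_leq_size.
    rewrite map_inj_in_uniq /= ?wrs // => i j; rewrite !inE => hi hj.
    have {}hi : n <= i by case/orP: hi => [/eqP ->|/rsn]; lia.
    have {}hj : n <= j by case/orP: hj => [/eqP ->|/rsn]; lia.
    by lia.
  move=> _ /mapP[i irs ->]; rewrite mem_filter mem_iota.
  move: irs; rewrite inE => /predU1P[->|irs]; first by rewrite lexx; lia.
  by rewrite (rle i) //=; have := rsn _ irs; lia.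
rewrite -(ltn_predK (m := 0) (n := m)) ?ltnS; last by lia.
have -> : m.-1 = size [seq i - n | i <- rs] by rewrite size_map sz subn1.
apply: uniq_leq_size; first by rewrite filter_uniq ?iota_uniq.
move=> y; rewrite mem_filter mem_iota => /andP[yw yn].
apply/mapP; exists (n + y); last by lia.
apply: contraTT yw => yrs; rewrite -leNgt.
have := le (n + y) ltac:(lia) yrs.
by rewrite /f addKn.
Qed.

Lemma runs_fair_radii n m st :
  nmem st 0 0 = n -> nmem st 10 0 = m -> 0 < m <= n ->
  (forall i, i < n + n -> nmem st 5 i = i./2) ->
  runs D fair_radii st
    (fun st' => forall x, x < n -> radius_spec n m x (rmem st' 1 x))
    (1000 * (n.+1 * n.+1 * (trunc_log 2 (n + n)).+1)).
Proof.
move=> n0 m0 mn half; apply: runs_le.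
  apply: (@runs_for _ _ _ _ _ n _
    (fun i st' => forall x, x < i -> radius_spec n m x (rmem st' 1 x))) => //.
    by move=> st2 fr2; rewrite -n0 /= (fr2.1 0 isT).
  move=> x st2 xn stx fr2 Ix; set f := fun a => D x (a - n).
  have e2 : nmem st2 0 0 = n by rewrite (fr2.1 0 isT).
  apply: runs_seq; first exact: (runs_tree_build _ e2).
  rewrite stx => st3 fr3 [tW lv].
  have h3 i : i < n + n -> nmem st3 5 i = i./2.
    by move=> ni; rewrite (fr3.1 5 isT) (fr2.1 5 isT) half.
  apply: runs_seq.
    apply: (@runs_for _ _ _ _ _ (m - 1) _ (fun l st' =>
      tournament f n (nmem st' 4) /\
      exists2 rs, removed f n (nmem st' 4) rs & size rs = l)) => //.
    - by move=> st4 fr4; rewrite -m0 /= (fr4.1 10 isT) (fr3.1 10 isT) (fr2.1 10 isT).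
    - by split=> //; exists [::].
    - move=> l st4 lm stl fr4 [tW4 [rs rm sz]].
      have e4 : nmem st4 0 0 = n by rewrite (fr4.1 0 isT) (fr3.1 0 isT).
      have ex4 : nmem st4 12 0 = x by rewrite (fr4.1 12 isT) (fr3.1 12 isT).
      have h4 i : i < n + n -> nmem st4 5 i = i./2.
        by move=> ni; rewrite (fr4.1 5 isT) h3.
      have [w0 wn wrs le] := removed_root (n := n) ltac:(lia) tW4 rm ltac:(lia).
      apply: runs_mono; last exact: leqnn.
        apply: (runs_tree_remove (n := n)) => //; first by lia.
        by rewrite ex4.
      rewrite ex4 -/f => st5 [tW5 lv5]; split; first by [].
      case: rm => urs rsn Wrs rle.
      exists (nmem st4 4 1 :: rs); last by rewrite /= sz.
      split=> /=; first by rewrite wrs.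
      + by move=> i; rewrite inE => /predU1P[->|/rsn].
      + move=> i ni; rewrite /update /= lv5 // inE.
        by case: eqP => //= _; rewrite Wrs.
      + move=> i j; rewrite !inE negb_or => hi nj /andP[_ jrs].
        by case/predU1P: hi => [->|irs]; [apply: le|apply: rle].
  move=> st4 fr4 [tW4 [rs rm sz]]; apply: runs_sem => //=.
  have e4 : nmem st4 0 0 = n by rewrite (fr4.1 0 isT) (fr3.1 0 isT).
  have ex4 : nmem st4 12 0 = x by rewrite (fr4.1 12 isT) (fr3.1 12 isT).
  move=> z zx; rewrite /update /= ex4 e4; case: eqP => [->|zx'].
    exact: removed_radius tW4 rm sz.
  by rewrite (fr4.2 1 isT) (fr3.2 1 isT); apply: Ix; lia.
rewrite /=; set L := trunc_log 2 (n + n).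
have : (m - 1) * (100 * L.+1 + 14) <= n * (100 * L.+1 + 14) by rewrite leq_mul2r; lia.
by rewrite -mulnA; nia.
Qed.
End Radii.

(** * Critical centers and farthest points *)

Definition select_center : cmd :=
  Seq (setv 16 (NConst 0))
    (For 13 nE
      (If (BAnd (NEq (NGet 6 (var 13)) (NConst 1))
                (BNot (BAnd (NEq (var 16) (NConst 1))
                  (RLe (RGet 1 (var 17)) (RGet 1 (var 13))))))
          (Seq (setv 16 (NConst 1)) (setv 17 (var 13))) Skip)).

Definition record_center : cmd :=
  Seq (Seq (NSet 2 (NGet 1 (NConst 0)) (var 17))
           (NSet 1 (NConst 0) (NAdd (NGet 1 (NConst 0)) (NConst 1))))
    (For 13 nE
      (If (RLe (RDist (var 13) (var 17))
               (RMul (RMul (RConst 6) (RGet 0 (NConst 0))) (RGet 1 (var 13))))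
          (NSet 6 (var 13) (NConst 0)) Skip)).

(** Exactly [n] rounds are run, and a round that finds no remaining point does nothing. They
    suffice, because a chosen center eliminates at least itself. *)
Definition critical : cmd :=
  Seq (Seq (NSet 1 (NConst 0) (NConst 0)) (For 13 nE (NSet 6 (var 13) (NConst 1))))
    (For 25 nE
      (Seq select_center
           (If (NEq (var 16) (NConst 1)) record_center Skip))).

Definition farthest_point : cmd :=
  Seq (setr 4 (RConst 0))
    (For 12 nE
      (Seq (min_dist (var 12) (NConst 0) (var 18))
           (If (BNot (RLe (rvar 2) (rvar 4)))
               (Seq (setr 4 (rvar 2)) (setv 17 (var 12))) Skip))).

Definition farthest : cmd :=
  Seq (Seq (For 13 (NGet 1 (NConst 0)) (NSet 3 (var 13) (NGet 2 (var 13))))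
           (setv 18 (NGet 1 (NConst 0))))
    (For 25 (NSub kE (NGet 1 (NConst 0)))
      (Seq farthest_point
           (Seq (NSet 3 (var 18) (var 17)) (setv 18 (NAdd (var 18) (NConst 1)))))).

Definition pair_tables : cmd :=
  Seq (setv 24 (NConst 0))
    (For 12 kE
      (For 13 nE
        (Seq (Seq (NSet 7 (var 24) (var 12)) (NSet 8 (var 24) (var 13)))
             (setv 24 (NAdd (var 24) (NConst 1)))))).

Section Phases.
Context {R : realType}.
Variable D : nat -> nat -> R.
Implicit Types (st : @memory R).
Local Open Scope nat_scope.

(** Membership in [Z] after [a] rounds: the successive filters of the procedure are collected into
    one condition on the first [a] centers. *)
Definition alive (alpha : R) (r : nat -> R) (cs : nat -> nat) (a y : nat) : bool :=
  all (fun b => (6 * alpha * r y < D y (cs b))%R) (iota 0 a).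

Definition greedy_centers (n : nat) (alpha : R) (r : nat -> R)
    (cs : nat -> nat) (m : nat) : Prop :=
  forall a, a < m -> [/\ cs a < n, alive alpha r cs a (cs a) &
    forall y, y < n -> alive alpha r cs a y -> (r (cs a) <= r y)%R].

Lemma aliveS alpha r cs a y : alive alpha r cs a.+1 y =
  alive alpha r cs a y && (6 * alpha * r y < D y (cs a))%R.
Proof. by rewrite /alive -[a.+1]addn1 iotaD all_cat /= andbT. Qed.

Lemma eq_alive alpha r cs cs' a y : (forall b, b < a -> cs b = cs' b) ->
  alive alpha r cs a y = alive alpha r cs' a y.
Proof.
by move=> h; apply: eq_in_all => b; rewrite mem_iota => /andP[_] /h ->.
Qed.

Lemma count_lt (T : eqType) (p q : pred T) (s : seq T) c :
  subpred p q -> c \in s -> q c -> ~~ p c -> count p s < count q s.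
Proof.
move=> pq + qc npc; elim: s => //= a s IH; rewrite inE => /predU1P[<-|/IH lt].
  by rewrite qc (negbTE npc) ltnS; apply: sub_count.
by case pa : (p a); [rewrite (pq _ pa)|case: (q a)]; lia.
Qed.

Lemma runs_select_center n st :
  nmem st 0 0 = n ->
  runs D select_center st (fun st' =>
    if nmem st' 16 0 == 1 then
      [/\ nmem st' 17 0 < n, nmem st 6 (nmem st' 17 0) = 1 &
          forall y, y < n -> nmem st 6 y = 1 ->
            (rmem st 1 (nmem st' 17 0%N) <= rmem st 1 y)%R]
    else forall y, y < n -> nmem st 6 y <> 1) (100 * n.+1).
Proof.
move=> n0; apply: runs_le.
  apply: runs_seq; first by apply: runs_sem; [|exact: erefl].
  move=> _ /[swap] <- fr1.
  apply: (@runs_for _ _ _ _ _ n _ (fun i st' =>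
    if nmem st' 16 0 == 1 then
      [/\ nmem st' 17 0 < n, nmem st 6 (nmem st' 17 0) = 1 &
          forall y, y < i -> nmem st 6 y = 1 ->
            (rmem st 1 (nmem st' 17 0%N) <= rmem st 1 y)%R]
    else forall y, y < i -> nmem st 6 y <> 1)) => //.
    by move=> st2 fr2; rewrite -n0 /= (fr2.1 0 isT).
  move=> i st2 iN sti fr2 Ii; apply: runs_sem => //=.
  rewrite !(fr2.1 6 isT) sti !(fr2.2 1 isT) /= /update /=.
  case: (nmem st 6 i =P 1) => /= [zi|zi]; last first.
    case: eqP Ii => _ /=.
      move=> [h1 h2 h3]; split=> // y; rewrite ltnS leq_eqVlt.
      by case/predU1P=> [-> /zi|/h3].
    by move=> h y; rewrite ltnS leq_eqVlt => /predU1P[->|/h].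
  have lastN (P : nat -> Prop) : (forall y, y < i -> P y) -> P i -> forall y, y < i.+1 -> P y.
    by move=> h hi y; rewrite ltnS leq_eqVlt => /predU1P[->|/h].
  case: (nmem st2 16 0 =P 1) Ii => [e|e] /= Ii; last first.
    by rewrite sti; split=> //; apply: lastN => // y /Ii.
  case: Ii => h1 h2 h3.
  case: (leP (rmem st 1 (nmem st2 17 0%N)) (rmem st 1 i)) => le /=.
    by rewrite e; split=> //; apply: lastN.
  rewrite sti; split=> //; apply: lastN => // y yi zy.
  by apply: le_trans (ltW le) (h3 y yi zy).
by rewrite /=; lia.
Qed.

(** The hypothesis on [D c c] makes the new center fail its own filter; this gives the strict
    decrease of the number of remaining points. *)
Lemma runs_record_center n alpha r cs m c st :
  nmem st 0 0 = n -> rmem st 0 0 = alpha -> rmem st 1 =1 r ->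
  nmem st 2 =1 cs -> nmem st 1 0 = m -> nmem st 17 0 = c -> c < n ->
  (D c c <= 6 * alpha * r c)%R ->
  (forall y, y < n -> nmem st 6 y = alive alpha r cs m y) ->
  greedy_centers n alpha r cs m -> alive alpha r cs m c ->
  (forall y, y < n -> alive alpha r cs m y -> (r c <= r y)%R) ->
  runs D record_center st (fun st' =>
    [/\ nmem st' 1 0 = m.+1, greedy_centers n alpha r (nmem st' 2) m.+1,
      (forall y, y < n -> nmem st' 6 y = alive alpha r (nmem st' 2) m.+1 y) &
      count (alive alpha r (nmem st' 2) m.+1) (iota 0 n) <
      count (alive alpha r cs m) (iota 0 n)]) (100 * n.+1).
Proof.
move=> n0 a0 rr csE m0 c0 cn Dc zE gr ac minc.
set cs' := update (nmem st) 2 m c 2.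
have cs'E b : cs' b = if b == m then c else cs b.
  by rewrite /cs' /update /=; case: eqP.
have al y : alive alpha r cs' m.+1 y =
    alive alpha r cs m y && (6 * alpha * r y < D y c)%R.
  rewrite aliveS cs'E eqxx; congr (_ && _); apply: eq_alive => b bm.
  by rewrite cs'E; case: eqP => //; lia.
apply: runs_le.
  apply: runs_seq; first by apply: runs_sem; [|exact: erefl].
  move=> _ /[swap] <- fr1.
  apply: runs_mono; last exact: leqnn.
    apply: (@runs_frame _ _ _ _ _ _).
    apply: (@runs_for _ _ _ _ _ n _ (fun i st' => forall y, y < n ->
        nmem st' 6 y = alive alpha r cs m y && ((i <= y) || (6 * alpha * r y < D y c)%R))) => //.
    - by move=> st2 fr2; rewrite -n0 /= (fr2.1 0 isT).
    - by move=> y yn /=; rewrite /update /= zE // andbT.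
    - move=> i st2 iN sti fr2 Ii; apply: runs_sem => //= y yn.
      rewrite sti (fr2.1 17 isT) (fr2.2 1 isT) (fr2.2 0 isT) /= /update /= c0 a0 rr.
      have := Ii y yn; case: (y =P i) => [->|yi].
        by rewrite ltnn leqnn andbT /= ltNge; case: ifP => /=; rewrite ?eqxx ?andbF ?andbT.
      have -> : (i < y) = (i <= y) by lia.
      by case: ifP => _ //=; rewrite /update /=; case: eqP.
  move=> st' [zE' fr2].
  have e2 : nmem st' 2 =1 cs'.
    by move=> b; rewrite (fr2.1 2 isT) /= /cs' /update /= m0 c0.
  have eal a y : alive alpha r (nmem st' 2) a y = alive alpha r cs' a y.
    by apply: eq_alive => b _; apply: e2.
  split.
  - by rewrite (fr2.1 1 isT) /= /update /= m0 addn1.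
  - move=> a; rewrite ltnS leq_eqVlt e2 cs'E => /predU1P[->|am].
      rewrite eqxx; have E y : alive alpha r (nmem st' 2) m y = alive alpha r cs m y.
        by apply: eq_alive => b bm; rewrite e2 cs'E; case: eqP => //; lia.
      by split=> //; [rewrite E|move=> y yn; rewrite E; apply: minc].
    have E y : alive alpha r (nmem st' 2) a y = alive alpha r cs a y.
      by apply: eq_alive => b bm; rewrite e2 cs'E; case: eqP => //; lia.
    have -> : (a == m) = false by apply/eqP; lia.
    by have [h1 h2 h3] := gr a am; split=> // [|y yn]; rewrite E //; apply: h3.
  - by move=> y yn; rewrite zE' // eal al leqNgt yn.
  - apply: (@count_lt _ _ _ _ c); rewrite ?mem_iota //.
      by move=> y; rewrite /= eal al => /andP[].
    by rewrite eal al negb_and -leNgt Dc orbT.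
by rewrite /=; lia.
Qed.

Lemma runs_critical n alpha r st :
  nmem st 0 0 = n -> rmem st 0 0 = alpha -> rmem st 1 =1 r ->
  (forall c, c < n -> (D c c <= 6 * alpha * r c)%R) ->
  runs D critical st (fun st' =>
    greedy_centers n alpha r (nmem st' 2) (nmem st' 1 0) /\
    forall y, y < n -> ~~ alive alpha r (nmem st' 2) (nmem st' 1 0) y)
  (1000 * (n.+1 * n.+1)).
Proof.
move=> n0 a0 rr Dr; apply: runs_le.
  apply: runs_seq.
    apply: runs_seq; first by apply: runs_sem; [|exact: erefl].
    move=> _ /[swap] <- fr0.
    apply: runs_mono; last exact: leqnn.
      apply: (@runs_frame _ _ _ _ _ _).
      apply: (@runs_for _ _ _ _ _ n _ (fun i st' => forall y, y < i -> nmem st' 6 y = 1)) => //.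
        by move=> st2 fr2; rewrite -n0 /= (fr2.1 0 isT).
      move=> i st2 iN sti fr2 Ii; apply: runs_sem => //= y yi.
      by rewrite /update /= sti; case: eqP => // ?; apply: Ii; lia.
    move=> st1 [z1 fr1]; have e : nmem st1 1 0 = 0 by rewrite (fr1.1 1 isT).
    exact: (conj z1 e).
  move=> st1 fr1 [z1 nc1].
  apply: runs_mono; last exact: leqnn.
    apply: (@runs_for _ _ _ _ _ n _ (fun i st' =>
      [/\ greedy_centers n alpha r (nmem st' 2) (nmem st' 1 0),
      (forall y, y < n -> nmem st' 6 y = alive alpha r (nmem st' 2) (nmem st' 1 0) y) &
      count (alive alpha r (nmem st' 2) (nmem st' 1 0)) (iota 0 n) <= n - i])) => //.
    - by move=> st2 fr2; rewrite -n0 /= (fr2.1 0 isT) (fr1.1 0 isT).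
    - rewrite /= /update /= nc1; split=> //.
      by rewrite -{2}(size_iota 0 n) subn0 count_size.
    - move=> i st2 iN sti fr2 [gr zE cnt].
      have e2 : nmem st2 0 0 = n by rewrite (fr2.1 0 isT) (fr1.1 0 isT).
      have r2 : rmem st2 1 =1 r by move=> y; rewrite (fr2.2 1 isT) (fr1.2 1 isT).
      apply: runs_seq; first exact: (runs_select_center e2).
      move=> st3 fr3 sel; apply: runs_if => /= fnd.
        rewrite fnd in sel; case: sel => cn zc minc.
        apply: runs_mono; last exact: leqnn.
          apply: (@runs_record_center n alpha r (nmem st2 2) (nmem st2 1 0) (nmem st3 17 0)) => //.
          - by rewrite (fr3.1 0 isT).
          - by rewrite (fr3.2 0 isT) (fr2.2 0 isT) (fr1.2 0 isT).
          - by move=> y; rewrite (fr3.2 1 isT).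
          - exact: (fr3.1 2 isT).
          - exact: (fr3.1 1 isT).
          - exact: Dr.
          - by move=> y yn; rewrite (fr3.1 6 isT) zE.
          - by rewrite zE // in zc; case: (alive _ _ _ _ _) zc.
          - by move=> y yn ay; rewrite -!r2; apply: minc; rewrite ?zE ?ay.
        move=> st4 [m4 gr4 z4 cnt4]; rewrite /= /update /= m4; split=> //.
        have h := leq_trans cnt4 cnt; rewrite -ltnS; apply: leq_trans h _; lia.
      rewrite (negbTE fnd) in sel.
      apply: runs_sem => //; rewrite /= /update /=.
      have E a y : alive alpha r (nmem st3 2) a y = alive alpha r (nmem st2 2) a y.
        by apply: eq_alive => b _; rewrite (fr3.1 2 isT).
      have dead y : y < n -> ~~ alive alpha r (nmem st2 2) (nmem st2 1 0) y.
        by move=> yn; apply/negP => ay; apply: (sel y yn); rewrite zE // ay.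
      rewrite (fr3.1 1 isT); split.
      + move=> a am; rewrite (fr3.1 2 isT).
        by have [h1 h2 h3] := gr a am; split=> // [|y yn]; rewrite E //; apply: h3.
      + by move=> y yn; rewrite (fr3.1 6 isT) E zE.
      + rewrite (eq_in_count (a2 := pred0)) ?count_pred0 // => y.
        by rewrite mem_iota /= => yn; rewrite E; apply/negbTE/dead; lia.
  move=> st' [gr zE]; rewrite subnn => cnt; split=> // y yn.
  have /hasPn h : ~~ has (alive alpha r (nmem st' 2) (nmem st' 1 0)) (iota 0 n).
    by rewrite has_count; lia.
  by apply: h; rewrite mem_iota.
rewrite /=; nia.
Qed.
End Phases.

(** * Farthest-point insertion and the tables of pairs *)

Section MorePhases.
Context {R : realType}.
Variable D : nat -> nat -> R.
Implicit Types (st : @memory R) (A C : nat -> nat).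
Local Open Scope nat_scope.

Definition set_dist (A : nat -> nat) (N z : nat) : R :=
  min_upto (fun l => D z (A l)) N.

Lemma eq_set_dist A A' N z : 0 < N -> (forall l, l < N -> A l = A' l) ->
  set_dist A N z = set_dist A' N z.
Proof. by move=> N0 AA; apply: eq_min_upto => // l /AA ->. Qed.

(** The running maximum starts at 0. If no point exceeds it, the selected point is a stale value
    about which nothing is claimed; the first alternative records this case, which is excluded later
    as long as [N < n]. *)
Definition farthest_choice (n : nat) (A : nat -> nat) (N : nat) : Prop :=
  exists2 best : R, forall z, z < n -> (set_dist A N z <= best)%R &
    best = 0%R \/ A N < n /\ best = set_dist A N (A N).

Lemma eq_farthest_choice n A A' N : 0 < N -> (forall l, l <= N -> A l = A' l) ->
  farthest_choice n A N -> farthest_choice n A' N.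
Proof.
move=> N0 AA [b le h]; exists b => [z zn|].
  by rewrite -(@eq_set_dist A) => [|//|l /ltnW /AA //]; apply: le.
case: h => [->|[AN ->]]; [by left|right; rewrite -AA //; split=> //].
by apply: eq_set_dist => // l lN; rewrite AA // ltnW.
Qed.

Lemma runs_farthest_point n N st :
  nmem st 0 0 = n -> nmem st 18 0 = N -> 0 < N ->
  runs D farthest_point st (fun st' => exists2 best : R,
    forall z, z < n -> (set_dist (nmem st 3) N z <= best)%R &
    best = 0%R \/ nmem st' 17 0 < n /\
      best = set_dist (nmem st 3) N (nmem st' 17 0))
    (200 * (n.+1 * N.+1)).
Proof.
move=> n0 N0 Npos; apply: runs_le.
  apply: runs_seq; first by apply: runs_sem; [|exact: erefl].
  move=> _ /[swap] <- fr1.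
  apply: runs_mono; last exact: leqnn.
    apply: (@runs_for _ _ _ _ _ n _ (fun i st' =>
      (forall z, z < i -> (set_dist (nmem st 3) N z <= rmem st' 4 0%N)%R) /\
      (rmem st' 4 0 = 0%R \/ nmem st' 17 0 < n /\
       rmem st' 4 0 = set_dist (nmem st 3) N (nmem st' 17 0)))) => //.
    - by move=> st2 fr2; rewrite -n0 /= (fr2.1 0 isT).
    - by split=> //; left.
    - move=> i st2 iN sti fr2 [le h].
      apply: runs_seq.
        apply: (@runs_min_dist _ _ _ _ _ _ N) => //.
        by rewrite /= (fr2.1 18 isT).
      move=> st3 fr3; set d := min_upto _ _.
      have -> : d = set_dist (nmem st 3) N i.
        by apply: eq_min_upto => // l _; rewrite /= sti (fr2.1 3 isT).
      move=> {d} d2; apply: runs_sem => //=.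
      have e17 : nmem st3 17 0 = nmem st2 17 0 by apply: (fr3.1 17 isT).
      have e4 : rmem st3 4 0 = rmem st2 4 0 by apply: (fr3.2 4 isT).
      have e12 : nmem st3 12 0 = i by rewrite (fr3.1 12 isT).
      rewrite d2 e4.
      case: (leP (set_dist (nmem st 3) N i) (rmem st2 4 0%N)) => lt /=;
        rewrite /update /= ?d2 ?e17 ?e4 ?e12; split.
      + by move=> z; rewrite ltnS leq_eqVlt => /predU1P[->|/le].
      + exact: h.
      + move=> z; rewrite ltnS leq_eqVlt => /predU1P[->//|/le h'].
        exact: le_trans h' (ltW lt).
      + by right.
  by move=> st' [le h]; exists (rmem st' 4 0).
by rewrite /=; nia.
Qed.

Lemma runs_farthest n k nc C st :
  nmem st 0 0 = n -> nmem st 0 1 = k -> nmem st 1 0 = nc -> nmem st 2 =1 C ->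
  0 < nc <= k ->
  runs D farthest st (fun st' =>
    (forall l, l < nc -> nmem st' 3 l = C l) /\
    forall s, nc <= s < k -> farthest_choice n (nmem st' 3) s)
    (1000 * (k.+1 * k.+1 * n.+1)).
Proof.
move=> n0 k0 c0 CE nck; apply: runs_le.
  apply: runs_seq.
    apply: runs_seq.
      apply: (@runs_for _ _ _ _ _ nc _
        (fun i st' => forall j, j < i -> nmem st' 3 j = C j)) => //.
        by move=> st2 fr2; rewrite -c0 /= (fr2.1 1 isT).
      move=> i st2 iN sti fr2 Ii; apply: runs_sem => //= j ji.
      rewrite /update /= sti (fr2.1 2 isT) CE; case: eqP => [->//|h].
      by apply: Ii; lia.
    move=> st1 fr1 h1; apply: (@runs_sem _ _ _ _ (fun st' =>
      (forall j, j < nc -> nmem st' 3 j = C j) /\ nmem st' 18 0 = nc)) => //=.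
    by rewrite /update /= (fr1.1 1 isT).
  move=> st1 fr1 [h1 e1].
  apply: runs_mono; last exact: leqnn.
    apply: (@runs_for _ _ _ _ _ (k - nc) _ (fun i st' =>
      [/\ forall j, j < nc -> nmem st' 3 j = C j, nmem st' 18 0 = nc + i &
       forall s, nc <= s < nc + i -> farthest_choice n (nmem st' 3) s])) => //.
    - move=> st2 fr2; rewrite /= (fr2.1 0 isT) (fr2.1 1 isT) (fr1.1 0 isT).
      by rewrite (fr1.1 1 isT) k0 c0.
    - by split=> //; [rewrite addn0|move=> s /=; lia].
    - move=> i st2 iN sti fr2 [h2 e2 far2].
      apply: (@runs_le _ _ _ _ _ _ (200 * (n.+1 * k.+1) + 30)).
        apply: runs_seq.
          apply: (@runs_farthest_point n (nc + i)) => //; last by lia.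
          by rewrite (fr2.1 0 isT) (fr1.1 0 isT).
        move=> st3 fr3 ch; apply: runs_sem => //=.
        rewrite /update /= (fr3.1 18 isT) e2; split=> [j jn||s si].
        + by case: eqP => [|_]; [lia|rewrite (fr3.1 3 isT) h2].
        + by rewrite addn1 addnS.
        + have [si'|si'] := ltnP s (nc + i).
            apply: (@eq_farthest_choice _ (nmem st2 3)); [lia| |by apply: far2; lia].
            by move=> l ls /=; case: eqP => [|_]; [lia|rewrite (fr3.1 3 isT)].
          have -> : s = nc + i by lia.
          have E z : set_dist (fun j => if (3 == 3) && (j == nc + i)
              then nmem st3 17 0 else nmem st3 3 j) (nc + i) z =
              set_dist (nmem st2 3) (nc + i) z.
            apply: eq_set_dist; first by lia.
            by move=> l li /=; case: eqP => [|_]; [lia|rewrite (fr3.1 3 isT)].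
          case: ch => b le h; exists b => [z zn|]; first by rewrite E; apply: le.
          by rewrite eqxx; case: h => [->|[h1' h2']]; [left|right; rewrite E].
      by rewrite /=; nia.
  move=> st' [h2 _ far]; split=> // s sk; apply: far; lia.
rewrite /=.
have : (k - nc) * (200 * (n.+1 * k.+1) + 30 + 5 + 10) <= k * (200 * (n.+1 * k.+1) + 45).
  by apply: leq_mul; lia.
have : nc <= k by lia.
nia.
Qed.

Lemma runs_pair_tables n k st :
  nmem st 0 0 = n -> nmem st 0 1 = k -> 0 < n ->
  runs D pair_tables st (fun st' => nmem st' 24 0 = k * n /\
    forall e, e < k * n -> nmem st' 7 e = e %/ n /\ nmem st' 8 e = e %% n)
    (200 * (n.+1 * k.+1)).
Proof.
move=> n0 k0 npos; apply: runs_le.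
  apply: runs_seq; first by apply: runs_sem; [|exact: erefl].
  move=> _ /[swap] <- fr1.
  apply: (@runs_for _ _ _ _ _ k _ (fun i st' => nmem st' 24 0 = i * n /\
    forall e, e < i * n -> nmem st' 7 e = e %/ n /\ nmem st' 8 e = e %% n)) => //.
    by move=> st2 fr2; rewrite -k0 /= (fr2.1 0 isT).
  move=> i st2 iN sti fr2 Ii.
  apply: runs_mono; last exact: leqnn.
    apply: (@runs_for _ _ _ _ _ n _ (fun j st' => nmem st' 24 0 = i * n + j /\
      forall e, e < i * n + j -> nmem st' 7 e = e %/ n /\ nmem st' 8 e = e %% n)) => //.
    - by move=> st3 fr3; rewrite -n0 /= (fr3.1 0 isT) (fr2.1 0 isT).
    - by rewrite addn0.
    - move=> j st3 jN stj fr3 [e3 Ij]; apply: runs_sem => //=.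
      rewrite /update /= e3; split=> [|e]; first by rewrite addn1 addnS.
      rewrite addnS ltnS leq_eqVlt stj (fr3.1 12 isT) /= /update /= sti.
      case/predU1P => [->|lt].
        by rewrite eqxx divnMDl // modnMDl divn_small // modn_small // addn0.
      by case: eqP => [|_]; [lia|apply: Ij].
  by move=> st3 [e3 I3]; rewrite /= /update /= mulSnr.
by rewrite /=; nia.
Qed.
End MorePhases.

(** * Words and candidate swaps *)

(** The letters act in turn on a copy of the current set, so a later letter overrides an earlier one
    at the same position; [swap_word] tests its last letter first for that reason. *)
Definition build_candidate : cmd :=
  Seq (For 14 kE (NSet 3 (NAdd (var 20) (var 14)) (NGet 3 (NAdd (var 19) (var 14)))))
    (For 14 (var 23)
      (NSet 3 (NAdd (var 20) (NGet 7 (NGet 9 (var 14)))) (NGet 8 (NGet 9 (var 14))))).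

Definition check_distinct : cmd :=
  For 12 kE
    (For 13 (var 12)
      (If (NEq (NGet 3 (NAdd (var 20) (var 12))) (NGet 3 (NAdd (var 20) (var 13))))
          (setv 16 (NConst 0)) Skip)).

Definition check_feasible : cmd :=
  For 12 (NGet 1 (NConst 0))
    (Seq (min_dist (NGet 2 (var 12)) (var 20) kE)
      (If (RLe (rvar 2) (RMul (RGet 0 (NConst 0)) (RGet 1 (NGet 2 (var 12)))))
          Skip (setv 16 (NConst 0)))).

Definition check_candidate : cmd :=
  Seq (setv 16 (NConst 1))
    (Seq check_distinct
      (Seq check_feasible
        (Seq (cost_at 20)
          (If (BAnd (RLe (rvar 5)
                      (RMul (RSub (RConst 1) (RGet 0 (NConst 1))) (rvar 6)))
                    (BNot (RLe (rvar 6) (rvar 5))))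
              Skip (setv 16 (NConst 0)))))).

Definition next_word : cmd :=
  Seq (setv 14 (NConst 0))
    (Seq
      (While (BAnd (NLt (var 14) (var 23))
                   (NEq (NAdd (NGet 9 (var 14)) (NConst 1)) (var 24)))
        (Seq (NSet 9 (var 14) (NConst 0)) (setv 14 (NAdd (var 14) (NConst 1)))))
      (If (NLt (var 14) (var 23))
          (NSet 9 (var 14) (NAdd (NGet 9 (var 14)) (NConst 1)))
          (setv 22 (NConst 1)))).

Section Words.
Local Open Scope nat_scope.

(* The first digit is the least significant one. *)
Fixpoint word_value (N : nat) (w : nat -> nat) (m : nat) : nat :=
  if m is m'.+1 then word_value N w m' + w m' * N ^ m' else 0.

Lemma eq_word_value N w w' m : (forall l, l < m -> w l = w' l) ->
  word_value N w m = word_value N w' m.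
Proof. by elim: m => //= m IH ww; rewrite ww // IH // => l /ltnW/ww. Qed.

Lemma word_value0 N m : word_value N (fun=> 0) m = 0.
Proof. by elim: m => //= m ->. Qed.

Lemma word_value_lt N w m : (forall l, l < m -> w l < N) ->
  word_value N w m < N ^ m.
Proof.
elim: m => //= m IH wN; have := IH (fun l lm => wN l (ltnW lm)).
have := wN m (ltnSn m); rewrite expnS => wm vm.
have : (w m).+1 * N ^ m <= N * N ^ m by rewrite leq_mul2r wm orbT.
by rewrite mulSn; lia.
Qed.

(** Uniqueness of digits in base [N]. It is needed because the search invariant speaks of the values
    of words, while completeness of the search concerns the words themselves. *)
Lemma word_value_inj N w w' m :
  (forall l, l < m -> w l < N) -> (forall l, l < m -> w' l < N) ->
  word_value N w m = word_value N w' m -> forall l, l < m -> w l = w' l.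
Proof.
elim: m => //= m IH wN wN'.
have v := word_value_lt (fun l lm => wN l (ltnW lm)).
have v' := word_value_lt (fun l lm => wN' l (ltnW lm)).
move=> e.
have em : w m = w' m.
  have := congr1 (fun x => x %/ N ^ m) e.
  by rewrite !(addnC (word_value _ _ _)) !divnMDl ?divn_small ?addn0 //; lia.
move=> l; rewrite ltnS leq_eqVlt => /predU1P[->//|lm].
by apply: IH lm => [i /ltnW/wN||] //; [move=> i /ltnW/wN'|rewrite em in e; lia].
Qed.

Lemma word_value_full N w m : 0 < N -> (forall l, l < m -> (w l).+1 = N) ->
  (word_value N w m).+1 = N ^ m.
Proof.
move=> N0; elim: m => //= m IH wN.
have := IH (fun l lm => wN l (ltnW lm)); have := wN m (ltnSn m).
by rewrite expnS => <- <-; rewrite mulSn; lia.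
Qed.

(** The carry: the digits below [l] contribute [N ^ l - 1] before and 0 after, while digit [l] adds
    [N ^ l]. *)
Lemma word_value_next N w w' l m : 0 < N -> l < m ->
  (forall i, i < l -> (w i).+1 = N) -> (forall i, i < l -> w' i = 0) ->
  w' l = (w l).+1 -> (forall i, l < i < m -> w' i = w i) ->
  word_value N w' m = (word_value N w m).+1.
Proof.
move=> N0; elim: m => //= m IH lm full zero wl ww.
case: (l =P m) lm => [e _|/eqP ne lm].
  subst m; have -> : word_value N w' l = 0.
    rewrite (@eq_word_value _ _ (fun=> 0)) //.
    exact: word_value0.
  have := word_value_full N0 full; rewrite wl mulSn; lia.
rewrite IH //; [|by lia|by move=> i im; apply: ww; lia].
by rewrite ww ?addSn //; lia.
Qed.

(* The letter [e] of a word stands for the exchange of the point in position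
   [e %/ n] for the point [e %% n]. *)
Fixpoint swap_word (n : nat) (w : nat -> nat) (m : nat) (S : nat -> nat)
    : nat -> nat :=
  if m is m'.+1 then
    fun p => if p == w m' %/ n then w m' %% n else swap_word n w m' S p
  else S.

Lemma eq_swap_word n w w' m S S' p :
  (forall l, l < m -> w l = w' l) -> S p = S' p ->
  swap_word n w m S p = swap_word n w' m S' p.
Proof.
move=> + Sp; elim: m => //= m IH ww; rewrite ww //; case: eqP => // _.
by apply: IH => l /ltnW/ww.
Qed.

End Words.

(** * Testing one candidate, and passing to the next word *)

Section LocalSearch.
Context {R : realType}.
Variable D : nat -> nat -> R.
Variables (n k nc tt : nat) (alpha eps : R) (r : nat -> R) (C : nat -> nat).
Implicit Types (st : @memory R) (S A : nat -> nat).
Local Open Scope nat_scope.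

Definition index_cost S : R := (\sum_(z <- iota 0 n) set_dist D S k z)%R.

(** Distinct entries keep the set at size [k]. The strict inequality matters only at cost 0, where
    it rejects words that permute the positions without changing the set. *)
Definition accepted S S' : bool :=
  [&& uniq [seq S' l | l <- iota 0 k],
      all (fun a => (set_dist D S' k (C a) <= alpha * r (C a))%R) (iota 0 nc),
      (index_cost S' <= (1 - eps) * index_cost S)%R &
      (index_cost S' < index_cost S)%R].

Lemma eq_index_cost S S' : 0 < k -> (forall p, p < k -> S p = S' p) ->
  index_cost S = index_cost S'.
Proof. by move=> k0 SS; apply: eq_bigr => z _; apply: eq_set_dist. Qed.

Lemma eq_accepted S1 S1' S2 S2' : 0 < k ->
  (forall p, p < k -> S1 p = S2 p) -> (forall p, p < k -> S1' p = S2' p) ->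
  accepted S1 S1' = accepted S2 S2'.
Proof.
move=> k0 e e'; rewrite /accepted (eq_index_cost k0 e) (eq_index_cost k0 e').
congr (uniq _ && (_ && _)).
  by apply/eq_in_map => l; rewrite mem_iota => /e'.
by apply: eq_all => a; rewrite (eq_set_dist D _ k0 e').
Qed.

Lemma all_iotaS (p : pred nat) m :
  all p (iota 0 m.+1) = all p (iota 0 m) && p m.
Proof. by rewrite -[m.+1]addn1 iotaD all_cat /= andbT. Qed.

Lemma uniq_pairwise S : uniq [seq S l | l <- iota 0 k] =
  all (fun p => all (fun q => S p != S q) (iota 0 p)) (iota 0 k).
Proof.
elim: k => // m IH; rewrite -[m.+1]addn1 iotaD map_cat all_cat [map _ (iota _ 1)]/= add0n.
rewrite cats1 rcons_uniq IH andbC /= andbT; congr (_ && _).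
apply/idP/allP => [nin q qm|h].
  by apply: contraNneq nin => ->; apply: map_f.
by apply/negP => /mapP[q /h /eqP].
Qed.

Definition search_env st : Prop :=
  [/\ nmem st 0 0 = n, nmem st 0 1 = k, rmem st 0 0 = alpha & rmem st 0 1 = eps] /\
  [/\ nmem st 1 0 = nc, nmem st 2 =1 C, rmem st 1 =1 r, nmem st 23 0 = tt &
      nmem st 24 0 = k * n /\
      forall e, e < k * n -> nmem st 7 e = e %/ n /\ nmem st 8 e = e %% n].

Lemma search_env_frame c st st' :
  ~~ has (mem (nat_writes c)) [:: 0; 2; 7; 8; 23; 24] ->
  ~~ has (mem (real_writes c)) [:: 0; 1] ->
  nmem st' 1 0 = nmem st 1 0 ->
  frame c st st' -> search_env st -> search_env st'.
Proof.
rewrite /= !orbF !negb_or => /and5P[w0 w2 w7 w8 /andP[w23 w24]] /andP[r0 r1] e1 [fn fr].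
case=> [[h1 h2 h3 h4] [h5 h6 h7 h8 [h9 h10]]]; split.
  by split; rewrite ?fn ?fr.
split; rewrite ?e1 ?fn //; first by move=> a; rewrite fn.
  by move=> a; rewrite fr.
by split=> // e /h10; rewrite !fn.
Qed.

Hypotheses (k0 : 0 < k) (n0 : 0 < n) (kn : k <= n) (ttk : tt <= k) (nck : nc <= k).

Definition word (w : nat -> nat) : Prop := forall l, l < tt -> w l < k * n.

Lemma runs_build_candidate st o :
  search_env st -> word (nmem st 9) -> nmem st 19 0 = o -> nmem st 20 0 = o + k ->
  runs D build_candidate st (fun st' =>
    (forall i, i < o + k -> nmem st' 3 i = nmem st 3 i) /\
    forall p, p < k -> nmem st' 3 (o + k + p) =
      swap_word n (nmem st 9) tt (fun l => nmem st 3 (o + l)) p) (200 * k.+1).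
Proof.
case=> [[h1 h2 h3 h4] [h5 h6 h7 h8 [h9 h10]]] ww o19 o20; apply: runs_le.
  apply: runs_seq.
    apply: (@runs_for _ _ _ _ _ k _ (fun i st' =>
      (forall i, i < o + k -> nmem st' 3 i = nmem st 3 i) /\
      forall p, p < i -> nmem st' 3 (o + k + p) = nmem st 3 (o + p))) => //.
      by move=> st2 fr2; rewrite -h2 /= (fr2.1 0 isT).
    move=> i st2 ik sti fr2 [lo hi]; apply: runs_sem => //=.
    rewrite /update /= sti (fr2.1 19 isT) (fr2.1 20 isT) o19 o20.
    split=> [j jo|p]; first by case: eqP => [|_]; [lia|apply: lo].
    rewrite ltnS leq_eqVlt => /predU1P[->|pi]; first by rewrite eqxx lo; lia.
    by case: eqP => [|_]; [lia|apply: hi].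
  move=> st1 fr1 [lo1 hi1].
  apply: (@runs_for _ _ _ _ _ tt _ (fun i st' =>
      (forall i, i < o + k -> nmem st' 3 i = nmem st 3 i) /\
      forall p, p < k -> nmem st' 3 (o + k + p) =
        swap_word n (nmem st 9) i (fun l => nmem st 3 (o + l)) p)) => //.
    by move=> st2 fr2; rewrite -h8 /= (fr2.1 23 isT) (fr1.1 23 isT).
  move=> i st2 it sti fr2 [lo hi]; apply: runs_sem => //=.
  rewrite /update /= sti (fr2.1 20 isT) (fr2.1 7 isT) (fr2.1 8 isT) (fr2.1 9 isT).
  rewrite (fr1.1 20 isT) (fr1.1 7 isT) (fr1.1 8 isT) (fr1.1 9 isT) o20.
  have [-> ->] := h10 _ (ww i it).
  split=> [j jo|p pk].
    by case: eqP jo => [->|_ /lo //]; rewrite ltnNge leq_addr.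
  by rewrite eqn_add2l; case: eqP => // _; apply: hi.
rewrite /=; lia.
Qed.

Lemma runs_check_distinct st o :
  nmem st 0 1 = k -> nmem st 20 0 = o ->
  runs D check_distinct st (fun st' => (nmem st' 16 0 == 1) =
      (nmem st 16 0 == 1) && uniq [seq nmem st 3 (o + l) | l <- iota 0 k])
    (200 * (k.+1 * k.+1)).
Proof.
move=> h2 o20; apply: runs_le.
  rewrite (uniq_pairwise (fun l => nmem st 3 (o + l))).
  apply: (@runs_for _ _ _ _ _ k _ (fun i st' => (nmem st' 16 0 == 1) =
      (nmem st 16 0 == 1) && all (fun p =>
       all (fun q => nmem st 3 (o + p) != nmem st 3 (o + q)) (iota 0 p)) (iota 0 i))) => //.
  - by move=> st2 fr2; rewrite -h2 /= (fr2.1 0 isT).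
  - by rewrite andbT.
  - move=> i st2 ik sti fr2 Ii.
    apply: (@runs_le _ _ _ _ _ _ (k * 60 + 20)).
      apply: runs_mono; last exact: leqnn.
        apply: (@runs_for _ _ _ _ _ i _ (fun j st' => (nmem st' 16 0 == 1) =
          (nmem st2 16 0 == 1) &&
           all (fun q => nmem st 3 (o + i) != nmem st 3 (o + q)) (iota 0 j))) => //.
        + by move=> st3 fr3; rewrite -sti /= (fr3.1 12 isT).
        + by rewrite andbT.
        + move=> j st3 ji stj fr3 Ij; apply: runs_sem => //; rewrite all_iotaS /=.
          rewrite stj (fr3.1 20 isT) (fr3.1 12 isT) (fr3.1 3 isT) /= /update /= sti.
          rewrite (fr2.1 20 isT) o20 !(fr3.1 3 isT) !(fr2.1 3 isT) /=.
          rewrite andbA -Ij.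
          by case: (_ == nmem st 3 (o + j)); rewrite /= ?andbF ?andbT.
      by move=> st3 Ij; rewrite all_iotaS andbA -Ii -Ij.
    by rewrite /=; lia.
by rewrite /=; nia.
Qed.

Lemma runs_check_feasible st o :
  search_env st -> nmem st 20 0 = o ->
  runs D check_feasible st (fun st' => (nmem st' 16 0 == 1) =
      (nmem st 16 0 == 1) &&
      all (fun a => (set_dist D (fun l => nmem st 3 (o + l)) k (C a) <=
                     alpha * r (C a))%R) (iota 0 nc))
    (200 * (k.+1 * k.+1)).
Proof.
case=> [[h1 h2 h3 h4] [h5 h6 h7 h8 _]] o20; apply: runs_le.
  apply: (@runs_for _ _ _ _ _ nc _ (fun i st' => (nmem st' 16 0 == 1) =
      (nmem st 16 0 == 1) &&
      all (fun a => (set_dist D (fun l => nmem st 3 (o + l)) k (C a) <=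
                     alpha * r (C a))%R) (iota 0 i))) => //.
  - by move=> st2 fr2; rewrite -h5 /= (fr2.1 1 isT).
  - by rewrite andbT.
  - move=> i st2 ik sti fr2 Ii.
    apply: runs_seq.
      apply: (@runs_min_dist _ _ _ _ _ _ k) => //.
      by rewrite /= (fr2.1 0 isT).
    move=> st3 fr3; set d := min_upto _ _.
    have -> : d = set_dist D (fun l => nmem st 3 (o + l)) k (C i).
      apply: eq_min_upto => // l _.
      by rewrite /= sti (fr2.1 3 isT) (fr2.1 2 isT) (fr2.1 20 isT) h6 o20.
    move=> {d} d3; apply: runs_sem => //; rewrite all_iotaS andbA -Ii /=.
    rewrite d3 (fr3.1 12 isT) (fr3.1 2 isT) (fr3.2 0 isT) (fr3.2 1 isT) sti.
    rewrite (fr2.1 2 isT) (fr2.2 0 isT) (fr2.2 1 isT) h3 h6 h7.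
    have e16 : nmem st3 16 0 = nmem st2 16 0 by rewrite (fr3.1 16 isT).
    by case: ifP => _; rewrite /= /update /= ?e16 ?andbF ?andbT.
rewrite /=.
have : nc * ((2 + 1 + 1 + 2 + 2 + 60) * k.+1) <= k * (70 * k.+1) by apply: leq_mul; lia.
nia.
Qed.

Lemma runs_check_candidate st o S :
  search_env st -> nmem st 20 0 = o -> rmem st 6 0 = index_cost S ->
  runs D check_candidate st (fun st' => (nmem st' 16 0 == 1) =
      accepted S (fun l => nmem st 3 (o + l))) (1000 * (n.+1 * k.+1)).
Proof.
move=> env o20 c6; case: (env) => [[h1 h2 h3 h4] [h5 h6 h7 h8 _]]; apply: runs_le.
  apply: runs_seq; first by apply: runs_sem; [|exact: erefl].
  move=> _ /[swap] <- fr1.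
  apply: runs_seq; first exact: (@runs_check_distinct _ o).
  move=> st2 fr2 e2.
  apply: runs_seq.
    apply: (@runs_check_feasible _ o); last by rewrite (fr2.1 20 isT).
    by apply: (search_env_frame _ _ _ fr2) => //; rewrite (fr2.1 1 isT).
  move=> st3 fr3 e3.
  apply: runs_seq.
    apply: (@runs_cost_at _ _ _ n k) => //.
      by rewrite (fr3.1 0 isT) (fr2.1 0 isT).
    by rewrite (fr3.1 0 isT) (fr2.1 0 isT).
  move=> st4 fr4 e4; apply: runs_sem => //.
  have {}e3 : (nmem st4 16 0 == 1) = uniq [seq nmem st 3 (o + l) | l <- iota 0 k] &&
     all (fun a => (set_dist D (fun l => nmem st 3 (o + l)) k (C a) <=
                     alpha * r (C a))%R) (iota 0 nc).
    rewrite (fr4.1 16 isT) e3 e2 /= /update /=; congr (_ && _).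
    apply: eq_all => a; congr (_ <= _)%R; apply: eq_set_dist => // l _.
    by rewrite (fr2.1 3 isT).
  have {}e4 : rmem st4 5 0 = index_cost (fun l => nmem st 3 (o + l)).
    rewrite e4; apply: eq_bigr => z _; apply: eq_min_upto => // l _.
    by rewrite (fr3.1 3 isT) (fr2.1 3 isT) (fr3.1 20 isT) (fr2.1 20 isT) /= /update /= o20.
  have e6 : rmem st4 6 0 = index_cost S.
    by rewrite (fr4.2 6 isT) (fr3.2 6 isT) (fr2.2 6 isT).
  have e1 : rmem st4 0 1 = eps.
    by rewrite (fr4.2 0 isT) (fr3.2 0 isT) (fr2.2 0 isT).
  rewrite /= e4 e6 e1 -ltNge /accepted andbA -e3.
  by case: ifP => h /=; rewrite ?h ?andbT ?andbF.
rewrite /=; nia.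
Qed.

Lemma runs_next_word st :
  search_env st -> word (nmem st 9) -> nmem st 22 0 = 0 ->
  runs D next_word st (fun st' => word (nmem st' 9) /\
    if nmem st' 22 0 == 0 then
      word_value (k * n) (nmem st' 9) tt = (word_value (k * n) (nmem st 9) tt).+1
    else nmem st' 22 0 = 1 /\
      (word_value (k * n) (nmem st 9) tt).+1 = (k * n) ^ tt) (200 * k.+1).
Proof.
case=> [[h1 h2 h3 h4] [h5 h6 h7 h8 [h9 h10]]] ww d0.
set w := nmem st 9.
have N0 : 0 < k * n by rewrite muln_gt0 k0.
apply: runs_le.
  apply: runs_seq; first by apply: runs_sem; [|exact: erefl].
  move=> _ /[swap] <- fr1.
  apply: runs_seq.
    apply: (@runs_frame _ _ _ _ _ _).
    apply: (@runs_while _ _ _ _ _ (fun st' => [/\ nmem st' 14 0 <= tt,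
      forall i, i < nmem st' 14 0 -> nmem st' 9 i = 0 /\ (w i).+1 = k * n &
      forall i, nmem st' 14 0 <= i -> nmem st' 9 i = w i])
      (fun st' => tt - nmem st' 14 0)) => //.
    move=> st2 fr2 [lt lo hi] /=; rewrite (fr2.1 23 isT) (fr2.1 24 isT) /= /update /= h8 h9.
    rewrite -ltnNge => /andP[l14 /eqP full]; apply: runs_sem => //=; rewrite /update /=.
    split; last by lia.
    split; first by lia.
      move=> i; rewrite addn1 ltnS leq_eqVlt; case: eqP => [-> _|ne /= li].
        by split=> //; rewrite -hi // -addn1.
      by apply: lo.
    by move=> i li; case: eqP => [|_]; [lia|apply: hi; lia].
  move=> st2 fr2 [[[lt lo hi] stop] _]; apply: runs_sem => //=.
  rewrite (fr2.1 23 isT) /= /update /= h8 -ltnNge.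
  have e22 : nmem st2 22 0 = 0 by rewrite (fr2.1 22 isT).
  case: (ltnP (nmem st2 14 0) tt) => l14 /=; rewrite ?e22 /=.
    have nf : (w (nmem st2 14 0)).+1 != k * n.
      move: stop; rewrite /= (fr2.1 23 isT) (fr2.1 24 isT) /= /update /= h8 h9.
      by rewrite -ltnNge l14 /= hi // addn1.
    split=> [l lt'|].
      have := ww l lt'; rewrite -/w; case: eqP => [->|ne].
        by rewrite hi // addn1; lia.
      case: (ltnP l (nmem st2 14 0)) => [/lo [-> _]|/hi ->] //.
    apply: (@word_value_next _ _ _ (nmem st2 14 0)) => //=.
    - by move=> i /lo [].
    - by move=> i il; case: eqP => [|_]; [lia|case: (lo i il)].
    - by rewrite eqxx hi // addn1.
    - by move=> i il; case: eqP => [|_]; [lia|apply: hi; lia].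
  (* The carry ran past the last digit: all digits were maximal, so the word just tried was the last
     one. *)
  have e14 : nmem st2 14 0 = tt by lia.
  split=> [l lt'|].
    by have [-> _] := lo l ltac:(by rewrite e14).
  by split=> //; apply: word_value_full => // l lt'; case: (lo l ltac:(by rewrite e14)).
rewrite /= /update /=; lia.
Qed.
End LocalSearch.

(** * The search for one swap and the loop over the iterations *)

Definition try_word : cmd :=
  Seq build_candidate
    (Seq check_candidate
      (If (NEq (var 16) (NConst 1))
          (Seq (setv 21 (NConst 1)) (setv 22 (NConst 1)))
          next_word)).

Definition search_swap : cmd :=
  Seq (setv 21 (NConst 0))
    (Seq (cost_at 19)
      (Seq (Seq (setr 6 (rvar 5))
             (Seq (setv 20 (NAdd (var 19) kE)) (setv 22 (NConst 0))))
        (Seq (For 14 (var 23) (NSet 9 (var 14) (NConst 0)))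
          (While (NEq (var 22) (NConst 0)) try_word)))).

Definition local_loop : cmd :=
  While (NEq (var 21) (NConst 1))
    (Seq search_swap
      (If (NEq (var 21) (NConst 1))
          (Seq (NSet 1 (NConst 1) (NAdd (NGet 1 (NConst 1)) (NConst 1)))
               (setv 19 (var 20)))
          Skip)).

Section LocalLoop.
Context {R : realType}.
Variable D : nat -> nat -> R.
Variables (n k nc tt : nat) (alpha eps : R) (r : nat -> R) (C : nat -> nat).
Implicit Types (st : @memory R) (S A : nat -> nat).
Local Open Scope nat_scope.
Hypotheses (k0 : 0 < k) (n0 : 0 < n) (kn : k <= n) (ttk : tt <= k) (nck : nc <= k).

Let env st := search_env n k nc tt alpha eps r C st.
Let accepts S S' := accepted D n k nc alpha eps r C S S'.
Let is_word := word n k tt.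

Lemma runs_try_word st o S :
  env st -> is_word (nmem st 9) -> nmem st 19 0 = o -> nmem st 20 0 = o + k ->
  (forall l, l < k -> nmem st 3 (o + l) = S l) ->
  rmem st 6 0 = index_cost D n k S -> nmem st 22 0 = 0 -> nmem st 21 0 = 0 ->
  runs D try_word st (fun st' =>
    [/\ forall i, i < o + k -> nmem st' 3 i = nmem st 3 i, is_word (nmem st' 9) &
     if nmem st' 22 0 == 0 then
       [/\ nmem st' 21 0 = 0, ~~ accepts S (swap_word n (nmem st 9) tt S) &
         word_value (k * n) (nmem st' 9) tt = (word_value (k * n) (nmem st 9) tt).+1]
     else if nmem st' 21 0 == 1 then
       (forall p, p < k -> nmem st' 3 (o + k + p) = swap_word n (nmem st 9) tt S p) /\
       accepts S (swap_word n (nmem st 9) tt S)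
     else [/\ nmem st' 21 0 = 0, ~~ accepts S (swap_word n (nmem st 9) tt S) &
       (word_value (k * n) (nmem st 9) tt).+1 = (k * n) ^ tt]]) (2000 * (n.+1 * k.+1)).
Proof.
move=> e w o19 o20 SE c6 d0 g0.
set w0 := nmem st 9 in w *.
apply: runs_le.
  apply: runs_seq.
    exact: (runs_build_candidate D k0 n0 kn ttk nck e w o19 o20).
  move=> st1 fr1 [lo1 hi1].
  have {}hi1 p : p < k -> nmem st1 3 (o + k + p) = swap_word n w0 tt S p.
    by move=> pk; rewrite hi1 //; apply: eq_swap_word => //; apply: SE.
  have e1 : env st1.
    by apply: (search_env_frame _ _ _ fr1) e => //; rewrite (fr1.1 1 isT).
  apply: runs_seq.
    apply: (@runs_check_candidate _ D n k nc tt alpha eps r C k0 n0 kn ttk nck st1 (o + k) S e1).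
      by rewrite (fr1.1 20 isT).
    by rewrite (fr1.2 6 isT).
  move=> st2 fr2.
  have -> : accepted D n k nc alpha eps r C S (fun l => nmem st1 3 (o + k + l)) =
            accepts S (swap_word n w0 tt S).
    by apply: eq_accepted => // p pk; apply: hi1.
  move=> acc.
  have lo2 i : i < o + k -> nmem st2 3 i = nmem st 3 i.
    by move=> io; rewrite (fr2.1 3 isT) lo1.
  have e2 : env st2.
    by apply: (search_env_frame _ _ _ fr2) e1 => //; rewrite (fr2.1 1 isT).
  have w2 : nmem st2 9 =1 w0.
    by move=> l; rewrite (fr2.1 9 isT) (fr1.1 9 isT).
  apply: runs_if => /= [a|a].
    apply: runs_sem => //=; rewrite /update /=; split=> //.
      by move=> l lt; rewrite w2; apply: w.
    split; last by rewrite -acc.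
    by move=> p pk; rewrite (fr2.1 3 isT) hi1.
  apply: runs_mono; last exact: leqnn.
    apply: (@runs_frame _ _ _ _ _ _).
    apply: (@runs_next_word _ D n k nc tt alpha eps r C k0 n0 kn ttk nck st2 e2).
      by move=> l lt; rewrite w2; apply: w.
    by rewrite (fr2.1 22 isT) (fr1.1 22 isT).
  move=> st3 [[w3 nx] fr3].
  have v2 : word_value (k * n) (nmem st2 9) tt = word_value (k * n) w0 tt.
    by apply: eq_word_value => l _; apply: w2.
  have g3 : nmem st3 21 0 = 0.
    by rewrite (fr3.1 21 isT) (fr2.1 21 isT) (fr1.1 21 isT).
  split=> //; first by move=> i io; rewrite (fr3.1 3 isT) lo2.
  rewrite g3 /= -acc -v2.
  case: (nmem st3 22 0 =P 0) nx => // _.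
  by case.
by rewrite /=; nia.
Qed.

Lemma runs_search_swap st o :
  env st -> nmem st 19 0 = o ->
  let S l := nmem st 3 (o + l) in
  runs D search_swap st (fun st' =>
    [/\ forall i, i < o + k -> nmem st' 3 i = nmem st 3 i, nmem st' 20 0 = o + k &
     if nmem st' 21 0 == 1 then exists2 w, is_word w & accepts S (swap_word n w tt S) /\
       forall p, p < k -> nmem st' 3 (o + k + p) = swap_word n w tt S p
     else forall w, is_word w -> ~~ accepts S (swap_word n w tt S)])
    (3000 * (n.+1 * k.+1 * ((k * n) ^ tt).+1)).
Proof.
move=> e o19 S; have [[h1 h2 h3 h4] [h5 h6 h7 h8 _]] := e.
apply: runs_le.
  apply: runs_seq; first by apply: runs_sem; [|exact: erefl].
  move=> _ /[swap] <- fr1.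
  apply: runs_seq; first by apply: (@runs_cost_at _ _ _ n k).
  move=> st2 fr2 c2.
  apply: runs_seq; first by apply: runs_sem; [|exact: erefl].
  move=> _ /[swap] <- fr3.
  apply: runs_seq.
    apply: (@runs_for _ _ _ _ _ tt _ (fun i st' => forall j, j < i -> nmem st' 9 j = 0)) => //.
      by move=> st4 fr4; rewrite -h8 /= (fr4.1 23 isT) (fr3.1 23 isT) (fr2.1 23 isT).
    move=> i st4 it sti fr4 Ii; apply: runs_sem => //= j ji.
    by rewrite /update /= sti; case: eqP => // ne; apply: Ii; lia.
  move=> st4 fr4 w4.
  have a4 i : nmem st4 3 i = nmem st 3 i.
    by rewrite (fr4.1 3 isT) (fr3.1 3 isT) (fr2.1 3 isT).
  have env4 : env st4.
    apply: (search_env_frame _ _ _ fr4) => //; first by rewrite (fr4.1 1 isT).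
    apply: (search_env_frame _ _ _ fr3) => //.
    by apply: (search_env_frame _ _ _ fr2) => //; rewrite (fr2.1 1 isT).
  have c4 : rmem st4 6 0 = index_cost D n k S.
    rewrite (fr4.2 6 isT) /= /update /= c2; apply: eq_bigr => z _.
    by apply: eq_min_upto => // l _; rewrite /S /= /update /= o19.
  have o20 : nmem st4 20 0 = o + k.
    by rewrite (fr4.1 20 isT) /= /update /= (fr2.1 19 isT) (fr2.1 0 isT) /= /update /= o19 h2.
  have g4 : nmem st4 21 0 = 0.
    by rewrite (fr4.1 21 isT) (fr3.1 21 isT) (fr2.1 21 isT).
  have d4 : nmem st4 22 0 = 0 by rewrite (fr4.1 22 isT).
  have o4 : nmem st4 19 0 = o.
    by rewrite (fr4.1 19 isT) (fr3.1 19 isT) (fr2.1 19 isT).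
  (* While the search goes on, every word of value below the current one has been rejected; the two
     other branches describe success and exhaustion. *)
  pose J st' := [/\ forall i, i < o + k -> nmem st' 3 i = nmem st 3 i,
     is_word (nmem st' 9) &
     if nmem st' 22 0 == 0 then nmem st' 21 0 = 0 /\
       forall w, is_word w ->
         word_value (k * n) w tt < word_value (k * n) (nmem st' 9) tt ->
         ~~ accepts S (swap_word n w tt S)
     else if nmem st' 21 0 == 1 then
       exists2 w, is_word w & accepts S (swap_word n w tt S) /\
       forall p, p < k -> nmem st' 3 (o + k + p) = swap_word n w tt S p
     else forall w, is_word w -> ~~ accepts S (swap_word n w tt S)].
  apply: (@runs_le _ _ _ _ _ _ ((k * n) ^ tt * (2000 * (n.+1 * k.+1) + 4) + 4)); last first.
    exact: leqnn.
  apply: runs_mono.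
    apply: (@runs_frame _ _ _ _ _ _).
    (* The measure counts the words not yet rejected and drops to 0 as soon as the end flag is
       raised. *)
    apply: (@runs_while _ _ _ _ _ J (fun st' => if nmem st' 22 0 == 0 then
       (k * n) ^ tt - word_value (k * n) (nmem st' 9) tt else 0)); last first.
    - split=> [i _||]; first exact: a4.
        by move=> l lt; rewrite w4 // muln_gt0 k0.
      rewrite d4 /=; split=> // w _.
      by rewrite (@eq_word_value _ _ (fun=> 0) _ w4) word_value0.
    - move=> st5 fr5 [lo w5 +] /= d5; rewrite d5 => -[g5 rej].
      have env5 : env st5.
        by apply: (search_env_frame _ _ _ fr5) env4 => //; rewrite (fr5.1 1 isT).
      have vlt := word_value_lt w5.
      apply: runs_mono; last exact: leqnn.
        apply: (@runs_try_word st5 o S) => //.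
        + by rewrite (fr5.1 19 isT).
        + by rewrite (fr5.1 20 isT).
        + by move=> l lk; rewrite lo // ltn_add2l.
        + by rewrite (fr5.2 6 isT).
        + exact/eqP.
      move=> st6 [lo6 w6 nx].
      have rej' w : is_word w -> ~~ accepts S (swap_word n (nmem st5 9) tt S) ->
          word_value (k * n) w tt <= word_value (k * n) (nmem st5 9) tt ->
          ~~ accepts S (swap_word n w tt S).
        move=> ww nacc; rewrite leq_eqVlt => /predU1P[/(word_value_inj ww w5) ew|]; last exact: rej.
        rewrite (_ : accepts _ _ = accepts S (swap_word n (nmem st5 9) tt S)) //.
        by apply: eq_accepted => // p _; apply: eq_swap_word.
      have lo' i : i < o + k -> nmem st6 3 i = nmem st 3 i by move=> io; rewrite lo6 // lo.
      case: eqP nx => d6 /=.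
        case=> g6 nacc v6; split; last by rewrite v6; lia.
        split=> //; rewrite d6 /=; split=> // w ww; rewrite v6 ltnS; exact: rej'.
      move=> nx; split; last by lia.
      split=> //; move/eqP/negbTE: d6 => ->; case: eqP nx => g6.
        by case=> ? ?; exists (nmem st5 9).
      by case=> _ nacc v6 w ww; apply: rej' => //; have := word_value_lt ww; lia.
  - move=> st' [[[lo w' h] /= d'] fr']; rewrite (negbTE d') in h.
    by split=> //; rewrite (fr'.1 20 isT).
  by rewrite /= d4 /= leq_add2r leq_mul2r; apply/orP; right; rewrite leq_subr.
rewrite /=; set X := (k * n) ^ tt; nia.
Qed.

Definition block A l p : nat := A (l * k + p).

Definition swap_chain (A : nat -> nat) (j : nat) : Prop :=
  forall l, l < j -> exists2 w, is_word w &
    accepts (block A l) (block A l.+1) /\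
    forall p, p < k -> block A l.+1 p = swap_word n w tt (block A l) p.

(** At the level of indices nothing shows why the loop should stop, so [J] is assumed to bound every
    chain that starts from the given first block. The chain is quantified over arbitrary arrays,
    because the array of the trace is known only during the run. *)
Lemma runs_local_loop st J :
  env st -> nmem st 1 1 = 0 -> nmem st 19 0 = 0 -> nmem st 21 0 = 1 ->
  (forall A j, (forall p, p < k -> A p = nmem st 3 p) -> swap_chain A j -> j <= J) ->
  runs D local_loop st (fun st' => let A := nmem st' 3 in let j := nmem st' 1 1 in
    [/\ forall p, p < k -> A p = nmem st 3 p, swap_chain A j, nmem st' 1 0 = nc &
     forall w, is_word w -> ~~ accepts (block A j) (swap_word n w tt (block A j))])
    (4000 * (J.+1 * (n.+1 * k.+1 * ((k * n) ^ tt).+1))).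
Proof.
move=> e j0 o0 g0 bound.
have eq_acc S1 S1' S2 S2' : (forall p, p < k -> S1 p = S2 p) ->
    (forall p, p < k -> S1' p = S2' p) -> accepts S1 S1' = accepts S2 S2'.
  exact: eq_accepted.
have nc0 : nmem st 1 0 = nc by case: e => _ [].
pose I st' := [/\ forall p, p < k -> nmem st' 3 p = nmem st 3 p,
  swap_chain (nmem st' 3) (nmem st' 1 1), nmem st' 1 0 = nc,
  nmem st' 19 0 = nmem st' 1 1 * k &
  if nmem st' 21 0 == 1 then True else
    forall w, is_word w -> ~~ accepts (block (nmem st' 3) (nmem st' 1 1))
      (swap_word n w tt (block (nmem st' 3) (nmem st' 1 1)))].
apply: runs_le.
  apply: runs_mono; last exact: leqnn.
    (* The successor pays for the last search, which fails and lowers the flag. *)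
    apply: (@runs_while _ _ _ _ _ I (fun st' => if nmem st' 21 0 == 1 then
      (J - nmem st' 1 1).+1 else 0)); last first.
    - by split=> //; rewrite ?j0 ?g0 //= o0.
    - move=> st1 fr1 [b0 ch c1 o1 _] /= g1; rewrite g1.
      have env1 : env st1.
        by apply: (search_env_frame _ _ _ fr1) e => //; rewrite c1 nc0.
      apply: runs_seq; first exact: (runs_search_swap env1 o1).
      set j := nmem st1 1 1 in ch o1 *.
      move=> st2 fr2 [lo2 o2 res].
      have j2 : nmem st2 1 1 = j by rewrite (fr2.1 1 isT).
      (* The search writes only beyond the current block, so the trace up to block [j] is intact. *)
      have ch2 : swap_chain (nmem st2 3) j.
        move=> l lj; have [w ww [acc sw]] := ch l lj.
        have lk p : p < k -> l * k + p < j * k + k.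
          by move=> pk; have : l * k <= j * k; [rewrite leq_mul2r; lia|lia].
        have lk' p : p < k -> l.+1 * k + p < j * k + k.
          by move=> pk; have : l.+1 * k <= j * k; [rewrite leq_mul2r; lia|lia].
        have E p : p < k -> block (nmem st2 3) l p = block (nmem st1 3) l p.
          by move=> pk; rewrite /block lo2 ?lk.
        have E' p : p < k -> block (nmem st2 3) l.+1 p = block (nmem st1 3) l.+1 p.
          by move=> pk; rewrite /block lo2 ?lk'.
        exists w => //; split; first by rewrite (eq_acc _ _ _ _ E E').
        by move=> p pk; rewrite E' // sw //; apply: eq_swap_word; rewrite ?E.
      have b2 p : p < k -> nmem st2 3 p = nmem st 3 p.
        by move=> pk; rewrite lo2 ?b0 //; lia.
      have Ej p : p < k -> block (nmem st2 3) j p = nmem st1 3 (j * k + p).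
        by move=> pk; rewrite /block lo2 //; lia.
      apply: runs_if => /= g2; [rewrite g2 in res|rewrite (negbTE g2) in res].
        have ch3 : swap_chain (nmem st2 3) j.+1.
          move=> l; rewrite ltnS leq_eqVlt => /predU1P[->|/ch2 //].
          have [w ww [acc sw]] := res; exists w => //.
          have E' p : p < k -> block (nmem st2 3) j.+1 p =
             swap_word n w tt (block (nmem st2 3) j) p.
            move=> pk; rewrite /block mulSnr sw //; apply: eq_swap_word => //.
            by rewrite -Ej.
          split=> //; move: acc.
          rewrite -(eq_acc (block (nmem st2 3) j) (block (nmem st2 3) j.+1)) // => p pk.
          by rewrite E' //; apply: eq_swap_word; rewrite ?Ej.
        (* The chain prolonged by the new block is still bounded by [J], so [j] was less than [J]
           and the measure decreases. *)
        have jJ := bound _ _ b2 ch3.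
        apply: runs_sem => //=; rewrite /I /= /update /= g2 j2 addn1; split; last by lia.
        split=> //; first by rewrite (fr2.1 1 isT).
        by rewrite o2 mulSnr.
      apply: runs_sem => //; rewrite /I /= (negbTE g2) j2; split=> //; split=> //.
      + by rewrite (fr2.1 1 isT).
      + by rewrite (fr2.1 19 isT).
      + move=> w ww; have := res w ww; congr (~~ _); apply: eq_acc => // p pk.
          by rewrite Ej.
        by apply: eq_swap_word; rewrite ?Ej.
  by move=> st' [[b0 ch c1 o1 +] /= g1]; rewrite (negbTE g1).
rewrite /= g0 j0 subn0 /=.
set X := n.+1 * k.+1 * _.
have : 0 < X by rewrite !muln_gt0.
nia.
Qed.
End LocalLoop.

(** * Bound on the number of iterations *)

Lemma fset_pigeonhole (K : choiceType) (g : K -> K) (U S : {fset K}) :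
  (forall u, u \in U -> g u \in S) -> (#|` S| < #|` U|)%N ->
  exists u u', [/\ u \in U, u' \in U, u != u' & g u = g u'].
Proof.
move=> gS lt; apply: contrapT => no.
have inj : {in U &, injective g}.
  move=> u u' uU u'U e; apply: contrapT => /eqP ne.
  by apply: no; exists u, u'.
have : [fset g u | u in U] `<=` S by apply/fsubsetP => _ /imfsetP[u /= uU ->]; apply: gS.
by move/fsubset_leq_card; rewrite card_in_imfset //= leqNgt lt.
Qed.

Section Median.
Context {R : realType} {X : metricType R}.
Implicit Types (P S Z C Cs : {fset X}) (x c z : X).

Lemma dist_to_le x S y : y \in S -> dist_to x S <= mdist x y.
Proof. by move=> yS; apply: ge_bigmin_seq. Qed.

Lemma dist_to_ex x S : S != fset0 -> exists2 y, y \in S & dist_to x S = mdist x y.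
Proof.
move=> S0; have hS : head x (enum_fset S) \in S.
  have hd (s : seq X) y : y \in s -> head x s \in s.
    by case: s => //= a s _; rewrite mem_head.
  by have /fset0Pn[y yS] := S0; apply: (hd (enum_fset S) y).
rewrite /dist_to big_seq.
apply: (big_ind (fun v => exists2 y, y \in S & v = mdist x y)).
- by exists (head x (enum_fset S)).
- by move=> a b ha hb; rewrite minEle; case: ifP.
- by move=> y yS; exists y.
Qed.

Lemma dist_toP x S v :
  (exists2 y, y \in S & v = mdist x y) -> (forall y, y \in S -> v <= mdist x y) ->
  dist_to x S = v.
Proof.
move=> [y yS e] le; apply/eqP; rewrite eq_le e dist_to_le //= -e.
have [|z zS ->] := @dist_to_ex x S; first by apply/fset0Pn; exists y.
exact: le.
Qed.

Lemma dist_to_ge0 x S : 0 <= dist_to x S.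
Proof. by apply: le_bigmin => *; apply: mdist_ge0. Qed.

Lemma dist_to_sub x S S' : S != fset0 -> S `<=` S' -> dist_to x S' <= dist_to x S.
Proof.
by move=> S0 /fsubsetP SS; have [y /SS yS' ->] := dist_to_ex x S0; apply: dist_to_le.
Qed.

Lemma dist_to_in x S : x \in S -> dist_to x S = 0.
Proof.
by move=> xS; apply: dist_toP => [|y _]; [exists x => //; rewrite mdistxx|apply: mdist_ge0].
Qed.

Lemma dist_to_gt0 x S : S != fset0 -> x \notin S -> 0 < dist_to x S.
Proof.
move=> S0 xS; have [y yS ->] := dist_to_ex x S0.
by rewrite mdist_gt0; apply: contraNneq xS => ->.
Qed.

Lemma cost_ge P S x : x \in P -> dist_to x S <= cost P S.
Proof.
move=> xP; rewrite /cost (big_fsetD1 x) //= lerDl.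
by apply: sumr_ge0 => *; apply: dist_to_ge0.
Qed.

Lemma cost_gt0 P S x : S != fset0 -> x \in P -> x \notin S -> 0 < cost P S.
Proof. by move=> S0 xP xS; apply: lt_le_trans (cost_ge S xP); apply: dist_to_gt0. Qed.

Lemma critical_loop_sub P k alpha Z C Cs : critical_loop P k alpha Z C Cs ->
  C `<=` Cs /\ Cs `<=` C `|` Z.
Proof.
elim=> {Z C Cs} [C|Z C Cs c cZ _ _ [sub1 sub2]]; first by rewrite fsetU0.
split; first exact: fsubset_trans (fsubsetU1 _ _) sub1.
apply: fsubset_trans sub2 _; apply/fsubsetP => y.
rewrite !inE => /orP[/predU1P[->|->//]|/andP[-> _]]; rewrite ?cZ orbT //.
Qed.

Lemma critical_loop_neq0 P k alpha Z C Cs : critical_loop P k alpha Z C Cs ->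
  Z != fset0 -> Cs != fset0.
Proof.
case=> {Z C Cs} [C|Z C Cs c cZ _ cl _]; first by rewrite eqxx.
have [/fsubsetP sub _] := critical_loop_sub cl.
by apply/fset0Pn; exists c; apply: sub; rewrite fset1U1.
Qed.

Definition separated P k alpha C : Prop := forall c c', c \in C -> c' \in C ->
  c != c' -> 6 * alpha * fair_radius P k c < mdist c c'.

(** Of two centers, the later one survived the filter of the earlier one, which compares their
    distance with the radius of the later. The earlier one minimized the fair radius, so the
    inequality holds for its radius too. *)
Lemma critical_loop_separated P k alpha Z C Cs : 0 <= alpha ->
  critical_loop P k alpha Z C Cs ->
  (forall c z, c \in C -> z \in Z -> 6 * alpha * fair_radius P k z < mdist z c /\
     fair_radius P k c <= fair_radius P k z) ->
  separated P k alpha C -> separated P k alpha Cs.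
Proof.
move=> a0; elim=> {Z C Cs} [//|Z C Cs c cZ minc _ IH] CZ sep; apply: IH.
  move=> c' z; rewrite !inE => /predU1P[->|c'C] /andP[zZ dz].
    by split=> //; apply: minc.
  exact: CZ.
move=> c1 c2; rewrite !inE => /predU1P[->|c1C] /predU1P[->|c2C] ne.
- by rewrite eqxx in ne.
- by case: (CZ c2 c c2C cZ).
- have [lt le] := CZ c1 c c1C cZ; rewrite [mdist _ _]metric_sym.
  by apply: le_lt_trans lt; rewrite ler_wpM2l // mulr_ge0.
- exact: sep.
Qed.

Lemma critical_centers_spec P k alpha Cs : 0 <= alpha -> P != fset0 ->
  critical_centers P k alpha Cs ->
  [/\ Cs `<=` P, Cs != fset0 & separated P k alpha Cs].
Proof.
move=> a0 P0 cr; split.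
- by case: (critical_loop_sub cr) => _; rewrite fset0U.
- exact: critical_loop_neq0 cr P0.
- by apply: (critical_loop_separated a0 cr).
Qed.

Lemma farthest_loop_sub P m S S' : farthest_loop P m S S' -> S `<=` S'.
Proof.
elim=> {m S S'} [S|m S S' z _ _ _ sub]; first by [].
exact: fsubset_trans (fsubsetU1 _ _) sub.
Qed.

Lemma farthest_loop_subP P m S S' : S `<=` P -> farthest_loop P m S S' -> S' `<=` P.
Proof.
move=> + fl; elim: fl => {m S S'} [S//|m S S' z zP _ _ IH] SP; apply: IH.
by rewrite fsubUset SP andbT fsub1set; move: zP; rewrite inE => /andP[].
Qed.

(** A point [w] that is still outside at the end was a candidate in every round. So each inserted
    point was at least as far from the set of that round as [w] was, and [w] only gets closer as the
    set grows. *)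
Lemma farthest_loop_separated P m S S' w : farthest_loop P m S S' ->
  S != fset0 -> w \in P `\` S' -> forall u u', u \in S' -> u' \in S' -> u != u' ->
  ~~ ((u \in S) && (u' \in S)) -> dist_to w S' <= mdist u u'.
Proof.
elim=> {m S S'} [S|m S S' z zP far fl IH] S0 wP u u' uS' u'S' ne.
  by rewrite uS' u'S'.
rewrite negb_and => out.
have zS0 : z |` S != fset0 by apply/fset0Pn; exists z; rewrite fset1U1.
have [|] := boolP ((u \in z |` S) && (u' \in z |` S)); last exact: IH.
have sub : S `<=` S' := fsubset_trans (fsubsetU1 _ _) (farthest_loop_sub fl).
have wPS : w \in P `\` S.
  move: wP; rewrite !inE => /andP[wS' ->]; rewrite andbT.
  by apply: contraNN wS'; apply: (fsubsetP sub).
have wz v : v \in S -> dist_to w S' <= mdist z v.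
  by move=> vS; apply: le_trans (dist_to_le z vS);
    apply: le_trans (far w wPS); apply: dist_to_sub.
rewrite !inE => /andP[/predU1P[eu|uS] /predU1P[eu'|u'S]].
- by rewrite eu eu' eqxx in ne.
- by rewrite eu; apply: wz.
- by rewrite eu' metric_sym; apply: wz.
- by rewrite uS u'S in out.
Qed.

Lemma cost_lower_bound P k alpha Cs m S0 S w : 0 <= alpha -> P != fset0 ->
  critical_centers P k alpha Cs -> farthest_loop P m Cs S0 ->
  w \in P `\` S0 -> feasible P k alpha Cs S -> (#|` S| <= #|` S0|)%N ->
  dist_to w S0 / 2 <= cost P S.
Proof.
move=> a0 P0 cr fl wP [SP feas] card.
have [CsP Cs0 sep] := critical_centers_spec a0 P0 cr.
have /fsubsetP CsS0 := farthest_loop_sub fl.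
have /fsubsetP S0P := farthest_loop_subP CsP fl.
have S00 : S0 != fset0 by have /fset0Pn[c /CsS0 cS] := Cs0; apply/fset0Pn; exists c.
have wS0 : w \notin S0 by move: wP; rewrite inE => /andP[].
set r := dist_to w S0; have r0 : 0 < r by apply: dist_to_gt0.
have Sn0 : S != fset0.
  have /fset0Pn[c /feas /fset0Pn[y]] := Cs0; rewrite inE => /andP[yS _].
  by apply/fset0Pn; exists y.
(* A near center has its image within [r / 2]. A critical center that is not near has [6 * alpha]
   times its radius at least [3 * r], so separation keeps it farther than [r] from the other
   centers. *)
pose near u := (u \in Cs) && (alpha * fair_radius P k u < r / 2).
have gex u : exists v, [/\ v \in S,
    near u -> mdist u v <= alpha * fair_radius P k u &
    ~~ near u -> dist_to u S = mdist u v].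
  have [nu|fu] := boolP (near u).
    have /andP[/feas /fset0Pn[y]] := nu; rewrite !inE => /and3P[yS _ dy] _.
    by exists y; split.
  by have [y yS e] := dist_to_ex u Sn0; exists y; split.
have [g gP] := choice gex.
have sepU u u' : u \in w |` S0 -> u' \in w |` S0 -> u != u' ->
    ~~ ((u \in Cs) && (u' \in Cs)) -> r <= mdist u u'.
  rewrite !inE => /predU1P[->|uS0] /predU1P[->|u'S0] ne.
  - by rewrite eqxx in ne.
  - by move=> _; apply: dist_to_le.
  - by move=> _; rewrite metric_sym; apply: dist_to_le.
  - exact: (farthest_loop_separated fl Cs0 wP).
have {sepU} sepU u u' : u \in w |` S0 -> u' \in w |` S0 -> u != u' ->
    ~~ near u -> r <= mdist u u'.
  move=> uU u'U ne nu; have [/andP[uC u'C]|] := boolP ((u \in Cs) && (u' \in Cs)); last exact: sepU.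
  move: nu; rewrite /near uC /= -leNgt => le.
  apply: ltW; apply: le_lt_trans (sep u u' uC u'C ne).
  by rewrite -mulrA; lra.
have UP u : u \in w |` S0 -> u \in P.
  by rewrite !inE => /predU1P[->|/S0P //]; move: wP; rewrite inE => /andP[].
have [u _||u [u' [uU u'U ne e]]] := @fset_pigeonhole _ g (w |` S0) S.
- by case: (gP u).
- by rewrite cardfsU1 wS0.
(* Two near centers with a common image would be within [alpha] times the sum of their radii,
   against a separation of [6 * alpha] times the larger radius. *)
wlog nu : u u' uU u'U ne e / ~~ near u.
  move=> W; have [nu|nu] := boolP (near u); last exact: (W u u').
  have [nu'|nu'] := boolP (near u'); last by apply: (W u' u) => //; rewrite eq_sym.
  have [_ /(_ nu) d1 _] := gP u; have [_ /(_ nu') d2 _] := gP u'.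
  move: nu nu' => /andP[uC lu] /andP[u'C lu'].
  have := sep u u' uC u'C ne; have := sep u' u u'C uC; rewrite eq_sym => /(_ ne).
  have := metric_triangle u (g u) u'; rewrite e [mdist (g u') u']metric_sym -e.
  rewrite [mdist u' u]metric_sym -!mulrA [mdist u' (g u)]/= => t s1 s2.
  have := mdist_ge0 u (g u); have := mdist_ge0 u' (g u').
  by rewrite e in d1 t *; lra.
have ru := sepU u u' uU u'U ne nu.
have [_ _ /(_ nu) du] := gP u.
have t := metric_triangle u (g u) u'.
have [nu'|nu'] := boolP (near u').
  have [_ /(_ nu') du' _] := gP u'; have /andP[_ lt] := nu'.
  apply: le_trans (cost_ge S (UP u uU)); rewrite du.
  by rewrite e [mdist (g u') u']metric_sym in t *; lra.
have [_ _ /(_ nu') du'] := gP u'.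
have := cost_ge S (UP u uU); have := cost_ge S (UP u' u'U).
rewrite du du'; rewrite e [mdist (g u') u']metric_sym in t *; lra.
Qed.
End Median.

(** * Geometric decay of the cost *)

Section Iterations.
Context {R : realType} {X : metricType R}.
Implicit Types (P S Z C Cs : {fset X}).

Lemma card_swap P S T1 T2 : T1 `<=` S -> T2 `<=` P `\` S -> #|` T1| = #|` T2| ->
  #|` (S `|` T2) `\` T1| = #|` S|.
Proof.
move=> T1S T2S e.
rewrite cardfsDS ?(fsubset_trans T1S) ?fsubsetUl // cardfsU e.
have -> : S `&` T2 = fset0.
  apply/eqP; rewrite -fsubset0; apply/fsubsetP => y; rewrite !inE => /andP[yS].
  by move/(fsubsetP T2S); rewrite inE yS.
by rewrite cardfs0 subn0 addnK.
Qed.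

Lemma improving_swapP P k alpha t (eps : R) Cs S S' :
  improving_swap P k alpha t eps Cs S S' ->
  [/\ #|` S'| = #|` S|, feasible P k alpha Cs S', P `\` S != fset0 &
      cost P S' <= (1 - eps) * cost P S].
Proof.
case=> i [T1 [T2 [[it T1S T2S c1 c2] [-> fe co]]]]; split=> //.
  by apply: card_swap T1S T2S _; rewrite c1.
apply: contraTneq it => e; move: T2S; rewrite e fsubset0 => /eqP e2.
by move: c2; rewrite e2 cardfs0 => <-.
Qed.

Lemma partial_run_bound P (k t : nat) alpha eps Cs (F : nat -> {fset X}) (j : nat) :
  P != fset0 -> 1 <= alpha -> 0 < eps -> eps < 1 ->
  partial_run P k alpha t eps Cs F j ->
  j%:R <= 2%:R * (ln #|` P|%:R / eps).
Proof.
move=> P0 a1 e0 e1 [cr ini step].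
have lnP : 0 <= ln (#|` P|%:R : R) by rewrite ln_ge0 // ler1n cardfs_gt0.
(* Without any iteration the claim is that the bound is nonnegative. Otherwise the first swap shows
   that [F 0] misses a point of [P], which makes the distance [r] below positive. *)
case: j step => [_|j step].
  by rewrite mulr_ge0 ?divr_ge0 // ltW.
have a0 : 0 <= alpha by apply: le_trans a1.
have [CsP Cs0 sep] := critical_centers_spec a0 P0 cr.
have [_ _ PF _] := improving_swapP (step 0%N isT).
have F0P : F 0%N `<=` P := farthest_loop_subP CsP ini.
have F00 : F 0%N != fset0.
  have /fset0Pn[c cC] := Cs0; apply/fset0Pn; exists c.
  by apply: (fsubsetP (farthest_loop_sub ini)).
have card_run l : (l <= j.+1)%N -> #|` F l| = #|` F 0%N|.
  by elim: l => // l IH lj; have [-> _ _ _] := improving_swapP (step l lj); apply: IH (ltnW lj).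
have cost_run l : (l <= j.+1)%N -> cost P (F l) <= (1 - eps) ^+ l * cost P (F 0%N).
  elim: l => [_|l IH lj]; first by rewrite expr0 mul1r.
  have [_ _ _ le] := improving_swapP (step l lj); apply: le_trans le _.
  by rewrite exprS -mulrA ler_wpM2l ?subr_ge0 ?(ltW e1) // IH // ltnW.
have [w wP wmax] : exists2 w, w \in P `\` F 0%N &
    forall x, x \in P `\` F 0%N -> dist_to x (F 0%N) <= dist_to w (F 0%N).
  have /fset0Pn[w0 w0P] := PF.
  have [/= w _ wmax] := @arg_maxP _ _ _ [` w0P] xpredT
     (fun u : P `\` F 0%N => dist_to (val u) (F 0%N)) isT.
  by exists (val w) => [|x xP]; [apply: valP|apply: (wmax [` xP])].
set r := dist_to w (F 0%N).
have r0 : 0 < r.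
  by apply: dist_to_gt0 => //; move: wP; rewrite inE => /andP[].
have hi : cost P (F 0%N) <= #|` P|%:R * r.
  have -> : #|` P|%:R * r = \sum_(x <- P) r.
    by rewrite big_const_seq count_predT iter_addr_0 mulr_natl.
  rewrite /cost big_seq [leRHS]big_seq; apply: ler_sum => x xP.
  have [xF|xF] := boolP (x \in F 0%N); first by rewrite dist_to_in // ltW.
  by apply: wmax; rewrite inE xF.
have lo : r / 2 <= cost P (F j.+1).
  have [_ fe _ _] := improving_swapP (step j (leqnn _)).
  by apply: (cost_lower_bound a0 P0 cr ini wP fe); rewrite card_run.
(* [F 0] is nonempty and misses [w]. This allows replacing the ratio [2 n] by [n * n] before taking
   logarithms. *)
have n1 : (1 < #|` P|)%N.
  have : (#|` w |` F 0%N| <= #|` P|)%N.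
    apply: fsubset_leq_card; rewrite fsubUset F0P andbT fsub1set.
    by move: wP; rewrite inE => /andP[].
  apply: leq_trans; rewrite cardfsU1; move: wP; rewrite inE => /andP[-> _].
  by rewrite add1n ltnS cardfs_gt0.
set n := #|` P| in lnP hi n1 *.
have key : 1 <= 2 * n%:R * (1 - eps) ^+ j.+1.
  rewrite -(ler_pM2r (x := r / 2)) ?divr_gt0 // mul1r.
  apply: le_trans lo _; apply: le_trans (cost_run j.+1 (leqnn _)) _.
  have p0 : 0 <= (1 - eps) ^+ j.+1 by rewrite exprn_ge0 // subr_ge0 ltW.
  apply: le_trans (ler_wpM2l p0 hi) _.
  by rewrite le_eqVlt; apply/orP; left; apply/eqP; field.
have exp_le : (1 - eps) ^+ j.+1 <= expR (- (eps * j.+1%:R)).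
  rewrite -mulNr expRM_natr.
  apply: lerXn2r; rewrite ?nnegrE ?expR_ge0 ?subr_ge0 ?(ltW e1) //.
  exact: expR_ge1Dx.
have n0 : (0 : R) < n%:R by rewrite ltr0n; apply: ltnW.
have : expR (eps * j.+1%:R) <= n%:R * n%:R.
  have : expR (eps * j.+1%:R) <= 2 * n%:R.
    have : 1 <= 2 * n%:R * expR (- (eps * j.+1%:R)).
      by apply: le_trans key _; rewrite ler_wpM2l // mulr_ge0 // ltW.
    by rewrite expRN ler_pdivlMr ?expR_gt0 // mul1r.
  move=> h; apply: le_trans h _; rewrite ler_pM2r //.
  by rewrite (ler_nat R 2 n).
move=> h; have : eps * j.+1%:R <= ln (n%:R * n%:R : R).
  rewrite -[leLHS]expRK ler_ln ?posrE ?expR_gt0 ?mulr_gt0 //.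
rewrite lnM ?posrE // => le.
by rewrite mulrA ler_pdivlMr // mulrC mulr_natl mulr2n.
Qed.
End Iterations.

(** * From indices to points *)

Lemma count_le1 (T : eqType) (p : pred T) (s : seq T) : uniq s ->
  (forall a b, a \in s -> b \in s -> p a -> p b -> a = b) -> (count p s <= 1)%N.
Proof.
move=> us h; rewrite -size_filter; case e : (seq.filter p s) => [|a [|b t]] //.
have := filter_uniq p us; rewrite e /= inE negb_or => /andP[/andP[/eqP ab _] _].
have : a \in seq.filter p s by rewrite e mem_head.
have : b \in seq.filter p s by rewrite e !inE eqxx orbT.
rewrite !mem_filter => /andP[pb bs] /andP[pa sa].
by case: ab; apply: h.
Qed.

Section Indexing.
Context {R : realType} {X : metricType R}.
Variables (y : nat -> X) (n : nat) (P : {fset X}) (D : nat -> nat -> R).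
Implicit Types (A S : nat -> nat) (s : seq nat).

Definition points s : {fset X} := [fset y i | i in s].

Definition prefix_seq A m : seq nat := [seq A l | l <- iota 0 m].

Lemma mem_prefix_seq A m i :
  reflect (exists2 l, (l < m)%N & i = A l) (i \in prefix_seq A m).
Proof.
apply: (iffP mapP) => [[l]|[l lm ->]]; rewrite ?mem_iota; first by exists l.
by exists l => //; rewrite mem_iota.
Qed.

Lemma prefix_seqS A m : prefix_seq A m.+1 = rcons (prefix_seq A m) (A m).
Proof. by rewrite /prefix_seq -[m.+1]addn1 iotaD map_cat cats1. Qed.

Lemma pointsP s z : reflect (exists2 i, i \in s & z = y i) (z \in points s).
Proof. exact: (iffP (imfsetP _ _ _ _)). Qed.

Lemma points_rcons s a : points (rcons s a) = y a |` points s.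
Proof.
apply/fsetP => z; rewrite !inE; apply/pointsP/predU1P => [[i]|].
  by rewrite mem_rcons inE => /predU1P[->|si] ->; [left|right; apply/pointsP; exists i].
case=> [->|/pointsP[i si ->]]; first by exists a; rewrite // mem_rcons mem_head.
by exists i; rewrite // mem_rcons inE si orbT.
Qed.

Hypothesis y_inj : forall i j, (i < n)%N -> (j < n)%N -> y i = y j -> i = j.
Hypothesis PE : P = points (iota 0 n).
Hypothesis DE : forall i j, (i < n)%N -> (j < n)%N -> D i j = mdist (y i) (y j).

Let ltn_seq s := {in s, forall i, (i < n)%N}.

Lemma mem_points s i : ltn_seq s -> (i < n)%N -> (y i \in points s) = (i \in s).
Proof.
move=> sn i_n; apply/pointsP/idP => [[j js e]|]; last by exists i.
by rewrite (y_inj i_n (sn j js) e).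
Qed.

Lemma card_points s : ltn_seq s -> #|` points s| = size (undup s).
Proof.
move=> sn; rewrite /points card_in_imfset //= => i j /sn i_n /sn j_n.
exact: y_inj.
Qed.

Lemma mem_P i : (i < n)%N -> y i \in P.
Proof. by move=> i_n; rewrite PE; apply/pointsP; exists i; rewrite ?mem_iota. Qed.

Lemma points_subP s : ltn_seq s -> points s `<=` P.
Proof. by move=> sn; apply/fsubsetP => _ /pointsP[i /sn i_n ->]; apply: mem_P. Qed.

Lemma ltn_iota : ltn_seq (iota 0 n).
Proof. by move=> i; rewrite mem_iota. Qed.

Lemma PP z : reflect (exists2 i, (i < n)%N & z = y i) (z \in P).
Proof.
by rewrite PE; apply: (iffP (pointsP _ _)) => -[i];
  rewrite ?mem_iota => i_n ->; exists i; rewrite ?mem_iota.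
Qed.

Lemma card_P : #|` P| = n.
Proof. by rewrite PE card_points ?undup_id ?iota_uniq ?size_iota //; apply: ltn_iota. Qed.

Lemma ltn_prefix A m : (forall l, (l < m)%N -> (A l < n)%N) -> ltn_seq (prefix_seq A m).
Proof. by move=> h i /mem_prefix_seq[l /h lt ->]. Qed.

Lemma set_distE A m z : (0 < m)%N -> (forall l, (l < m)%N -> (A l < n)%N) ->
  (z < n)%N -> set_dist D A m z = dist_to (y z) (points (prefix_seq A m)).
Proof.
move=> m0 An zn; apply/esym/dist_toP.
  have [l lm e] := min_upto_ex (fun l => D z (A l)) m0.
  exists (y (A l)); last by rewrite /set_dist e DE ?An.
  by apply/pointsP; exists (A l) => //; apply/mem_prefix_seq; exists l.
move=> _ /pointsP[_ /mem_prefix_seq[l lm ->] ->]; rewrite -DE ?An //.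
exact: (min_upto_le (fun l => D z (A l))).
Qed.

Lemma big_P (f : X -> R) : \sum_(z <- P) f z = \sum_(i <- iota 0 n) f (y i).
Proof.
rewrite PE /points big_imfset /=; last first.
  by move=> i j; rewrite !mem_iota /= => i_n j_n; apply: y_inj.
by rewrite undup_id ?iota_uniq.
Qed.

Lemma index_costE A k : (0 < k)%N -> (forall l, (l < k)%N -> (A l < n)%N) ->
  index_cost D n k A = cost P (points (prefix_seq A k)).
Proof.
move=> k0 An; rewrite /cost big_P /index_cost big_seq [RHS]big_seq.
by apply: eq_bigr => z; rewrite mem_iota => zn; apply: set_distE.
Qed.

Lemma card_cball x v : (x < n)%N ->
  #|` cball P (y x) v| = count (fun j => D x j <= v) (iota 0 n).
Proof.
move=> xn; have -> : cball P (y x) v = points [seq j <- iota 0 n | D x j <= v].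
  apply/fsetP => z; rewrite !inE; apply/andP/pointsP => [[/PP[j jn ->] d]|[j]].
    by exists j; rewrite // mem_filter mem_iota DE // d.
  rewrite mem_filter mem_iota /= => /andP[d jn] ->.
  by rewrite mem_P // -DE.
rewrite card_points ?undup_id ?filter_uniq ?iota_uniq ?size_filter //.
by move=> j; rewrite mem_filter mem_iota => /andP[].
Qed.

(** The bounds on [m] say that it is [ceil (n / k)]: a ball has at least [n / k] points exactly when
    it has at least [m]. The last conclusion says that the infimum is attained; the count of the
    critical centers relies on it. *)
Lemma fair_radiusE k m x v : (0 < k)%N -> (x < n)%N ->
  (0 < m)%N -> (m.-1 * k < n)%N -> (n <= m * k)%N -> radius_spec D n m x v ->
  [/\ fair_radius P k (y x) = v, 0 <= v & (n <= k * #|` cball P (y x) v|)%N].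
Proof.
move=> k0 xn m0 lo hi [le lt].
have kR : (0 : R) < k%:R by rewrite ltr0n.
have v0 : 0 <= v.
  have : has (fun j => D x j <= v) (iota 0 n) by rewrite has_count; apply: leq_trans le.
  by move=> /hasP[j]; rewrite mem_iota => jn; rewrite DE //; apply: le_trans (mdist_ge0 _ _).
have big : (n <= k * #|` cball P (y x) v|)%N.
  by rewrite card_cball //; apply: leq_trans hi _; rewrite mulnC leq_mul2l le orbT.
split=> //; rewrite /fair_radius card_P.
set E := (X in inf X).
have vE : E v by split=> //; rewrite ler_pdivrMr // mulrC -natrM ler_nat.
apply/eqP; rewrite eq_le; apply/andP; split.
  by apply: ge_inf vE; exists 0 => r [].
apply: lb_le_inf; first by exists v.
move=> r [r0]; rewrite ler_pdivrMr // -natrM ler_nat card_cball // => nr.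
rewrite leNgt; apply/negP => rv.
have : (count (fun j => (D x j <= r)%R) (iota 0 n) <= m.-1)%N.
  rewrite -ltnS prednK //; apply: leq_ltn_trans lt; apply: sub_count => j /= h.
  exact: le_lt_trans h rv.
move=> h; have := leq_trans nr (leq_mul h (leqnn k)); lia.
Qed.

Section Greedy.
Variables (k : nat) (alpha : R) (r : nat -> R).
Hypotheses (k0 : (0 < k)%N) (n0 : (0 < n)%N) (a1 : 1 <= alpha).
Hypothesis rE : forall x, (x < n)%N -> [/\ fair_radius P k (y x) = r x, 0 <= r x &
  (n <= k * #|` cball P (y x) (r x)|)%N].

Lemma greedy_critical cs m : greedy_centers D n alpha r cs m ->
  (forall z, (z < n)%N -> ~~ alive D alpha r cs m z) ->
  critical_centers P k alpha (points (prefix_seq cs m)).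
Proof.
move=> gr dead.
(* [critical_loop] is built from its end, so the induction is on the number [d] of rounds still to
   come. *)
suff main d : (d <= m)%N -> critical_loop P k alpha
    (points [seq z <- iota 0 n | alive D alpha r cs (m - d) z])
    (points (prefix_seq cs (m - d))) (points (prefix_seq cs m)).
  have := main m (leqnn m); rewrite subnn /critical_centers.
  by rewrite (eq_filter (a2 := predT)) // filter_predT -PE; congr critical_loop;
    apply/fsetP => z; rewrite !inE; apply/pointsP => -[].
elim: d => [_|d IH dm].
  rewrite subn0 (_ : points (seq.filter _ _) = fset0); first exact: critical_stop.
  apply/eqP; rewrite -fsubset0; apply/fsubsetP => z /pointsP[i].
  by rewrite mem_filter mem_iota => /andP[al /dead]; rewrite al.
set a := (m - d.+1)%N; have am : (a < m)%N by rewrite /a; lia.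
have eS : (m - d)%N = a.+1 by rewrite /a; lia.
have [cn al minc] := gr a am.
have filt b : ltn_seq [seq z <- iota 0 n | alive D alpha r cs b z].
  by move=> i; rewrite mem_filter mem_iota => /andP[].
apply: (@critical_step _ _ _ _ _ _ _ _ (y (cs a))).
- by rewrite mem_points // mem_filter al mem_iota.
- move=> _ /pointsP[z + ->]; rewrite mem_filter mem_iota => /andP[alz zn].
  by have [-> _ _] := rE cn; have [-> _ _] := rE zn; apply: minc.
have := IH (ltnW dm); rewrite eS prefix_seqS points_rcons.
congr critical_loop; apply/fsetP => z; rewrite !inE.
apply/pointsP/andP => [[i]|[/pointsP[i]]]; rewrite mem_filter mem_iota /= => /andP[].
  rewrite aliveS => /andP[ali lt] i_n ->; have [-> _ _] := rE i_n.
  by rewrite mem_points // mem_filter ali mem_iota -DE.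
move=> ali i_n -> lt; exists i => //.
rewrite mem_filter mem_iota i_n aliveS ali DE //= andbT.
by have [<- _ _] := rE i_n.
Qed.

(** A repeated center would be at distance 0 from its first occurrence and could not have survived
    the filter. *)
Lemma greedy_uniq cs m : greedy_centers D n alpha r cs m -> uniq (prefix_seq cs m).
Proof.
move=> gr; suff main a : (a <= m)%N -> uniq (prefix_seq cs a) by apply: main.
elim: a => // a IH am; rewrite prefix_seqS rcons_uniq IH ?(ltnW am) // andbT.
apply/negP => /mem_prefix_seq[b ba e].
have [cn /allP/(_ b) + _] := gr a am; rewrite mem_iota -e => /(_ ba).
rewrite DE // mdistxx; have [_ r0 _] := rE cn; rewrite ltNge => /negP; apply.
by rewrite !mulr_ge0 // (le_trans ler01).
Qed.

Lemma critical_centers_card Cs : critical_centers P k alpha Cs -> (#|` Cs| <= k)%N.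
Proof.
move=> cr; have a0 : 0 <= alpha by apply: le_trans a1.
have P0 : P != fset0 by rewrite -cardfs_gt0 card_P.
have [/fsubsetP CsP _ sep] := critical_centers_spec a0 P0 cr.
have radius c : c \in Cs -> 0 <= fair_radius P k c /\
    (n <= k * #|` cball P c (fair_radius P k c)|)%N.
  by move=> /CsP/PP[i i_n ->]; have [-> ? ?] := rE i_n.
(* Double counting: by separation and [1 <= alpha], each point lies in the ball of at most one
   center. *)
have sum_le : (\sum_(c <- Cs) #|` cball P c (fair_radius P k c)| <= n)%N.
  have E c : c \in Cs -> #|` cball P c (fair_radius P k c)| =
      (\sum_(i <- iota 0 n) (mdist c (y i) <= fair_radius P k c)%R)%N.
    move=> /CsP/PP[x xn ->]; rewrite card_cball // -sum1_count big_mkcond.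
    by rewrite big_seq [RHS]big_seq; apply: eq_bigr => i; rewrite mem_iota => i_n;
      rewrite DE //; case: ifP.
  rewrite big_seq (eq_bigr _ E) -big_seq exchange_big /= -[leqRHS](size_iota 0 n) -sum1_size.
  apply: leq_sum => i _.
  rewrite -(big_mkcond (fun c => mdist c (y i) <= fair_radius P k c) (fun=> 1%N)) /=.
  rewrite sum1_count; apply: count_le1 => [|c c' cC c'C d d']; first exact: fset_uniq.
  apply: contrapT => /eqP ne; have s1 := sep c c' cC c'C ne.
  have s2 := sep c' c c'C cC; rewrite eq_sym in s2; have {}s2 := s2 ne.
  have [rc _] := radius c cC; have [rc' _] := radius c' c'C.
  have t := metric_triangle c (y i) c'; rewrite [mdist (y i) c']metric_sym in t.
  rewrite [mdist c' c]metric_sym in s2.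
  have : fair_radius P k c <= alpha * fair_radius P k c by rewrite ler_peMl.
  have : fair_radius P k c' <= alpha * fair_radius P k c' by rewrite ler_peMl.
  by rewrite -!mulrA in s1 s2; lra.
rewrite -(leq_pmul2r n0); apply: leq_trans (leq_mul (leqnn k) sum_le).
rewrite big_distrr /= -sum1_size big_distrl /= big_seq [leqRHS]big_seq.
by apply: leq_sum => c /radius[_]; rewrite mul1n.
Qed.

Lemma ltn_greedy cs m : greedy_centers D n alpha r cs m ->
  forall l, (l < m)%N -> (cs l < n)%N.
Proof. by move=> gr l /gr[]. Qed.

End Greedy.

(** If the recorded maximum were 0, or the selected point already present, every point of [P] would
    be at distance 0 from a set of [s < n] points and hence belong to it. *)
Lemma farthest_choices_prefix A nc k : (0 < nc)%N -> (k <= n)%N ->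
  (forall l, (l < nc)%N -> (A l < n)%N) -> uniq (prefix_seq A nc) ->
  (forall s : nat, (nc <= s < k)%N -> farthest_choice D n A s) ->
  forall s : nat, (nc <= s <= k)%N ->
  (forall l, (l < s)%N -> (A l < n)%N) /\ uniq (prefix_seq A s).
Proof.
move=> nc0 kn An un far; elim=> [|s IH] sk; first by lia.
have [e|lt] : nc = s.+1 \/ (nc <= s)%N by lia.
  by rewrite -e.
have [An' us] := IH ltac:(lia).
have [b le [b0|[As eb]]] := far s ltac:(lia).
  have : P `<=` points (prefix_seq A s).
    apply/fsubsetP => _ /PP[z zn ->]; apply: contrapT => /negP out.
    have := le z zn; rewrite b0 set_distE //; last by lia.
    rewrite leNgt dist_to_gt0 //.
    apply/fset0Pn; exists (y (A 0%N)); apply/pointsP; exists (A 0%N) => //.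
    by apply/mem_prefix_seq; exists 0%N => //; lia.
  move/fsubset_leq_card; rewrite card_P card_points; last exact: ltn_prefix.
  by rewrite undup_id // size_map size_iota; lia.
split; first by move=> l; rewrite ltnS leq_eqVlt => /predU1P[->|/An'].
rewrite prefix_seqS rcons_uniq us andbT; apply/negP => inA.
have : P `<=` points (prefix_seq A s).
  apply/fsubsetP => _ /PP[z zn ->]; apply: contrapT => /negP out.
  have := le z zn; rewrite eb !set_distE //; try lia.
  rewrite [leRHS]dist_to_in; last by rewrite mem_points //; apply: ltn_prefix.
  rewrite leNgt dist_to_gt0 //.
  apply/fset0Pn; exists (y (A 0%N)); apply/pointsP; exists (A 0%N) => //.
  by apply/mem_prefix_seq; exists 0%N => //; lia.
move/fsubset_leq_card; rewrite card_P card_points; last exact: ltn_prefix.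
by rewrite undup_id // size_map size_iota; lia.
Qed.

Lemma farthest_choices_loop A nc k : (0 < nc)%N -> (nc <= k <= n)%N ->
  (forall l, (l < nc)%N -> (A l < n)%N) -> uniq (prefix_seq A nc) ->
  (forall s : nat, (nc <= s < k)%N -> farthest_choice D n A s) ->
  farthest_loop P (k - nc) (points (prefix_seq A nc)) (points (prefix_seq A k)).
Proof.
move=> nc0 nck An un far.
have pre := farthest_choices_prefix nc0 (k := k) ltac:(lia) An un far.
suff main d : (d <= k - nc)%N ->
    farthest_loop P d (points (prefix_seq A (k - d))) (points (prefix_seq A k)).
  by have := main (k - nc)%N (leqnn _); rewrite subKn //; lia.
elim: d => [_|d IH dk]; first by rewrite subn0; apply: farthest_stop.
set s := (k - d.+1)%N; have eS : (k - d)%N = s.+1 by rewrite /s; lia.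
have [An' us] := pre s ltac:(rewrite /s; lia).
have [AnS uS] := pre s.+1 ltac:(rewrite /s; lia).
have s0 : (0 < s)%N by rewrite /s; lia.
have As : (A s < n)%N by apply: AnS.
have out : A s \notin prefix_seq A s.
  by move: uS; rewrite prefix_seqS rcons_uniq => /andP[].
have np : ltn_seq (prefix_seq A s) by apply: ltn_prefix.
have ps0 : points (prefix_seq A s) != fset0.
  apply/fset0Pn; exists (y (A 0%N)); apply/pointsP; exists (A 0%N) => //.
  by apply/mem_prefix_seq; exists 0%N.
apply: (@farthest_step _ _ _ _ _ _ (y (A s))).
- by rewrite inE mem_points // out mem_P.
- move=> z; rewrite inE => /andP[_ /PP[i i_n ->]].
  have [b le h] := far s ltac:(rewrite /s; lia).
  rewrite -!set_distE //; apply: le_trans (le i i_n) _.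
  case: h => [->|[_ ->]] //; rewrite set_distE //; exact: dist_to_ge0.
- by rewrite -points_rcons -prefix_seqS -eS; apply: IH; lia.
Qed.
End Indexing.

(** * Correspondence between words and swaps *)

Section WordSwaps.
Local Open Scope nat_scope.

Lemma swap_word_notin n w m S p :
  (forall l, l < m -> p != w l %/ n) -> swap_word n w m S p = S p.
Proof.
elim: m => //= m IH h; rewrite (negbTE (h m (ltnSn m))).
by apply: IH => l /ltnW; apply: h.
Qed.

Lemma swap_word_lt n w m S p : 0 < n -> S p < n -> swap_word n w m S p < n.
Proof. by move=> n0 Sp; elim: m => //= m IH; case: ifP => // _; apply: ltn_pmod. Qed.

(* The last letter is repeated, so that a word of any length at least
   [size ps] performs the exchange of [ps] for [qs]. *)
Definition exchange_word (n : nat) (ps qs : seq nat) (l : nat) : nat :=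
  let l' := minn l (size ps).-1 in nth 0 ps l' * n + nth 0 qs l'.

Lemma swap_exchange_word n ps qs m S p :
  uniq ps -> size qs = size ps -> 0 < size ps -> (forall q, q \in qs -> q < n) ->
  swap_word n (exchange_word n ps qs) m S p =
  if (p \in ps) && (index p ps < m) then nth 0 qs (index p ps) else S p.
Proof.
move=> ups sz s0 qn; elim: m => [|m IH] /=; first by rewrite ltn0 andbF.
rewrite /exchange_word; set l := minn m (size ps).-1.
have ls : l < size ps by rewrite /l; lia.
have qln : nth 0 qs l < n by apply: qn; rewrite mem_nth ?sz.
have n0 : 0 < n by apply: leq_ltn_trans qln.
rewrite divnMDl // divn_small // addn0 modnMDl modn_small // IH.
case: eqP => [->|/eqP ne].
  by rewrite mem_nth // index_uniq //= /l; case: ifP => //; lia.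
case: (boolP (p \in ps)) => //= pin; have := index_mem p ps; rewrite pin => ip.
have nei : index p ps != l by apply: contraNneq ne => <-; rewrite nth_index.
by congr (if _ then _ else _); rewrite /l in nei; lia.
Qed.
End WordSwaps.

Section Swaps.
Context {R : realType} {X : metricType R}.
Variables (y : nat -> X) (n : nat) (P : {fset X}) (D : nat -> nat -> R).
Implicit Types (A S : nat -> nat) (s : seq nat).
Hypothesis y_inj : forall i j, (i < n)%N -> (j < n)%N -> y i = y j -> i = j.
Hypothesis PE : P = points y (iota 0 n).
Hypothesis DE : forall i j, (i < n)%N -> (j < n)%N -> D i j = mdist (y i) (y j).
Variables (k t nc : nat) (alpha eps : R) (r : nat -> R) (C : nat -> nat).
Hypotheses (k0 : (0 < k)%N) (kn : (k <= n)%N) (e0 : 0 < eps).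
Hypothesis rE : forall x, (x < n)%N -> fair_radius P k (y x) = r x.
Hypothesis Cn : forall l, (l < nc)%N -> (C l < n)%N.

Let pts S := points y (prefix_seq S k).
Let Cs := points y (prefix_seq C nc).
Let below S := forall l, (l < k)%N -> (S l < n)%N.
Let acc S S' := accepted D n k nc alpha eps r C S S'.
Let tt := minn t k.

Lemma card_pts S : below S -> uniq (prefix_seq S k) -> #|` pts S| = k.
Proof.
move=> Sn us; rewrite (card_points y_inj) ?undup_id ?size_map ?size_iota //.
exact: ltn_prefix.
Qed.

Lemma pts_neq0 S : pts S != fset0.
Proof.
apply/fset0Pn; exists (y (S 0%N)); apply/pointsP; exists (S 0%N) => //.
by apply/mem_prefix_seq; exists 0%N.
Qed.

Lemma feasibleE S : below S ->
  all (fun a => set_dist D S k (C a) <= alpha * r (C a)) (iota 0 nc) <->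
  feasible P k alpha Cs (pts S).
Proof.
move=> Sn; have sub : pts S `<=` P by apply: (points_subP PE); apply: ltn_prefix.
have key a : (a < nc)%N -> set_dist D S k (C a) <= alpha * r (C a) <->
    pts S `&` cball P (y (C a)) (alpha * fair_radius P k (y (C a))) != fset0.
  move=> anc; have Ca := Cn anc; rewrite (set_distE DE) // rE //; split.
    have [z zS ->] := dist_to_ex (y (C a)) (pts_neq0 S) => le.
    by apply/fset0Pn; exists z; rewrite !inE zS (fsubsetP sub) //= le.
  move=> /fset0Pn[z]; rewrite !inE => /and3P[zS _ le].
  exact: le_trans (dist_to_le _ zS) le.
split=> [/allP h|[_ h]].
  split=> // _ /pointsP[_ /mem_prefix_seq[a anc ->] ->].
  by apply/key => //; apply: h; rewrite mem_iota.
apply/allP => a; rewrite mem_iota => anc; apply/key => //; apply: h.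
by apply/pointsP; exists (C a) => //; apply/mem_prefix_seq; exists a.
Qed.

(** The swap is read off as the two set differences. They have at most [tt] points because a point
    that leaves sat at a position named by a letter, and they are nonempty because the cost strictly
    decreased. *)
Lemma accepted_improving S S' w : below S -> uniq (prefix_seq S k) -> acc S S' ->
  (forall p, (p < k)%N -> S' p = swap_word n w tt S p) ->
  [/\ below S', uniq (prefix_seq S' k) & improving_swap P k alpha t eps Cs (pts S) (pts S')].
Proof.
move=> Sn us /and4P[us' fe co lt] sw.
have n0 : (0 < n)%N by apply: leq_trans kn.
have Sn' : below S' by move=> l lk; rewrite sw //; apply: swap_word_lt => //; apply: Sn.
split=> //.
rewrite (index_costE y_inj PE DE) // (index_costE y_inj PE DE) // -/(pts S) -/(pts S') in lt.
rewrite (index_costE y_inj PE DE) // (index_costE y_inj PE DE) // -/(pts S) -/(pts S') in co.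
have c := card_pts Sn us; have c' := card_pts Sn' us'.
have e1 : (#|` pts S `\` pts S'| = #|` pts S' `\` pts S|)%N.
  by rewrite !cardfsD c c' [pts S' `&` _]fsetIC.
exists #|` pts S `\` pts S'|, (pts S `\` pts S'), (pts S' `\` pts S).
have sub' : pts S' `<=` P by apply: (points_subP PE); apply: ltn_prefix.
split; split=> //.
- apply/andP; split.
    rewrite cardfs_gt0; apply: contraTneq lt => /eqP; rewrite fsetD_eq0 => sub.
    have -> : pts S = pts S'.
      by apply/eqP; rewrite eqEfcard sub c c' leqnn.
    by rewrite ltxx.
  apply: (@leq_trans tt); last by rewrite geq_minl.
  have : pts S `\` pts S' `<=` points y [seq S (w l %/ n)%N | l <- iota 0 tt].
    apply/fsubsetP => z; rewrite inE => /andP[out /pointsP[_ /mem_prefix_seq[p pk ->] ez]].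
    apply/pointsP; exists (S p) => //; apply/mapP.
    apply: contrapT => no; case/negP: out; apply/pointsP; exists (S p) => //.
    apply/mem_prefix_seq; exists p => //; rewrite sw // swap_word_notin // => l lt'.
    by apply: contra_notN no => /eqP ->; exists l; rewrite ?mem_iota.
  move/fsubset_leq_card => /leq_trans; apply.
  rewrite /points -[leqRHS](size_iota 0) -[leqRHS](size_map (fun l => S (w l %/ n)%N)).
  by apply: leq_trans (leq_imfset_card _ _ _) _; rewrite /= size_undup.
- exact: fsubsetDl.
- exact: fsetSD.
- apply/fsetP => z; rewrite !inE.
  by case: (z \in pts S); case: (z \in pts S').
- exact/feasibleE.
Qed.

(** The positions of [T1] and the indices of [T2], each in increasing order, are paired to form the
    word. Any pairing would do, since only the resulting set counts. *)
Lemma improving_accepted S (S2 : {fset X}) : below S -> uniq (prefix_seq S k) ->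
  improving_swap P k alpha t eps Cs (pts S) S2 ->
  exists2 w, word n k tt w & acc S (swap_word n w tt S).
Proof.
move=> Sn us im; have [c2 fe PS co] := improving_swapP im.
have n0 : (0 < n)%N by apply: leq_trans kn.
case: im => i [T1 [T2 [[it T1S T2S c1 c2'] [e2 _ _]]]].
have cS := card_pts Sn us; rewrite cS in c2.
have ltn_S : {in prefix_seq S k, forall i, (i < n)%N} by apply: ltn_prefix.
pose ps := [seq p <- iota 0 k | y (S p) \in T1].
pose qs := [seq q <- iota 0 n | y q \in T2].
have Sinj p q : (p < k)%N -> (q < k)%N -> S p = S q -> p = q.
  move=> pk qk e; have nthS l : (l < k)%N -> nth 0%N (prefix_seq S k) l = S l.
    by move=> lk; rewrite (nth_map 0%N) ?size_iota // nth_iota.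
  apply/eqP; rewrite -(nth_uniq 0%N (s := prefix_seq S k)) ?size_map ?size_iota //.
  by rewrite !nthS // e.
have psk p : p \in ps -> (p < k)%N by rewrite mem_filter mem_iota => /andP[].
have qsn q : q \in qs -> (q < n)%N by rewrite mem_filter mem_iota => /andP[].
have ups : uniq ps by rewrite filter_uniq ?iota_uniq.
have uqs : uniq qs by rewrite filter_uniq ?iota_uniq.
have sp : size ps = i.
  rewrite -c1 -(size_map S); have -> : T1 = points y [seq S p | p <- ps].
    apply/fsetP => z; apply/idP/pointsP => [zT|[_ /mapP[p pin ->] ->]].
      have /pointsP[_ /mem_prefix_seq[p pk ->] e] := fsubsetP T1S z zT.
      by exists (S p) => //; apply: map_f; rewrite mem_filter -e zT mem_iota.
    by move: pin; rewrite mem_filter => /andP[].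
  rewrite (card_points y_inj); last by move=> _ /mapP[p /psk pk ->]; apply: Sn.
  by rewrite undup_id // map_inj_in_uniq // => p q /psk pk /psk qk; apply: Sinj.
have sq : size qs = i.
  rewrite -c2'; have -> : T2 = points y qs.
    apply/fsetP => z; apply/idP/pointsP => [zT|[q + ->]].
      have := fsubsetP T2S z zT; rewrite inE => /andP[_ /(PP PE)[j jn e]].
      by exists j => //; rewrite mem_filter -e zT mem_iota.
    by rewrite mem_filter => /andP[].
  by rewrite (card_points y_inj) // undup_id.
(* [T1] is part of a set of [k] points, so words of [minn t k] letters miss no swap. *)
have itt : (i <= tt)%N.
  rewrite leq_min -[X in _ && (_ <= X)%N]cS -c1 fsubset_leq_card // andbT c1.
  by case/andP: it.
have i0 : (0 < i)%N by case/andP: it.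
pose w := exchange_word n ps qs; set S' := swap_word n w tt S.
have swE p : S' p = if p \in ps then nth 0%N qs (index p ps) else S p.
  rewrite /S' swap_exchange_word ?sp ?sq //.
  case: (boolP (p \in ps)) => //= pin.
  by rewrite (leq_trans _ itt) // -sp index_mem.
have Sn' : below S'.
  by move=> l lk; apply: swap_word_lt => //; apply: Sn.
have e : pts S' = S2.
  rewrite e2; apply/fsetP => z; apply/pointsP/idP => [[_ /mem_prefix_seq[p pk ->] ->]|].
    rewrite swE !inE; case: (boolP (p \in ps)) => pin.
      have : nth 0%N qs (index p ps) \in qs by rewrite mem_nth // sq -sp index_mem.
      rewrite mem_filter => /andP[qT _]; rewrite qT orbT andbT.
      by have := fsubsetP T2S _ qT; rewrite inE => /andP[out _]; apply: contraNN out;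
        apply: (fsubsetP T1S).
    have -> : y (S p) \in pts S by apply/pointsP; exists (S p) => //; apply/mem_prefix_seq; exists p.
    by move: pin; rewrite mem_filter mem_iota pk /= andbT => ->.
  rewrite !inE => /andP[zT1 /orP[/pointsP[_ /mem_prefix_seq[p pk ->] ez]|zT2]].
    exists (S p) => //; apply/mem_prefix_seq; exists p => //; rewrite swE.
    by rewrite mem_filter -ez (negbTE zT1).
  have := fsubsetP T2S z zT2; rewrite inE => /andP[_ /(PP PE)[j jn ez]].
  have jq : j \in qs by rewrite mem_filter -ez zT2 mem_iota.
  have ji : (index j qs < size ps)%N by rewrite sp -sq index_mem.
  exists j => //; apply/mem_prefix_seq; exists (nth 0%N ps (index j qs)).
    by apply: psk; rewrite mem_nth.
  by rewrite swE mem_nth // index_uniq // nth_index.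
exists w.
  move=> l _; rewrite /w /exchange_word sp; set l' := minn l _.
  have l'i : (l' < i)%N by rewrite /l'; lia.
  have pk : (nth 0%N ps l' < k)%N by apply: psk; rewrite mem_nth ?sp.
  have qn : (nth 0%N qs l' < n)%N by apply: qsn; rewrite mem_nth ?sq.
  have := leq_mul pk (leqnn n); rewrite mulSn; lia.
have cpos : 0 < cost P (pts S).
  have /fset0Pn[z] := PS; rewrite inE => /andP[zS zP].
  exact: cost_gt0 (pts_neq0 S) zP zS.
have co2 : index_cost D n k S' <= (1 - eps) * index_cost D n k S.
  by rewrite !(index_costE y_inj PE DE) // -/(pts S) -/(pts S') e.
apply/and4P; split=> //.
(* The [k] entries enumerate a set of [k] points, so none is repeated. *)
- rewrite -/(prefix_seq S' k); apply: contraT; rewrite -ltn_size_undup.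
  rewrite -(card_points y_inj) -/(pts S'); last exact: ltn_prefix.
  by rewrite e c2 size_map size_iota ltnn.
- by apply/feasibleE => //; rewrite e.
- apply: le_lt_trans co2 _; rewrite (index_costE y_inj PE DE) // -/(pts S).
  by rewrite gtr_pMl // ltrBlDr ltrDl.
Qed.

Lemma swap_chain_run A (j : nat) : below (block k A 0) -> uniq (prefix_seq (block k A 0) k) ->
  swap_chain D n k nc tt alpha eps r C A j ->
  (forall l, (l <= j)%N -> below (block k A l) /\ uniq (prefix_seq (block k A l) k)) /\
  (forall l, (l < j)%N -> improving_swap P k alpha t eps Cs
     (pts (block k A l)) (pts (block k A l.+1))).
Proof.
move=> b0 u0 ch.
have H l : (l <= j)%N -> below (block k A l) /\ uniq (prefix_seq (block k A l) k).
  elim: l => // l IH lj; have [bl ul] := IH (ltnW lj).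
  by have [w _ [ac sw]] := ch l lj; have [] := accepted_improving bl ul ac sw.
split=> // l lj; have [bl ul] := H l (ltnW lj).
by have [w _ [ac sw]] := ch l lj; have [] := accepted_improving bl ul ac sw.
Qed.
End Swaps.

(** * The whole procedure *)

Definition search_init : cmd :=
  Seq (If (NLe tE kE) (setv 23 tE) (setv 23 kE))
    (Seq (NSet 1 (NConst 1) (NConst 0))
      (Seq (setv 19 (NConst 0)) (setv 21 (NConst 1)))).

Definition clustering : cmd :=
  Seq compute_m (Seq half_table (Seq fair_radii (Seq critical
    (Seq farthest (Seq pair_tables (Seq search_init local_loop)))))).

(** With [q = k * n], an iteration tries [q ^ minn t k] words in time of order [q] each, which is at
    most of order [q ^ t.+1]. The preparation takes time of order [q ^ 2] up to the logarithm [L],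
    and [0 < t] makes this fit. *)
Lemma total_steps_le (n k t L J T : nat) : (0 < k)%N -> (0 < n)%N ->
  (T <= 100 * n + (100 * n.+1 + (1000 * (n.+1 * n.+1 * L.+1) +
     (1000 * (n.+1 * n.+1) + (1000 * (k.+1 * k.+1 * n.+1) + (200 * (n.+1 * k.+1) +
     (100 + 4000 * (J.+1 * (n.+1 * k.+1 * ((k * n) ^ minn t k).+1)))))))))%N ->
  (0 < t)%N -> (T <= 4000 * (10 * ((k * n) ^ t.+1 * (L + J).+2)))%N.
Proof.
move=> k0 n0 TB t0; apply: leq_trans TB _.
set q := (k * n)%N; have q0 : (0 < q)%N by rewrite muln_gt0 k0.
set Y := (q ^ t.+1)%N.
have qY : (q * q <= Y)%N by rewrite mulnn (leq_pexp2l q0) // ltnS.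
have pY : (q * q ^ minn t k <= Y)%N by rewrite -expnS (leq_pexp2l q0) // ltnS geq_minl.
set Z := (q ^ minn t k)%N in pY *; have Z0 : (0 < Z)%N by rewrite expn_gt0 q0.
have nq : (n <= q)%N by rewrite leq_pmull.
have kq : (k <= q)%N by rewrite leq_pmulr.
have s1 : (n.+1 * n.+1 <= 4 * Y)%N.
  have h : (n.+1 * n.+1 <= (2 * q) * (2 * q))%N by apply: leq_mul; lia.
  by apply: leq_trans h _; lia.
have s2 : (n.+1 * k.+1 <= 4 * q)%N by rewrite /q; nia.
have s3 : (k.+1 * k.+1 * n.+1 <= 8 * Y)%N.
  have h : (k * (k * n) <= q * q)%N by rewrite leq_mul.
  apply: leq_trans (_ : 8 * (k * (k * n)) <= _)%N; last by lia.
  have k2 : (k.+1 <= 2 * k)%N by lia.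
  have n2 : (n.+1 <= 2 * n)%N by lia.
  by apply: leq_trans (leq_mul (leq_mul k2 k2) n2) _; lia.
have s4 : (n.+1 * k.+1 * Z.+1 <= 8 * Y)%N.
  by apply: leq_trans (leq_mul s2 (_ : Z.+1 <= 2 * Z)%N) _; lia.
have q_le : (q <= q * q)%N by rewrite leq_pmulr.
have s5 : (n.+1 * n.+1 * L.+1 <= 4 * Y * L.+1)%N by rewrite leq_mul2r s1 orbT.
have s6 : (J.+1 * (n.+1 * k.+1 * Z.+1) <= J.+1 * (8 * Y))%N by rewrite leq_mul2l s4 orbT.
have Y0 : (0 < Y)%N by rewrite expn_gt0 q0.
have e1 : (Y * (L + J).+2 = Y * L + Y * J + Y * 2)%N by rewrite -addn2 !mulnDr.
have e2 : (4 * Y * L.+1 = 4 * (Y * L) + 4 * Y)%N by rewrite mulnS mulnA addnC.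
have e3 : (J.+1 * (8 * Y) = 8 * (Y * J) + 8 * Y)%N by rewrite mulSn addnC mulnCA [(J * Y)%N]mulnC.
rewrite e2 in s5; rewrite e3 in s6; rewrite e1.
(* The products become variables, and what remains is linear. *)
move: s1 s2 s3 s5 s6 nq q_le qY Y0.
move: (q * q)%N (n.+1 * k.+1)%N (k.+1 * k.+1 * n.+1)%N (n.+1 * n.+1)%N
  (Y * L)%N (Y * J)%N.
by clear=> *; lia.
Qed.

(** From [2 ^ L <= 2 n] one gets [L * ln 2 <= ln 2 + ln n], and [1 / 2 <= ln 2 <= 1]; the lower
    bound is [1 + u <= expR u] at [u = - ln 2]. *)
Lemma trunc_log_le (R : realType) (n : nat) : (0 < n)%N ->
  (trunc_log 2 (n + n))%:R <= 2 + 2 * ln (n%:R : R).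
Proof.
move=> n0; set L := trunc_log 2 _.
have le : (2 ^ L <= n + n)%N by apply: trunc_logP => //; lia.
have n1 : (0 : R) < n%:R by rewrite ltr0n.
have h : ln (2 ^+ L : R) <= ln (2 * n%:R : R).
  rewrite ler_ln ?posrE ?exprn_gt0 ?mulr_gt0 //.
  by rewrite -natrX -(natrM R 2 n) ler_nat mul2n -addnn.
move: h; rewrite lnXn // lnM ?posrE // -[_ *+ L]mulr_natl.
have l1 : (1 : R) - ln 2 <= 2^-1.
  by have := expR_ge1Dx (- ln 2 : R); rewrite expRN lnK ?posrE.
have l2 : ln 2 <= (1 : R).
  by rewrite -[leRHS]expRK ler_ln ?posrE ?expR_gt0 //; have := expR_ge1Dx (1 : R).
have L0 : (0 : R) <= L%:R by [].
have : L%:R * 2^-1 <= L%:R * ln (2 : R) by rewrite ler_wpM2l //; lra.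
by move=> h1 h2; have := le_trans h1 h2; lra.
Qed.

Section Main.
Context {R : realType} {X : metricType R}.
Variables (P : {fset X}) (n k t : nat) (alpha eps : R).
Hypotheses (cP : #|` P| = n) (kn : (1 <= k <= n)%N) (a1 : 1 <= alpha)
  (t0 : (1 <= t)%N) (e0 : 0 < eps) (e1 : eps < 1).
Variable x : 'I_n -> X.
Hypothesis Px : P = [fset x i | i : 'I_n].

Let n0 : (0 < n)%N. Proof. by case/andP: kn => /leq_trans h /h. Qed.
Let k0 : (0 < k)%N. Proof. by case/andP: kn. Qed.

(** Total on naturals, like the indices of the machine; an index out of range gives the first
    point. *)
Definition point (i : nat) : X := odflt (x (Ordinal n0)) (omap x (insub i)).

Lemma pointE (i : nat) (h : (i < n)%N) : point i = x (Ordinal h).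
Proof. by rewrite /point insubT. Qed.

Lemma x_inj : injective x.
Proof.
apply/injectiveP; rewrite /injectiveb /dinjectiveb.
have eP : P = [fset z in [seq x i | i <- enum 'I_n]].
  apply/fsetP => z; rewrite Px inE; apply/imfsetP/mapP => -[i _ ->].
    by exists i; rewrite // mem_enum.
  by exists i.
apply: contraT; rewrite -ltn_size_undup -card_fseq -eP cP size_map.
by rewrite -cardT card_ord ltnn.
Qed.

Lemma point_inj i j : (i < n)%N -> (j < n)%N -> point i = point j -> i = j.
Proof. by move=> hi hj; rewrite (pointE hi) (pointE hj) => /x_inj[]. Qed.

Lemma point_P : P = points point (iota 0 n).
Proof.
apply/fsetP => z; rewrite Px; apply/imfsetP/pointsP => [[i _ ->]|[i]].
  by exists (i : nat); rewrite ?mem_iota //= (pointE (ltn_ord i)); congr x; apply: val_inj.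
by rewrite mem_iota /= => i_n ->; exists (Ordinal i_n); rewrite // (pointE i_n).
Qed.

Lemma oracle_point i j : (i < n)%N -> (j < n)%N -> oracle x i j = mdist (point i) (point j).
Proof. by move=> hi hj; rewrite (pointE hi) (pointE hj) /oracle !insubT. Qed.

Lemma stored_setE (st : @memory R) a o m :
  (forall l, (l < m)%N -> (nmem st a (o + l) < n)%N) ->
  stored_set x st a o m = points point (prefix_seq (fun l => nmem st a (o + l)%N) m).
Proof.
move=> lt; have -> : prefix_seq (fun l => nmem st a (o + l)%N) m =
    [seq nmem st a l | l <- iota o m].
  by have := iotaDl o 0 m; rewrite addn0 => ->; rewrite -map_comp.
apply/fsetP => z; apply/imfsetP/pointsP => [[i /= + ->]|[i im ->]].
  by rewrite inE => im; exists (i : nat); rewrite // (pointE (ltn_ord i)); congr x; apply: val_inj.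
have i_n : (i < n)%N.
  case/mapP: im => l; rewrite mem_iota => lm ->.
  by have := lt (l - o)%N; rewrite subnKC; [apply|]; lia.
by exists (Ordinal i_n); rewrite ?inE // (pointE i_n).
Qed.

(** Integer part of the bound in [partial_run_bound]; it is the [J] given to [runs_local_loop]. *)
Let J := Num.truncn (2 * (ln (n%:R : R) / eps)).

Lemma runs_clustering :
  runs (oracle x) clustering (input n k t alpha eps)
    (fun st => complete_run P k alpha t eps (output_centers x st)
       (output_set x k st) (output_iterations st))
    (4000 * (10 * ((k * n) ^ t.+1 * (trunc_log 2 (n + n) + J).+2))).
Proof.
have kn' : (k <= n)%N by case/andP: kn.
have DE := oracle_point; set D := oracle x in DE *.
apply: runs_le; last exact: (total_steps_le k0 n0 (leqnn _) t0).
set st0 := input n k t alpha eps.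
apply: runs_seq; first by apply: (@runs_compute_m _ D n k).
move=> st1 fr1; set m := nmem st1 10 0 => -[m0 mlo mhi].
apply: runs_seq; first by apply: (@runs_half_table _ D n); rewrite (fr1.1 0%N isT).
move=> st2 fr2 half.
apply: runs_seq.
  apply: (@runs_fair_radii _ D n m) => //.
  - by rewrite (fr2.1 0%N isT) (fr1.1 0%N isT).
  - by rewrite (fr2.1 10%N isT).
  - rewrite m0 /=; have : (m.-1 <= m.-1 * k)%N by rewrite leq_pmulr.
    lia.
move=> st3 fr3 rad; set r := rmem st3 1.
have rE z : (z < n)%N -> [/\ fair_radius P k (point z) = r z, 0 <= r z &
    (n <= k * #|` cball P (point z) (r z)|)%N].
  by move=> zn; apply: (fair_radiusE point_inj point_P DE k0 zn m0 mlo mhi); apply: rad.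
have N3 i : nmem st3 0 i = nmem st0 0 i by rewrite (fr3.1 0%N isT) (fr2.1 0%N isT) (fr1.1 0%N isT).
have R3 i : rmem st3 0 i = rmem st0 0 i by rewrite (fr3.2 0%N isT) (fr2.2 0%N isT) (fr1.2 0%N isT).
apply: runs_seq.
  apply: (@runs_critical _ D n alpha r) => // c cn.
  rewrite DE // mdistxx; have [_ rc _] := rE c cn.
  by rewrite !mulr_ge0 // (le_trans ler01).
move=> st4 fr4; set C := nmem st4 2; set nc := nmem st4 1 0 => -[gr dead].
set Cs := points point (prefix_seq C nc).
have crit : critical_centers P k alpha Cs.
  exact: (greedy_critical point_inj point_P DE k0 n0 a1 rE gr dead).
have Cn := ltn_greedy gr.
have ucs : uniq (prefix_seq C nc) := greedy_uniq DE a1 rE gr.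
have cCs : #|` Cs| = nc.
  by rewrite (card_points point_inj) ?undup_id ?size_map ?size_iota //; apply: ltn_prefix.
have nck : (nc <= k)%N.
  by rewrite -cCs; apply: (critical_centers_card point_inj point_P DE n0 a1 rE crit).
have P0 : P != fset0 by rewrite -cardfs_gt0 cP.
have nc0 : (0 < nc)%N.
  have [_ Cs0 _] := critical_centers_spec (le_trans ler01 a1) P0 crit.
  by rewrite -cCs cardfs_gt0.
apply: runs_seq.
  apply: (@runs_farthest _ D n k nc C) => //; last by rewrite nc0.
  - by rewrite (fr4.1 0%N isT) N3.
  - by rewrite (fr4.1 0%N isT) N3.
move=> st5 fr5; set A := nmem st5 3 => -[AC far].
have prefA : prefix_seq A nc = prefix_seq C nc.
  by apply/eq_in_map => l; rewrite mem_iota => /AC.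
have An l : (l < nc)%N -> (A l < n)%N by move=> lc; have -> : A l = C l := AC l lc; apply: Cn.
have uA : uniq (prefix_seq A nc) by rewrite prefA.
have [Ak uk] := farthest_choices_prefix point_inj point_P DE nc0 kn' An uA far
  (s := k) ltac:(by rewrite nck leqnn).
have init : initialization P k Cs (points point (prefix_seq A k)).
  rewrite /initialization cCs /Cs -prefA.
  apply: (farthest_choices_loop point_inj point_P DE nc0 _ An uA far).
  by rewrite nck kn'.
apply: runs_seq.
  apply: (@runs_pair_tables _ D n k) => //.
  - by rewrite (fr5.1 0%N isT) (fr4.1 0%N isT) N3.
  - by rewrite (fr5.1 0%N isT) (fr4.1 0%N isT) N3.
move=> st6 fr6 tab.
have N6 i : nmem st6 0 i = nmem st0 0 i.
  by rewrite (fr6.1 0%N isT) (fr5.1 0%N isT) (fr4.1 0%N isT) N3.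
apply: runs_seq.
  apply: (@runs_le _ _ _ _ _ (static_cost search_init) 100%N) => //.
  by apply: runs_sem; [|exact: erefl].
move=> _ /[swap] <- fr7; set st7 := sem _ _ _ in fr7 *.
set tt := minn t k.
have N7 i : nmem st7 0 i = nmem st0 0 i by rewrite (fr7.1 0%N isT) N6.
have R7 i : rmem st7 0 i = rmem st0 0 i.
  by rewrite (fr7.2 0%N isT) (fr6.2 0%N isT) (fr5.2 0%N isT) (fr4.2 0%N isT) R3.
have s7 : [/\ nmem st7 23 0 = tt, nmem st7 1 1 = 0%N, nmem st7 19 0 = 0%N,
    nmem st7 21 0 = 1%N & nmem st7 1 0 = nmem st6 1 0].
  have [N60 N61 N62] : [/\ nmem st6 0 0 = n, nmem st6 0 1 = k & nmem st6 0 2 = t].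
    by split; rewrite N6.
  by rewrite /st7 /= N61 N62 /tt; case: leqP => h /=; rewrite /update /=; split.
have [s23 s11 s19 s21 s10] := s7.
have env : search_env n k nc tt alpha eps r C st7.
  split; first by split; rewrite ?N7 ?R7.
  split=> //.
  - by rewrite s10 (fr6.1 1%N isT) (fr5.1 1%N isT).
  - by move=> i; rewrite (fr7.1 2%N isT) (fr6.1 2%N isT) (fr5.1 2%N isT).
  - by move=> i; rewrite (fr7.2 1%N isT) (fr6.2 1%N isT) (fr5.2 1%N isT) (fr4.2 1%N isT).
  - split; first by rewrite (fr7.1 24%N isT); case: tab.
    by case: tab => _ tab e /tab; rewrite (fr7.1 7%N isT) (fr7.1 8%N isT).
have A7 i : nmem st7 3 i = A i by rewrite (fr7.1 3%N isT) (fr6.1 3%N isT).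
have rE1 z : (z < n)%N -> fair_radius P k (point z) = r z by move=> /rE[].
(* Used twice: on an arbitrary chain it bounds [j] by [J], whence termination; on the final trace it
   yields the run that is output. *)
have blocks B j : (forall p, (p < k)%N -> B p = nmem st7 3 p) ->
    swap_chain D n k nc tt alpha eps r C B j ->
    (forall l, (l <= j)%N -> (forall p, (p < k)%N -> (block k B l p < n)%N) /\
        uniq (prefix_seq (block k B l) k)) /\
    partial_run P k alpha t eps Cs (fun l => points point (prefix_seq (block k B l) k)) j.
  move=> BA ch.
  have B0 p : (p < k)%N -> block k B 0 p = A p by move=> pk; rewrite /block BA // A7.
  have pB : prefix_seq (block k B 0) k = prefix_seq A k.
    by apply/eq_in_map => l; rewrite mem_iota => /B0.
  have [||bl im] := swap_chain_run point_inj point_P DE k0 kn' rE1 Cn (t := t) _ _ ch.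
  - by move=> p pk; rewrite B0 //; apply: Ak.
  - by rewrite pB.
  by split=> //; split=> //; rewrite pB.
apply: runs_mono; last exact: leqnn.
  apply: (@runs_frame _ _ _ _ _ _).
  apply: (@runs_local_loop _ D n k nc tt alpha eps r C k0 n0 kn' (geq_minr t k) nck st7 J) => //.
  move=> B j BA ch; have [_ pr] := blocks B j BA ch.
  have := partial_run_bound P0 a1 e0 e1 pr; rewrite cP => le.
  by rewrite truncn_ge_nat // (le_trans _ le).
move=> st8 [[b8 ch c8 rej] fr8]; rewrite /output_iterations; set j := nmem st8 1 1 in ch rej *.
have [bl pr] := blocks _ _ b8 ch.
have oc : output_centers x st8 = Cs.
  have e8 l : nmem st8 2 l = C l.
    by rewrite (fr8.1 2%N isT) (fr7.1 2%N isT) (fr6.1 2%N isT) (fr5.1 2%N isT).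
  rewrite /output_centers c8 stored_setE => [|l /Cn lt]; last by rewrite e8.
  by congr (points point _); apply/eq_in_map => l _; rewrite e8.
have os l : (l <= j)%N ->
    output_set x k st8 l = points point (prefix_seq (block k (nmem st8 3) l) k).
  by move=> /bl[lt _]; rewrite /output_set stored_setE.
rewrite oc; split.
  have [cr ini st] := pr; split=> //; first by rewrite os.
  by move=> l lj; rewrite !os //; [apply: st|apply: ltnW].
case=> S'; rewrite os // => im.
have [bj uj] := bl j (leqnn j).
have [w ww ac] := improving_accepted point_inj point_P DE k0 kn' e0 rE1 Cn bj uj im.
by have := rej w ww; rewrite ac.
Qed.
End Main.

Theorem theorem2 :
  exists (C1 C2 p : nat) (prog : cmd),
  forall (R : realType) (X : metricType R) (P : {fset X}) (n k t : nat)
         (alpha eps : R),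
    #|` P| = n -> (1 <= k <= n)%N -> 1 <= alpha -> (1 <= t)%N ->
    0 < eps -> eps < 1 ->
    (forall (Cs : {fset X}) (F : nat -> {fset X}) (j : nat),
        partial_run P k alpha t eps Cs F j ->
        j%:R <= C1%:R * (ln n%:R / eps)) /\
    (forall x : 'I_n -> X, P = [fset x i | i : 'I_n] ->
        exists (st : memory) (T : nat),
          [/\ exec (oracle x) prog (input n k t alpha eps) st T,
              complete_run P k alpha t eps (output_centers x st)
                (output_set x k st) (output_iterations st) &
              T%:R <= C2%:R * (1 + ln n%:R) ^+ p *
                      ((k * n)%N%:R ^+ t.+1 * eps^-1)]).
Proof.
exists 2%N, (4000 * 40)%N, 1%N, clustering => R X P n k t alpha eps cP kn a1 t0 e0 e1.
have n0 : (0 < n)%N by case/andP: kn => /leq_trans h /h.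
split=> [Cs F j run|x Px].
  by rewrite -cP; apply: partial_run_bound run => //; rewrite -cardfs_gt0 cP.
have [st [T [E le Q]]] := runs_clustering cP kn a1 t0 e0 e1 Px.
exists st, T; split=> //.
set J := Num.truncn _ in le; set L := trunc_log 2 _ in le.
have l0 : 0 <= ln (n%:R : R) by rewrite ln_ge0 // ler1n.
have i1 : 1 <= eps^-1 by rewrite invf_ge1 // ltW.
have JR : J%:R <= 2 * (ln (n%:R : R) * eps^-1).
  by rewrite truncn_le // mulr_ge0 // divr_ge0 // ltW.
have LR : L%:R <= 2 + 2 * ln (n%:R : R) by apply: trunc_log_le.
(* Only [J] carries the factor [1 / eps], but [1 / eps >= 1] lets the other terms take it as well.
   The 4 here and the [4000 * 10] steps make up the constant [4000 * 40]. *)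
have LJ : ((L + J).+2)%:R <= 4 * ((1 + ln (n%:R : R)) * eps^-1).
  have : ln (n%:R : R) <= ln (n%:R : R) * eps^-1 by rewrite ler_peMr.
  by rewrite -addn2 !natrD mulrDl mul1r; lra.
move: le; rewrite -(ler_nat R) => /le_trans; apply.
rewrite !(natrM, natrX) expr1.
set Y := (_ ^+ t.+1); have Y0 : 0 <= Y by rewrite exprn_ge0 // ler0n.
have -> : 4000 * 40 * (1 + ln (n%:R : R)) * (Y * eps^-1) =
    4000 * (10 * (Y * (4 * ((1 + ln (n%:R : R)) * eps^-1)))) by ring.
apply: ler_wpM2l; first exact: ler0n.
apply: ler_wpM2l; first exact: ler0n.
exact: ler_wpM2l.
Qed.
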